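(* Let $d>2$ be an odd square-free integer all of whose prime divisors are congruent to $1\pmod 8$, and let $r$ be the number of distinct prime divisors of $d$. Then the $2$-rank $r_2(d)$ of the class group of $L_d=\mathbb{Q}(\zeta_8,\sqrt d)$ satisfies $$r_2(d)=4r-1-e_d.$$
   Context: $\zeta_8$ is a primitive $8$-th root of unity, $K=\mathbb{Q}(\zeta_8)$, $L_d=K(\sqrt d)$, $E_K$ is the unit group of $K$, $N$ is the norm map of $L_d/K$, and $e_d$ is the integer defined by $(E_K:E_K\cap N(L_d^{*}))=2^{e_d}$. The $2$-rank of the class group is $\dim_{\mathbb{F}_2}\mathrm{Cl}(L_d)/\mathrm{Cl}(L_d)^2$. *)

(* Defs.v *)
From HB Require Import structures.
From mathcomp Require Import all_boot all_order all_algebra all_field.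
From mathcomp Require Import boolp classical_sets functions cardinality.

Set Implicit Arguments.
Unset Strict Implicit.
Unset Printing Implicit Defensive.

Import GRing.Theory.
Local Open Scope classical_set_scope.
Local Open Scope card_scope.
Local Open Scope quotient_scope.
Local Open Scope ring_scope.

Definition squarefree (n : nat) : Prop :=
  forall m : nat, (m ^ 2 %| n)%N -> m = 1%N.

(* For multiplicative subgroups H <= G of the nonzero elements of L: the set
   of cosets xH with x in G has n elements. *)
Definition index_eq (L : fieldType) (G H : set L) (n : nat) : Prop :=
  [set [set x * h | h in H] | x in G] #= `I_n.

Section NumberField.

Variable L : fieldExtType rat.

Definition is_integral (x : L) : Prop := integralOver (intr : int -> L) x.

(* The unit group of the ring of integers of the subfield K of L. *)
Definition unit_group (K : {subfield L}) : set L :=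
  [set u | [/\ u \in K, u != 0, is_integral u & is_integral u^-1]].

Definition ring_of_integers : set L := [set x | is_integral x].

Record is_submodule (I : set L) : Prop := IsSubmodule {
  submodule0 : I 0;
  submoduleD : forall x y, I x -> I y -> I (x + y);
  submoduleM : forall a x, is_integral a -> I x -> I (a * x) }.

Definition is_fractional (I : set L) : Prop :=
  is_submodule I /\
  exists c, [/\ c != 0, is_integral c & forall x, I x -> is_integral (c * x)].

Definition ideal_mul (I J : set L) : set L :=
  [set x | exists s : seq (L * L),
     (forall u, u \in s -> I u.1 /\ J u.2) /\ x = \sum_(u <- s) u.1 * u.2].

(* The group of fractional ideals is taken to be the group of invertible
   elements of the monoid of fractional ideals; as the ring of integers is a
   Dedekind domain, these are all the nonzero fractional ideals. *)
Record frac_ideal : Type := FracIdeal {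
  ideal_set : set L;
  ideal_inv : set L;
  ideal_setP : is_fractional ideal_set;
  ideal_invP : is_fractional ideal_inv;
  ideal_mulV : ideal_mul ideal_set ideal_inv = ring_of_integers }.

Lemma ideal_mul_incl (I J K : set L) : is_submodule K ->
  (forall x y, I x -> J y -> K (x * y)) -> ideal_mul I J `<=` K.
Proof.
move=> [K0 KD _] IJK _ [s [sIJ ->]]; elim: s sIJ => [|u s IHs] sIJ.
  by rewrite big_nil.
rewrite big_cons; apply: KD.
  by have [] := sIJ u (mem_head _ _); apply: IJK.
by apply: IHs => v vs; apply: sIJ; rewrite inE vs orbT.
Qed.

Lemma ideal_mul_mem (I J : set L) x y : I x -> J y -> ideal_mul I J (x * y).
Proof.
move=> Ix Jy; exists [:: (x, y)]; split; last by rewrite big_seq1.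
by move=> u; rewrite inE => /eqP->.
Qed.

Lemma ideal_mulC (I J : set L) : ideal_mul I J = ideal_mul J I.
Proof.
suff sub A B : ideal_mul A B `<=` ideal_mul B A.
  by apply/seteqP; split; apply: sub.
move=> _ [s [sAB ->]]; exists [seq (u.2, u.1) | u <- s]; split.
  by move=> _ /mapP[u us ->] /=; have [] := sAB u us.
by rewrite big_map; apply: eq_bigr => u _; rewrite mulrC.
Qed.

Lemma ideal_mul_submodule (I J : set L) :
  is_submodule I -> is_submodule (ideal_mul I J).
Proof.
move=> [_ _ IM]; split.
- by exists [::]; split=> //; rewrite big_nil.
- move=> _ _ [s [sP ->]] [t [tP ->]]; exists (s ++ t); split.
    by move=> u; rewrite mem_cat => /orP[]; [apply: sP | apply: tP].
  by rewrite big_cat.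
- move=> a _ aint [s [sP ->]]; exists [seq (a * u.1, u.2) | u <- s]; split.
    by move=> _ /mapP[u us ->] /=; have [/(IM _ _ aint)] := sP u us.
  by rewrite big_map mulr_sumr; apply: eq_bigr => u _; rewrite mulrA.
Qed.

Lemma ring_of_integers_submodule : is_submodule ring_of_integers.
Proof.
split; first exact: integral0.
  by move=> x y; apply: integral_add.
by move=> a x; apply: integral_mul.
Qed.

Lemma ring_of_integers_fractional : is_fractional ring_of_integers.
Proof.
split; first exact: ring_of_integers_submodule.
by exists 1; split; [apply: oner_neq0 | apply: integral1 | move=> x; rewrite mul1r].
Qed.

Lemma ideal_mul_fractional (I J : set L) :
  is_fractional I -> is_fractional J -> is_fractional (ideal_mul I J).
Proof.
move=> [Isub [a [a0 aint aI]]] [_ [b [b0 bint bJ]]].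
split; first exact: ideal_mul_submodule.
exists (a * b); split; [by rewrite mulf_neq0 | exact: integral_mul |].
move=> _ [s [sP ->]]; rewrite mulr_sumr.
elim: s sP => [|u s IHs] sP; first by rewrite big_nil; apply: integral0.
rewrite big_cons; apply: integral_add.
  have [/aI iu /bJ ju] := sP u (mem_head _ _).
  by rewrite mulrACA; apply: integral_mul.
by apply: IHs => v vs; apply: sP; rewrite inE vs orbT.
Qed.

Lemma ideal_mul1 (I : set L) :
  is_submodule I -> ideal_mul ring_of_integers I = I.
Proof.
move=> Isub; apply/seteqP; split.
  by apply: ideal_mul_incl => // x y; apply: submoduleM.
by move=> x Ix; rewrite -[x]mul1r; apply: ideal_mul_mem => //; apply: integral1.
Qed.

Lemma ideal_mulA (I J K : set L) :
  is_submodule I -> is_submodule J -> is_submodule K ->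
  ideal_mul I (ideal_mul J K) = ideal_mul (ideal_mul I J) K.
Proof.
suff sub A B C : is_submodule A -> is_submodule B -> is_submodule C ->
    ideal_mul A (ideal_mul B C) `<=` ideal_mul (ideal_mul A B) C.
  move=> sI sJ sK; apply/seteqP; split; first exact: sub.
  rewrite (ideal_mulC _ K) (ideal_mulC I J) (ideal_mulC I) (ideal_mulC J K).
  exact: sub.
move=> sA sB sC; apply: ideal_mul_incl.
  by apply: ideal_mul_submodule; apply: ideal_mul_submodule.
move=> x _ Ax [s [sP ->]]; rewrite mulr_sumr.
exists [seq (x * u.1, u.2) | u <- s]; split.
  move=> _ /mapP[u us ->] /=; have [Bu Cu] := sP u us.
  by split=> //; apply: ideal_mul_mem.
by rewrite big_map; apply: eq_bigr => u _; rewrite mulrA.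
Qed.

Lemma ideal_inv_unique (I J K : set L) :
  is_submodule I -> is_submodule J -> is_submodule K ->
  ideal_mul I J = ring_of_integers -> ideal_mul I K = ring_of_integers -> J = K.
Proof.
move=> sI sJ sK IJ IK.
by rewrite -(ideal_mul1 sJ) -IK (ideal_mulC I) -ideal_mulA // IJ ideal_mulC ideal_mul1.
Qed.

Lemma frac_ideal_eq (I J : frac_ideal) : ideal_set I = ideal_set J -> I = J.
Proof.
case: I J => [I I' If I'f II'] [J J' Jf J'f JJ'] /= eIJ; subst J.
have eI' : I' = J'.
  exact: (ideal_inv_unique (proj1 If) (proj1 I'f) (proj1 J'f)).
by subst J'; congr FracIdeal; apply: Prop_irrelevance.
Qed.

HB.instance Definition _ := gen_eqMixin frac_ideal.
HB.instance Definition _ := gen_choiceMixin frac_ideal.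

Definition frac_one : frac_ideal :=
  FracIdeal ring_of_integers_fractional ring_of_integers_fractional
            (ideal_mul1 ring_of_integers_submodule).

Lemma frac_opp_subproof (I : frac_ideal) :
  ideal_mul (ideal_inv I) (ideal_set I) = ring_of_integers.
Proof. by rewrite ideal_mulC ideal_mulV. Qed.

Definition frac_opp (I : frac_ideal) : frac_ideal :=
  FracIdeal (ideal_invP I) (ideal_setP I) (frac_opp_subproof I).

Lemma frac_add_subproof (I J : frac_ideal) :
  ideal_mul (ideal_mul (ideal_set I) (ideal_set J))
            (ideal_mul (ideal_inv I) (ideal_inv J)) = ring_of_integers.
Proof.
case: I J => [I I' [sI ?] [sI' ?] II'] [J J' [sJ ?] [sJ' ?] JJ'] /=.
have sub := ideal_mul_submodule.
rewrite (ideal_mulC I J) -ideal_mulA ?(ideal_mulA sI) //; try exact: sub.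
by rewrite II' ideal_mul1.
Qed.

Definition frac_add (I J : frac_ideal) : frac_ideal :=
  FracIdeal (ideal_mul_fractional (ideal_setP I) (ideal_setP J))
            (ideal_mul_fractional (ideal_invP I) (ideal_invP J))
            (frac_add_subproof I J).

Lemma frac_addA : associative frac_add.
Proof.
move=> I J K; apply: frac_ideal_eq => /=.
by apply: ideal_mulA; apply: (proj1 (ideal_setP _)).
Qed.

Lemma frac_addC : commutative frac_add.
Proof. by move=> I J; apply: frac_ideal_eq; apply: ideal_mulC. Qed.

Lemma frac_add0 : left_id frac_one frac_add.
Proof.
by move=> I; apply: frac_ideal_eq; apply: ideal_mul1; apply: (proj1 (ideal_setP I)).
Qed.

Lemma frac_addN : left_inverse frac_one frac_opp frac_add.
Proof. by move=> I; apply: frac_ideal_eq; apply: frac_opp_subproof. Qed.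

(* The multiplicative groups of ideals and of ideal classes are written
   additively, so as to use zmodType quotients. *)
HB.instance Definition _ :=
  GRing.isZmodule.Build frac_ideal frac_addA frac_addC frac_add0 frac_addN.

Definition principal : {pred frac_ideal} := fun I =>
  `[< exists2 a, a != 0 & ideal_set I = [set a * x | x in ring_of_integers] >].

Lemma principal_closed : zmod_closed principal.
Proof.
split.
  apply/asboolP; exists 1; first exact: oner_neq0.
  apply/seteqP; split=> x /=; first by exists x; rewrite ?mul1r.
  by case=> y oy <-; rewrite mul1r.
move=> I J /asboolP[a a0 eI] /asboolP[b b0 eJ].
apply/asboolP; exists (a / b); first by rewrite mulf_neq0 ?invr_neq0.
have eV : ideal_inv J = [set b^-1 * x | x in ring_of_integers].
  apply/seteqP; split=> [y Jy|].
    exists (b * y); last by rewrite mulKf.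
    rewrite -(ideal_mulV J); apply: ideal_mul_mem => //.
    by rewrite eJ; exists 1; [apply: integral1 | rewrite mulr1].
  suff Jb : ideal_inv J b^-1.
    move=> _ [x xint <-]; rewrite mulrC.
    by apply: submoduleM => //; case: (ideal_invP J).
  have : ring_of_integers 1 by apply: integral1.
  rewrite -(ideal_mulV J) => -[s [sP e1]].
  rewrite -[b^-1]mulr1 e1 mulr_sumr.
  have [sJ _] := ideal_invP J.
  elim: s sP {e1} => [|u s IHs] sP; first by rewrite big_nil; case: sJ.
  rewrite big_cons; apply: submoduleD => //.
    have [] := sP u (mem_head _ _); rewrite eJ => -[x xint <-] Ju.
    by rewrite -mulrA mulKf //; apply: submoduleM.
  by apply: IHs => v vs; apply: sP; rewrite inE vs orbT.
rewrite /= eI eV; apply/seteqP; split.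
  move=> _ [s [sP ->]]; elim: s sP => [|u s IHs] sP.
    by rewrite big_nil; exists 0; [apply: integral0 | rewrite mulr0].
  rewrite big_cons.
  have [v vs|w wint <-] := IHs; first by apply: sP; rewrite inE vs orbT.
  have [[x xint <-] [y yint <-]] := sP u (mem_head _ _).
  exists (x * y + w); last by rewrite mulrDr mulrACA.
  by apply: integral_add => //; apply: integral_mul.
move=> _ [x xint <-]; rewrite -mulrA.
apply: ideal_mul_mem; last by exists x.
by exists 1; [apply: integral1 | rewrite mulr1].
Qed.

HB.instance Definition _ := GRing.isZmodClosed.Build frac_ideal principal
  principal_closed.

Definition class_group : zmodType := Quotient.quot principal.

End NumberField.

Section TwoRank.

Variable A : zmodType.

Definition doubles : {pred A} := fun x => `[< exists y, x = y + y >].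

Lemma doubles_closed : zmod_closed doubles.
Proof.
split; first by apply/asboolP; exists 0; rewrite addr0.
move=> _ _ /asboolP[x ->] /asboolP[y ->]; apply/asboolP; exists (x - y).
by rewrite opprD addrACA.
Qed.

HB.instance Definition _ := GRing.isZmodClosed.Build A doubles doubles_closed.

(* A / 2A, that is C / C^2 for an abelian group C written multiplicatively *)
Definition mod_doubles : Type := Quotient.quot doubles.

HB.instance Definition _ := GRing.Zmodule.on mod_doubles.

Lemma mod_doubles_addxx (x : mod_doubles) : x + x = 0.
Proof.
rewrite -[x]reprK -raddfD -(raddf0 (\pi_mod_doubles)).
apply/eqP; rewrite -Quotient.idealrBE subr0.
by apply/asboolP; exists (repr x).
Qed.

Definition mod_doubles_scale (a : 'F_2) (x : mod_doubles) : mod_doubles :=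
  x *+ (a : nat).

Lemma mod_doubles_mulrn_mod (x : mod_doubles) n : x *+ (n %% 2) = x *+ n.
Proof.
rewrite [in RHS](divn_eq n 2) mulrnDr mulnC mulrnA mulr2n mod_doubles_addxx.
by rewrite mul0rn add0r.
Qed.

Lemma mod_doubles_scaleA a b x :
  mod_doubles_scale a (mod_doubles_scale b x) = mod_doubles_scale (a * b) x.
Proof. by rewrite /mod_doubles_scale /= mod_doubles_mulrn_mod -mulrnA mulnC. Qed.

Lemma mod_doubles_scale1 : left_id 1 mod_doubles_scale.
Proof. by []. Qed.

Lemma mod_doubles_scaleDr : right_distributive mod_doubles_scale +%R.
Proof. by move=> a x y; apply: mulrnDl. Qed.

Lemma mod_doubles_scaleDl x :
  {morph mod_doubles_scale^~ x : a b / a + b}.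
Proof.
by move=> a b; rewrite /mod_doubles_scale /= mod_doubles_mulrn_mod mulrnDr.
Qed.

HB.instance Definition _ := GRing.Zmodule_isLmodule.Build 'F_2 mod_doubles
  mod_doubles_scaleA mod_doubles_scale1 mod_doubles_scaleDr mod_doubles_scaleDl.

(* Vector.axiom n V is the type of linear isomorphisms V -> 'rV_n. *)
Definition two_rank_eq (n : nat) : Prop :=
  inhabited (Vector.axiom n mod_doubles).

End TwoRank.

Section RelativeNorm.

Variable L : splittingFieldType rat.

Definition norm_group (K : {subfield L}) : set L :=
  [set galNorm K {:L} x | x in [set x | x != 0]].

End RelativeNorm.

(* Main.v *)
(* For an ideal J of L, the ideal J * s(J) is generated by an element of K, because
   Z[zeta_8] is Euclidean. Hence s acts on the class group C as inversion, and,
   C being finite, |C/C^2| = |C[2]| is the number of ambiguous classes. This number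
   is computed with Chevalley's argument: an ambiguous class J/s(J) = (x) yields
   the unit N(x), modulo norms of units; when N(x) is the norm of a unit, the class
   contains an ambiguous ideal (Hilbert 90). Modulo ideals of K, the ambiguous ideals
   are the (a, sqrt d) for the 2^(4r) divisors a of d in Z[zeta_8] (2 is unramified,
   as d = 1 mod 4), and those which are principal correspond to H^1 of the units of L.
   What remains is the Herbrand quotient of these units. Up to finite index they
   are generated by the Pell units of Q(sqrt 2), Q(sqrt d) and Q(sqrt (2d)), because
   the fourth power of a unit is a product of units of quadratic fields. *)
From HB Require Import structures.
Require Import Defs.
From mathcomp Require Import all_boot all_order all_algebra all_field.
From mathcomp Require Import boolp classical_sets cardinality.
From mathcomp Require Import ring lra zify.

Set Implicit Arguments.
Unset Strict Implicit.
Unset Printing Implicit Defensive.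

Import Order.TTheory GRing.Theory Num.Theory.
Local Open Scope classical_set_scope.
Local Open Scope ring_scope.

(** * Indices of subgroups *)

(** Let E be the unit group of L, E^- its elements with x s(x) = 1, and m the index of N(E) among
    the units of K that are norms from L. The index m is never computed: it cancels. The order of
    C[2] is m k, where 2^(4r) = k (E^- : E^(1-s)). Under 1+s the preimage in E of E_K^2 is E_K E^-,
    and under 1-s this is also the preimage of (E^-)^2. Hence (E_K : N E) and (E^- : E^(1-s)) are in
    the ratio of (E_K : E_K^2) = 4 to (E^- : (E^-)^2) = 8. Since (E_K : N E) = 2^e m, the order of
    C[2] is 2^(4r-1-e). The numbers 4 and 8 come from ranks 1 and 2: among the quadratic fields that
    occur for E_K only Q(sqrt 2) is real, while for E^- both Q(sqrt d) and Q(sqrt(2d)) are. The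
    exponent 4r is due to the splitting of a prime p = 1 mod 8 into four primes of Z[zeta_8]. Ideals
    and nonzero elements form infinite groups, so the whole count is carried by finite indices
    between their subgroups, with both groups written additively. *)

Definition is_subgroup (M : zmodType) (G : set M) : Prop :=
  G 0 /\ forall x y, G x -> G y -> G (x - y).

(** Cosets are given by representatives [t i], so that indices inside infinite groups are compared
    without forming quotients. *)
Definition has_index (M : zmodType) (G H : set M) (n : nat) : Prop :=
  exists (T : finType) (t : T -> M),
    [/\ #|T| = n, forall i, G (t i), forall i j, H (t i - t j) -> i = j
      & forall x, G x -> exists i, H (x - t i)].

Section Subgroup.

Variables (M : zmodType) (G : set M).
Hypothesis sG : is_subgroup G.

Lemma subgroup0 : G 0. Proof. by case: sG. Qed.

Lemma subgroupB x y : G x -> G y -> G (x - y).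
Proof. by case: sG => _; apply. Qed.

Lemma subgroupN x : G x -> G (- x).
Proof. by move=> Gx; rewrite -sub0r; apply: subgroupB => //; apply: subgroup0. Qed.

Lemma subgroupD x y : G x -> G y -> G (x + y).
Proof. by move=> Gx Gy; rewrite -[y]opprK; apply/subgroupB/subgroupN. Qed.

Lemma subgroup_mulrn x n : G x -> G (x *+ n).
Proof.
move=> Gx; elim: n => [|n IHn]; first exact: subgroup0.
by rewrite mulrS; apply: subgroupD.
Qed.

Lemma subgroupBC x y : G (x - y) -> G (y - x).
Proof. by move=> /subgroupN; rewrite opprB. Qed.

Lemma subgroupDK x y : G y -> G (x + y) -> G x.
Proof. by move=> Gy Gxy; rewrite -[x](addrK y); apply: subgroupB. Qed.

Lemma subgroupBB x y z : G (x - z) -> G (y - z) -> G (x - y).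
Proof. by move=> xz /(subgroupB xz); rewrite opprB addrA subrK. Qed.

End Subgroup.

Section Index.

Variable M : zmodType.
Implicit Types G H K : set M.

Lemma has_index_le G H m n : is_subgroup H ->
  has_index G H m -> has_index G H n -> (m <= n)%N.
Proof.
move=> sH [S [s [<- sG sI _]]] [T [t [<- _ _ tC]]].
have [f fP] := choice (fun i => tC _ (sG i)).
apply: (@leq_card _ _ f) => i j fij; apply: sI.
by apply: (subgroupBB sH (fP i)); rewrite fij; apply: fP.
Qed.

Lemma has_index_uniq G H m n : is_subgroup H ->
  has_index G H m -> has_index G H n -> m = n.
Proof.
by move=> sH Gm Gn; apply/eqP; rewrite eqn_leq !(has_index_le sH Gm Gn, has_index_le sH Gn Gm).
Qed.

Lemma has_index_gt0 G H n : G 0 -> has_index G H n -> (0 < n)%N.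
Proof.
by move=> G0 [T [t [<- _ _ tC]]]; have [i _] := tC 0 G0; apply/card_gt0P; exists i.
Qed.

(** The map [f] may vary on a coset. Each coset is therefore labelled by the set [c x] of all values
    that [f] takes on it; labels of distinct cosets are disjoint. *)
Lemma has_index_finite G H (T : finType) (f : M -> T) : is_subgroup H ->
  (forall x y, G x -> G y -> f x = f y -> H (x - y)) ->
  exists n, has_index G H n.
Proof.
move=> sH fH.
pose c x : {set T} := [set i | `[< exists y, [/\ G y, f y = i & H (x - y)] >]]%SET.
have cP x y : G x -> G y -> c x = c y <-> H (x - y).
  move=> Gx Gy; split=> [cxy|Hxy].
    have : f x \in c x.
      by rewrite inE; apply/asboolP; exists x; rewrite subrr; split=> //; case: sH.
    rewrite cxy inE => /asboolP[z [Gz fzx Hyz]].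
    exact: subgroupBB (fH _ _ Gx Gz (esym fzx)) Hyz.
  apply/setP => i; rewrite !inE; apply/asboolP/asboolP => -[z [Gz fz Hz]]; exists z; split=> //.
    by apply: (subgroupBB sH (subgroupBC sH Hxy)); apply: subgroupBC.
  by apply: (subgroupBB sH Hxy); apply: subgroupBC.
pose T' := {s : {set T} | `[< exists2 x, G x & c x = s >]}.
have [t tP] : exists t : T' -> M, forall s, G (t s) /\ c (t s) = val s.
  have ex (s : T') : exists x, G x /\ c x = val s.
    by case: s => s /= /asboolP[x Gx cx]; exists x.
  by have [t tP] := choice ex; exists t.
exists #|{: T'}|, T', t; split=> // [s | s s' Hss' | x Gx].
- by case: (tP s).
- have [[Gs cs] [Gs' cs']] := (tP s, tP s'); apply: val_inj.
  by rewrite -cs -cs'; apply/cP.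
- have px : `[< exists2 y, G y & c y = c x >] by apply/asboolP; exists x.
  by exists (exist _ (c x) px); apply/cP => //; case: (tP (exist _ (c x) px)).
Qed.

Lemma has_indexM G H K m n : is_subgroup G -> is_subgroup H -> is_subgroup K ->
  (forall x, K x -> H x) -> (forall x, H x -> G x) ->
  has_index G H m -> has_index H K n -> has_index G K (m * n).
Proof.
move=> sG sH sK KH HG [S [s [<- sS sI sC]]] [T [t [<- tT tI tC]]].
exists (S * T)%type, (fun u => s u.1 + t u.2); split.
- exact: card_prod.
- by move=> u; apply: subgroupD => //; apply/HG/tT.
- move=> [i j] [i' j'] /=; rewrite opprD addrACA => /[dup] kk /KH hh.
  have eii : i = i'.
    by apply/sI/(subgroupDK sH _ hh)/(subgroupB sH); apply: tT.
  by move: kk; rewrite eii subrr add0r => /tI->.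
- move=> x /sC[i /tC[j Kij]]; exists (i, j) => /=.
  by rewrite opprD addrA.
Qed.

(** A finite labelling of G modulo K also labels G modulo H and H modulo K, so both indices exist;
    uniqueness of the index of K in G gives the product. *)
Lemma has_index_split G H K n : is_subgroup G -> is_subgroup H -> is_subgroup K ->
  (forall x, K x -> H x) -> (forall x, H x -> G x) -> has_index G K n ->
  exists a b, [/\ has_index G H a, has_index H K b & n = (a * b)%N].
Proof.
move=> sG sH sK KH HG GKn; have [T [t [_ _ _ tC]]] := GKn.
(* [None] is only a default value outside G. *)
have [f fP] : exists f : M -> option T, forall x, G x -> exists2 i, f x = Some i & K (x - t i).
  have [|f fP] := @choice _ _ (fun x o => G x -> exists2 i, o = Some i & K (x - t i)).
    move=> x; have [/tC[i Ki]|nGx] := pselect (G x); last by exists None.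
    by exists (Some i); exists i.
  by exists f.
have fK x y : G x -> G y -> f x = f y -> K (x - y).
  move=> /fP[i -> Ki] /fP[j -> Kj] [eij]; rewrite eij in Ki.
  exact: subgroupBB Ki Kj.
have [|a Ga] := @has_index_finite G H _ f sH; first by move=> x y Gx Gy /fK fxy; apply/KH/fxy.
have [|b Hb] := @has_index_finite H K _ f sK; first by move=> x y Hx Hy; apply: fK; apply: HG.
exists a, b; split=> //.
exact: (has_index_uniq sK GKn (has_indexM sG sH sK KH HG Ga Hb)).
Qed.

End Index.

(* An additive correspondence between G and G' that matches H with H'
   identifies G/H with G'/H'. *)
Lemma has_index_corr (M M' : zmodType) (G H : set M) (G' H' : set M')
    (R : M -> M' -> Prop) n :
  (forall x y x' y', R x x' -> R y y' -> R (x - y) (x' - y')) ->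
  (forall x, G x -> exists2 x', G' x' & R x x') ->
  (forall x', G' x' -> exists2 x, G x & R x x') ->
  (forall x x', R x x' -> H x <-> H' x') ->
  has_index G H n -> has_index G' H' n.
Proof.
move=> RB GG' G'G HH' [T [t [<- tT tI tC]]].
have [t' t'P] : exists t', forall i, G' (t' i) /\ R (t i) (t' i).
  have [|t' t'P] := @choice T M' (fun i x' => G' x' /\ R (t i) x').
    by move=> i; have [x'] := GG' _ (tT i); exists x'.
  by exists t'.
exists T, t'; split=> //.
- by move=> i; case: (t'P i).
- move=> i j; have [[_ Ri] [_ Rj]] := (t'P i, t'P j).
  by move=> H'ij; apply: tI; apply/(HH' _ _ (RB _ _ _ _ Ri Rj)).
- move=> x' /G'G[x /tC[i Hi] Rx]; exists i.
  by have [_ Ri] := t'P i; apply/(HH' _ _ (RB _ _ _ _ Rx Ri)).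
Qed.

(** * The 2-rank as the exponent of an index *)

Section FiniteF2Space.

Variable V : lmodType 'F_2.

Lemma F2_neq0 (a : 'F_2) : a != 0 -> a = 1.
Proof. by case: a => [[|[|a]] // lt_a] _; apply: val_inj. Qed.

(** Induction on the number of generators: if they are independent, coordinates give the
    isomorphism; otherwise a relation has a coefficient equal to 1, and that generator is
    dropped. *)
Lemma F2_finite_vector (n : nat) (v : 'I_n -> V) :
  (forall x, exists c : 'I_n -> 'F_2, x = \sum_i c i *: v i) ->
  exists m, inhabited (Vector.axiom m V).
Proof.
elim: n v => [|n IHn] v v_gen.
  exists 0; constructor; exists (fun _ => 0).
    by move=> a x y; rewrite scaler0 addr0.
  exists (fun _ => 0) => [x|r]; last by apply/rowP => -[].
  by have [c ->] := v_gen x; rewrite big_ord0.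
have [inj|] := pselect (forall c : 'I_n.+1 -> 'F_2, \sum_i c i *: v i = 0 -> forall i, c i = 0).
  have [f fP] := choice v_gen.
  exists n.+1; constructor; exists (fun x => \row_i f x i).
    move=> a x y; apply/rowP => i; rewrite !mxE; apply/eqP; rewrite -subr_eq0; apply/eqP.
    move: i; apply: inj.
    have -> : \sum_i (f (a *: x + y) i - (a * f x i + f y i)) *: v i =
       \sum_i f (a *: x + y) i *: v i - (a *: \sum_i f x i *: v i + \sum_i f y i *: v i).
      rewrite scaler_sumr -big_split -sumrB; apply: eq_bigr => i _ /=.
      by rewrite scalerBl scalerDl scalerA.
    by rewrite -!fP subrr.
  exists (fun r : 'rV_n.+1 => \sum_i r 0 i *: v i) => [x|r].
    by rewrite [in RHS](fP x); apply: eq_bigr => i _; rewrite mxE.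
  apply/rowP => i; rewrite mxE; apply/eqP; rewrite -subr_eq0; apply/eqP.
  move: i; apply: inj.
  by under eq_bigr do rewrite scalerBl; rewrite sumrB -fP subrr.
move=> /existsNP[c /not_implyP[c0 /existsNP[i /eqP/F2_neq0 ci]]].
apply: (IHn (fun j => v (lift i j))) => x.
have [b ->] := v_gen x.
exists (fun j => b (lift i j) - b i * c (lift i j)).
have vi : v i = - \sum_j c (lift i j) *: v (lift i j).
  by move: c0; rewrite (bigD1_ord i) //= ci scale1r => /eqP; rewrite addr_eq0 => /eqP.
rewrite (bigD1_ord i) //= vi scalerN -scaleNr scaler_sumr -big_split.
by apply: eq_bigr => j _ /=; rewrite scalerA -scalerDl mulNr addrC.
Qed.

End FiniteF2Space.

(** The coset representatives span A/2A, which makes it a space of some finite dimension k; counting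
    its elements in two ways gives 2^k = 2^m. *)
Lemma two_rank_of_index (A : zmodType) (m : nat) :
  has_index [set: A] [set x | exists y, x = y + y] (2 ^ m) -> two_rank_eq A m.
Proof.
move=> [T [t [cT _ tI tC]]].
pose V : lmodType 'F_2 := mod_doubles A.
pose p (x : A) : V := \pi_(Quotient.quot (doubles (A := A)))%qT x.
have pB x y : p (x - y) = p x - p y by rewrite /p raddfB.
have p0 x : (p x = 0) <-> exists y, x = y + y.
  have -> : 0 = p 0 by rewrite /p raddf0.
  split=> [/eqP|[y xy]].
    by rewrite /p -Quotient.idealrBE subr0 => /asboolP.
  by apply/eqP; rewrite /p -Quotient.idealrBE subr0; apply/asboolP; exists y.
have pS (x : V) : exists y, p y = x by exists (repr x); apply: reprK.
have [k [f]] : exists k, inhabited (Vector.axiom k V).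
  apply: (@F2_finite_vector V #|T| (fun i => p (t (enum_val i)))) => x.
  have [y <-] := pS x; have [i /p0] := tC y I.
  rewrite pB => /eqP; rewrite subr_eq0 => /eqP ->.
  exists (fun j => (j == enum_rank i)%:R).
  by rewrite (bigD1 (enum_rank i)) //= eqxx scale1r enum_rankK big1 ?addr0 // => j /negbTE ->; rewrite scale0r.
suff -> : m = k by constructor.
have [f' fl [g gf fg]] := f.
have fB x y : f' (x - y) = f' x - f' y.
  by rewrite (addrC x) -(scaleN1r y) fl scaleN1r addrC.
apply/eqP; rewrite -(@eqn_exp2l 2) //; apply/eqP.
have sD : is_subgroup [set x : A | exists y, x = y + y].
  split; first by exists 0; rewrite addr0.
  by move=> _ _ [x ->] [y ->]; exists (x - y); rewrite opprD addrACA.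
apply: (@has_index_uniq _ [set: A] _ _ _ sD).
  by exists T, t; split.
have [h hP] := choice pS.
exists 'rV['F_2]_k, (fun r => h (g r)); split=> //.
- by rewrite card_mx card_Fp // mul1n.
- move=> r r' /p0; rewrite pB !hP => /eqP; rewrite subr_eq0 => /eqP.
  exact: (can_inj fg).
- move=> x _; exists (f' (p x)); apply/p0.
  by rewrite pB hP gf subrr.
Qed.

(** * Pell's equation *)

Lemma not_injective_pigeonhole (n m : nat) (f : 'I_n -> 'I_m) : (m < n)%N ->
  exists i j : 'I_n, (i < j)%N /\ f i = f j.
Proof.
move=> lt_mn; have [inj|] := pselect (injective f).
  by have := leq_card f inj; rewrite !card_ord leqNgt lt_mn.
move=> /existsNP[i /existsNP[j /not_implyP[fij nij]]].
by have [lij|lji|/val_inj//] := ltngtP i j; [exists i, j | exists j, i].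
Qed.

(** Excludes the trivial solution in Pell's equation: two proportional pairs of the same nonzero
    norm, with positive second coordinates, coincide. *)
Lemma proportional_eq (D k v1 v2 w1 w2 : int) :
  k != 0 -> 0 < v2 -> 0 < w2 -> k = v1 ^+ 2 - D * v2 ^+ 2 ->
  k = w1 ^+ 2 - D * w2 ^+ 2 -> v2 * w1 = v1 * w2 -> v1 = w1 /\ v2 = w2.
Proof.
move=> k0 v0 w0 kv kw vw.
have e2 : v2 = w2.
  apply/eqP; rewrite -(@eqrXn2 _ 2) ?ltW //; apply/eqP/(mulfI k0).
  have : (v2 * w1) ^+ 2 = (v1 * w2) ^+ 2 by rewrite vw.
  by rewrite {1}kw kv !exprMn !mulrBl [w1 ^+ 2 * _]mulrC => ->; ring.
split=> //; move: vw; rewrite -e2 [v1 * _]mulrC.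
by move=> /(mulfI (lt0r_neq0 v0)).
Qed.

Section Approximation.

Variables (R : archiRealFieldType) (D : nat) (s : R).
Hypotheses (s_gt0 : 0 < s) (sD : s ^+ 2 = D%:R).
Hypothesis D_nonsquare : forall x y : int, x ^+ 2 = D%:Z * y ^+ 2 -> y = 0.

(** Pigeonhole: the N + 1 fractional parts of j s, for j from 0 to N, fall into N boxes of length
    1/N. *)
Lemma dirichlet_approx (N : nat) : (0 < N)%N -> exists x y : int,
  [/\ 0 < y, y <= N%:Z & `|x%:~R - y%:~R * s| * N%:R < 1].
Proof.
move=> N0; pose fl (j : nat) : int := Num.floor (j%:R * s).
have flP j : (fl j)%:~R <= j%:R * s < (fl j + 1)%:~R.
  by rewrite Num.Theory.floor_le /= Num.Theory.floorD1_gt.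
pose fr j : R := j%:R * s - (fl j)%:~R.
have frP j : 0 <= fr j < 1.
  by have := flP j; rewrite /fr rmorphD /= => /andP[h1 h2]; apply/andP; split; lra.
pose bx j : int := Num.floor (fr j * N%:R).
have N0R : 0 < N%:R :> R by rewrite ltr0n.
have bxP j : (bx j)%:~R <= fr j * N%:R < (bx j + 1)%:~R.
  by rewrite Num.Theory.floor_le /= Num.Theory.floorD1_gt.
have bx_ge0 j : 0 <= bx j.
  by rewrite Num.Theory.floor_ge0 mulr_ge0 ?ler0n //; case/andP: (frP j).
have bxN j : (absz (bx j) < N)%N.
  rewrite -ltz_nat gez0_abs // -(ltr_int R).
  apply: le_lt_trans (proj1 (andP (bxP j))) _.
  by rewrite -[X in _ < X]mul1r ltr_pM2r //; case/andP: (frP j).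
have [i [j [lij /(congr1 val) /= bij]]] :=
  @not_injective_pigeonhole N.+1 N (fun j => Ordinal (bxN j)) (ltnSn N).
have {}bij : bx i = bx j by rewrite -(gez0_abs (bx_ge0 i)) bij gez0_abs.
exists (fl j - fl i), (j%:Z - i%:Z); split; first by lia.
  by have := ltn_ord j; lia.
have -> : (fl j - fl i)%:~R - (j%:Z - i%:Z)%:~R * s = fr i - fr j.
  by rewrite /fr !rmorphB /= ; ring.
rewrite -(gtr0_norm N0R) -normrM ltr_norml mulrBl.
have := bxP i; have := bxP j; rewrite bij rmorphD /= => /andP[h1 h2] /andP[h3 h4].
by apply/andP; split; lra.
Qed.

Lemma irrational_sqrt (x y : int) : 0 < y -> 0 < `|x%:~R - y%:~R * s|.
Proof.
move=> y0; rewrite normr_gt0 subr_eq0; apply/eqP => xy.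
suff /D_nonsquare y00 : x ^+ 2 = D%:Z * y ^+ 2 by rewrite y00 in y0.
by apply: (@intr_inj R); rewrite rmorphXn [RHS]rmorphM rmorphXn /= xy exprMn sD mulrC.
Qed.

(** With d = |x - y s| the norm is at most d (d + 2 y s). Dirichlet's bound gives d < 1 and d y < 1,
    so the norm stays below a constant that does not depend on e. *)
Lemma pell_approx (e : R) : 0 < e -> exists x y : int,
  [/\ 0 < y, `|x%:~R - y%:~R * s| < e & `|x ^+ 2 - D%:Z * y ^+ 2|%:~R < 2 + 2 * s].
Proof.
move=> e0; pose N := (Num.Def.archi_bound e^-1).+1.
have N0R : 0 < N%:R :> R by rewrite ltr0n.
have Ne : e^-1 < N%:R.
  apply: lt_trans (archi_boundP (ltW _)) _; first by rewrite invr_gt0.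
  by rewrite ltr_nat.
have [x [y [y0 yN xyN]]] := @dirichlet_approx N isT.
have N1 : 1 <= N%:R :> R by rewrite ler1n.
have yN' : y%:~R <= N%:R :> R by rewrite -[N%:R]/(N%:Z%:~R) ler_int.
have y0' : 0 < y%:~R :> R by rewrite ltr0z.
exists x, y; split=> //.
  apply: lt_trans (_ : N%:R^-1 < e); last by rewrite invf_plt ?posrE.
  by rewrite -[N%:R^-1]mul1r ltr_pdivlMr.
have -> : `|x ^+ 2 - D%:Z * y ^+ 2|%:~R = `|x%:~R - y%:~R * s| * `|x%:~R + y%:~R * s|.
  by rewrite -normrM intr_norm rmorphB rmorphXn rmorphM rmorphXn /= -(sD : _ = D%:Z%:~R); congr `| _ |; ring.
set d := `|_ - _| in xyN *; have d0 : 0 <= d by apply: normr_ge0.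
have : `|x%:~R + y%:~R * s| <= d + 2 * (y%:~R * s).
  have -> : x%:~R + y%:~R * s = (x%:~R - y%:~R * s) + 2 * (y%:~R * s) by ring.
  apply: le_trans (ler_normD _ _) _.
  by rewrite lerD2l ger0_norm // mulr_ge0 // mulr_ge0 // ltW.
move=> h; apply: le_lt_trans (ler_wpM2l d0 h) _.
have d1 : d < 1 by apply: le_lt_trans xyN; rewrite ler_peMr.
have dy : d * y%:~R < 1 by apply: le_lt_trans xyN; rewrite ler_wpM2l.
have dd : d * d <= d by rewrite ler_piMr // ltW.
have dys : d * y%:~R * s <= s by rewrite ler_piMl // ltW.
by rewrite mulrDr mulrCA mulrA; lra.
Qed.

(** A new pair is obtained by asking for an error smaller than all earlier ones, which are positive
    because s is irrational. *)
Lemma pell_approx_seq (n : nat) : exists u : seq (int * int),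
  [/\ size u = n, uniq u & forall v, v \in u -> 0 < v.2 /\ `|v.1 ^+ 2 - D%:Z * v.2 ^+ 2|%:~R < 2 + 2 * s].
Proof.
elim: n => [|n [u [su uu uP]]]; first by exists [::].
have [e [e0 eP]] : exists e : R, 0 < e /\ forall v, v \in u -> e <= `|v.1%:~R - v.2%:~R * s|.
  elim: u {su uu} uP => [|v u IHu] uP; first by exists 1.
  have [w wu|e [e0 eP]] := IHu; first by apply: uP; rewrite inE wu orbT.
  exists (Num.min e `|v.1%:~R - v.2%:~R * s|); split.
    by rewrite lt_min e0 irrational_sqrt //; have [] := uP v (mem_head _ _).
  move=> w; rewrite inE ge_min => /predU1P[->|/eP->//]; by rewrite lexx orbT.
have [x [y [y0 xye xyB]]] := pell_approx e0.
exists ((x, y) :: u); split=> /=; first by rewrite su.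
  rewrite uu andbT; apply/negP => /eP /=; by rewrite leNgt xye.
by move=> v; rewrite inE => /predU1P[->|/uP].
Qed.

(** Among sufficiently many approximations two, v and w, have the same norm k and are congruent
    modulo k. Then v / w = v conj(w) / k has integral coordinates and norm 1, and it is not rational
    since v and w differ. *)
Lemma pell_of_sqrt : exists x y : int, y != 0 /\ x ^+ 2 - D%:Z * y ^+ 2 = 1.
Proof.
pose B := Num.Def.archi_bound (2 + 2 * s).
have BP (k : int) : `|k|%:~R < 2 + 2 * s -> (absz k < B)%N.
  move=> h; rewrite -ltz_nat -(ltr_int R) abszE.
  apply: lt_le_trans h _; apply/ltW/archi_boundP.
  by rewrite addr_ge0 // mulr_ge0 // ltW.
have [u [su uu uP]] := pell_approx_seq (#|{: 'I_B.*2.+1 * 'I_B.+1 * 'I_B.+1}|.+1).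
pose k (v : int * int) := v.1 ^+ 2 - D%:Z * v.2 ^+ 2.
(* The label of v is its norm, shifted by B to be nonnegative, together with its coordinates modulo
   the norm. *)
pose c (v : int * int) : 'I_B.*2.+1 * 'I_B.+1 * 'I_B.+1 :=
  (inord (absz (k v + B%:Z)), inord (absz (v.1 %% k v)%Z), inord (absz (v.2 %% k v)%Z)).
pose f (i : 'I_(#|{: 'I_B.*2.+1 * 'I_B.+1 * 'I_B.+1}|.+1)) := enum_rank (c (nth (0, 0) u i)).
have [i [j [lij /enum_rank_inj]]] := not_injective_pigeonhole f (ltnSn _).
set v := nth _ u i; set w := nth _ u j => cvw.
have vu : v \in u by apply: mem_nth; rewrite su.
have wu : w \in u by apply: mem_nth; rewrite su.
have nvw : v != w by rewrite nth_uniq ?su // neq_ltn lij.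
have [v0 /BP kv] := uP _ vu; have [w0 /BP kw] := uP _ wu.
rewrite -/(k v) in kv; rewrite -/(k w) in kw.
have k0 z : 0 < z.2 -> k z != 0.
  by move=> z0; rewrite subr_eq0; apply/eqP => /D_nonsquare z00; rewrite z00 in z0.
have [kv0 kw0] := (k0 _ v0, k0 _ w0).
have modB (x m : int) : m != 0 -> (absz m < B)%N -> (absz (x %% m)%Z < B.+1)%N.
  move=> m0 mB; have := ltz_mod x m0; have := modz_ge0 x m0; lia.
case: cvw => /(congr1 val) /= e1 /(congr1 val) /= e2 /(congr1 val) /= e3.
rewrite !inordK in e1; try lia.
have ek : k v = k w by lia.
rewrite !inordK ?modB // in e2; rewrite !inordK ?modB // in e3.
have {}e2 : (v.1 %% k v)%Z = (w.1 %% k v)%Z.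
  by move: e2 => /(congr1 Posz); rewrite -ek !gez0_abs ?modz_ge0.
have {}e3 : (v.2 %% k v)%Z = (w.2 %% k v)%Z.
  by move: e3 => /(congr1 Posz); rewrite -ek !gez0_abs ?modz_ge0.
have [p pP] : exists p, v.1 = w.1 + p * k v.
  exists ((v.1 %/ k v)%Z - (w.1 %/ k v)%Z).
  by rewrite {1}(divz_eq v.1 (k v)) {1}(divz_eq w.1 (k v)) e2; ring.
have [q qP] : exists q, v.2 = w.2 + q * k v.
  exists ((v.2 %/ k v)%Z - (w.2 %/ k v)%Z).
  by rewrite {1}(divz_eq v.2 (k v)) {1}(divz_eq w.2 (k v)) e3; ring.
(* As v = w + k (p + q sqrt D), the quotient v / w is 1 + (p + q sqrt D) conj(w). *)
exists (1 + p * w.1 - D%:Z * q * w.2), (q * w.1 - p * w.2).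
have kwE : k v = w.1 ^+ 2 - D%:Z * w.2 ^+ 2 by [].
have kvE : k v = v.1 ^+ 2 - D%:Z * v.2 ^+ 2 by [].
have eX : (v.1 * w.1 - D%:Z * v.2 * w.2) = k v * (1 + p * w.1 - D%:Z * q * w.2).
  have alg (m a b t h z : int) : m = a ^+ 2 - z * b ^+ 2 ->
      (a + t * m) * a - z * (b + h * m) * b = m * (1 + t * a - z * h * b) by move=> ->; ring.
  by rewrite pP qP; apply: alg.
have eY : (v.2 * w.1 - v.1 * w.2) = k v * (q * w.1 - p * w.2).
  by rewrite pP qP; ring.
split.
  apply/eqP => z0; rewrite z0 mulr0 in eY.
  have vw : v.2 * w.1 = v.1 * w.2 by apply/eqP; rewrite -subr_eq0 eY.
  have [e1' e2'] := proportional_eq kv0 v0 w0 kvE kwE vw.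
  by move: nvw; rewrite (surjective_pairing v) (surjective_pairing w) e1' e2' eqxx.
have : k v ^+ 2 * ((1 + p * w.1 - D%:Z * q * w.2) ^+ 2 - D%:Z * (q * w.1 - p * w.2) ^+ 2) = k v ^+ 2 * 1.
  have alg (m a b z : int) : m ^+ 2 * (a ^+ 2 - z * b ^+ 2) = (m * a) ^+ 2 - z * (m * b) ^+ 2 by ring.
  by rewrite alg -eX -eY mulr1 [RHS]expr2 {1}kwE kvE; ring.
by apply: mulfI; rewrite expf_neq0.
Qed.

End Approximation.

Lemma pell_equation (D : nat) :
  (forall x y : int, x ^+ 2 = D%:Z * y ^+ 2 -> y = 0) ->
  exists x y : int, y != 0 /\ x ^+ 2 - D%:Z * y ^+ 2 = 1.
Proof.
move=> nsq; have D0 : (0 < D)%N.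
  by rewrite lt0n; apply/eqP => D0; have := nsq 0 1; rewrite D0 expr0n mul0r => /(_ erefl).
pose s : algR := Num.sqrt (D%:R : algR).
apply: (@pell_of_sqrt _ D s) => //; first by rewrite sqrtr_gt0 ltr0n.
by rewrite sqr_sqrtr // ler0n.
Qed.

Section CharZero.

Variable L : fieldExtType rat.

Lemma intr_alg (m : int) : (m%:~R : rat)%:A = m%:~R :> L.
Proof. by rewrite scaler_int. Qed.

Lemma intrL_eq0 (m : int) : (m%:~R == 0 :> L) = (m == 0).
Proof. by rewrite -intr_alg scaler_eq0 oner_eq0 orbF intr_eq0. Qed.

Lemma intrL_inj : injective (fun m : int => m%:~R : L).
Proof.
move=> m n /eqP; rewrite -subr_eq0 -rmorphB intrL_eq0 subr_eq0; exact: eqP.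
Qed.

Lemma natrL_eq0 (n : nat) : (n%:R == 0 :> L) = (n == 0%N).
Proof. by rewrite -[n%:R]/(n%:Z%:~R) intrL_eq0. Qed.

Lemma two_neq0 : 2 != 0 :> L. Proof. by rewrite natrL_eq0. Qed.

End CharZero.

#[global] Hint Resolve two_neq0 : core.

(** * Norm one units of real quadratic fields *)

Section PellUnits.

Variables (L : fieldExtType rat) (D : nat) (delta : L).
Hypothesis deltaP : delta ^+ 2 = D%:R.

Definition pell_elt (X Y : int) : L := (X%:~R + Y%:~R * delta) / 2.

(** The right-hand side 4 matches the denominator 2 of [pell_elt], so that the units (X + Y sqrt
    D)/2 of the maximal order are covered whatever D is modulo 4. *)
Definition pell_unit (v : L) : Prop :=
  exists X Y : int, v = pell_elt X Y /\ X ^+ 2 - D%:Z * Y ^+ 2 = 4.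

(** Makes products of Pell units Pell units again. The norm equation forces X and D Y to have the
    same parity, and D^2 + D is even. *)
Lemma pell_even (X Y X' Y' : int) :
  X ^+ 2 - D%:Z * Y ^+ 2 = 4 -> X' ^+ 2 - D%:Z * Y' ^+ 2 = 4 ->
  exists U V, X * X' + D%:Z * Y * Y' = 2 * U /\ X * Y' + X' * Y = 2 * V.
Proof.
have parity (Z T : int) : Z ^+ 2 - D%:Z * T ^+ 2 = 4 -> exists m, Z = D%:Z * T + 2 * m.
  have half (x : int) : exists y, x = 2 * y \/ x = 2 * y + 1.
    by exists (x %/ 2)%Z; lia.
  have [[a aP] [b bP] [c cP]] := And3 (half Z) (half T) (half D%:Z).
  case: aP bP cP => -> [] -> [] -> h.
  - by exists (a - 2 * c * b); ring.
  - by exists (a - 2 * c * b - b); ring.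
  - by exists (a - 2 * c * b - c); ring.
  - by exfalso; lia.
  - by exfalso; lia.
  - by exfalso; lia.
  - by exfalso; lia.
  - by exists (a - 2 * c * b - c - b); ring.
move=> /[dup] h /parity[m Xm] /[dup] h' /parity[m' X'm].
have [c cP] : exists c, D%:Z * D%:Z + D%:Z = 2 * c.
  exists ((D * D + D)./2)%:Z; have := odd_double_half (D * D + D)%N.
  by rewrite oddD oddM andbb addbb add0n -mul2n => e; rewrite -[RHS]PoszM e PoszD PoszM.
exists (c * Y * Y' + D%:Z * Y * m' + D%:Z * Y' * m + 2 * m * m'), (D%:Z * Y * Y' + m * Y' + m' * Y).
split; rewrite Xm X'm; last by ring.
have -> : (D%:Z * Y + 2 * m) * (D%:Z * Y' + 2 * m') + D%:Z * Y * Y' =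
  (D%:Z * D%:Z + D%:Z) * (Y * Y') + 2 * (D%:Z * Y * m' + D%:Z * Y' * m + 2 * m * m') by ring.
by rewrite cP; ring.
Qed.

Lemma pell_elt_conj (X Y : int) : X ^+ 2 - D%:Z * Y ^+ 2 = 4 ->
  pell_elt X Y * pell_elt X (- Y) = 1.
Proof.
move=> /(congr1 (fun m : int => m%:~R : L)).
rewrite rmorphB [X in _ - X]rmorphM !rmorphXn /= => h.
have -> : pell_elt X Y * pell_elt X (- Y) =
    (X%:~R ^+ 2 - delta ^+ 2 * Y%:~R ^+ 2) / 4.
  rewrite /pell_elt rmorphN /=; field; rewrite !natrL_eq0 //.
by rewrite deltaP h divff // natrL_eq0.
Qed.

Lemma pell_elt_neq0 (X Y : int) : X ^+ 2 - D%:Z * Y ^+ 2 = 4 -> pell_elt X Y != 0.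
Proof.
by move=> /pell_elt_conj h; apply/eqP => e; move: h; rewrite e mul0r => /eqP; rewrite eq_sym oner_eq0.
Qed.

Lemma pell_eltV (X Y : int) : X ^+ 2 - D%:Z * Y ^+ 2 = 4 ->
  (pell_elt X Y)^-1 = pell_elt X (- Y).
Proof.
by move=> h; rewrite -[LHS]mulr1 -(pell_elt_conj h) mulKf ?pell_elt_neq0.
Qed.

Lemma pell_eltN (X Y : int) : - pell_elt X Y = pell_elt (- X) (- Y).
Proof. by rewrite /pell_elt !rmorphN /= mulNr -opprD mulNr. Qed.

Lemma pell_eltM (X Y X' Y' U V : int) :
  X * X' + D%:Z * Y * Y' = 2 * U -> X * Y' + X' * Y = 2 * V ->
  pell_elt X Y * pell_elt X' Y' = pell_elt U V.
Proof.
move=> /(congr1 (fun m : int => m%:~R : L)) hU /(congr1 (fun m : int => m%:~R : L)) hV.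
move: hU hV; rewrite !rmorphD !rmorphM /= => hU hV.
have -> : pell_elt X Y * pell_elt X' Y' =
  ((X%:~R * X'%:~R + delta ^+ 2 * Y%:~R * Y'%:~R) + (X%:~R * Y'%:~R + X'%:~R * Y%:~R) * delta) / 4.
  by rewrite /pell_elt; field; rewrite !natrL_eq0 //.
by rewrite deltaP hU hV /pell_elt; field; rewrite !natrL_eq0 //.
Qed.

Lemma pell_norm (X Y X' Y' U V : int) :
  X ^+ 2 - D%:Z * Y ^+ 2 = 4 -> X' ^+ 2 - D%:Z * Y' ^+ 2 = 4 ->
  X * X' + D%:Z * Y * Y' = 2 * U -> X * Y' + X' * Y = 2 * V ->
  U ^+ 2 - D%:Z * V ^+ 2 = 4.
Proof.
move=> h h' hU hV; suff : 4 * (U ^+ 2 - D%:Z * V ^+ 2) = 4 * 4 by apply: mulfI.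
have -> : 4 * (U ^+ 2 - D%:Z * V ^+ 2) = (2 * U) ^+ 2 - D%:Z * (2 * V) ^+ 2 by ring.
by rewrite -hU -hV -{1}h -h'; ring.
Qed.

Lemma pell_unitV v : pell_unit v -> pell_unit v^-1.
Proof.
by move=> [X [Y [-> h]]]; exists X, (- Y); rewrite sqrrN; split=> //; apply: pell_eltV.
Qed.

Lemma pell_pos_exp (X Y : int) n : X ^+ 2 - D%:Z * Y ^+ 2 = 4 -> 0 < X -> 0 < Y ->
  (0 < D)%N -> exists U V : int, [/\ pell_elt X Y ^+ n.+1 = pell_elt U V,
     U ^+ 2 - D%:Z * V ^+ 2 = 4, 0 < U & 0 < V].
Proof.
move=> h X0 Y0 D0; elim: n => [|n [U [V [e hUV U0 V0]]]]; first by exists X, Y.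
have [U' [V' [hU hV]]] := pell_even h hUV.
exists U', V'; split.
- by rewrite exprS e; apply: pell_eltM.
- exact: (pell_norm h hUV).
- rewrite -(@pmulr_rgt0 _ 2) // -hU; apply: addr_gt0; rewrite !mulr_gt0 //.
- by rewrite -(@pmulr_rgt0 _ 2) // -hV; apply: addr_gt0; rewrite !mulr_gt0.
Qed.

(** Here U is the first coordinate of (X, Y) divided by (X0, Y0). Put A = D Y Y0; then A^2 = (X^2 -
    4)(X0^2 - 4), which places A strictly between X (X0 - 2) and X X0. *)
Lemma pell_descent (X0 Y0 X Y U : int) : (0 < D)%N ->
  X0 ^+ 2 - D%:Z * Y0 ^+ 2 = 4 -> X ^+ 2 - D%:Z * Y ^+ 2 = 4 ->
  0 < X0 -> 0 < Y0 -> X0 <= X -> 0 < Y ->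
  X * X0 - D%:Z * Y * Y0 = 2 * U -> 0 < U < X.
Proof.
move=> D0 h0 h pX0 pY0 leX pY hU.
pose A := D%:Z * Y * Y0.
have pA : 0 < A by rewrite /A !mulr_gt0.
have A2 : A ^+ 2 = (X ^+ 2 - 4) * (X0 ^+ 2 - 4) by rewrite -{1}h -h0 /A; ring.
have X0_gt2 : 2 < X0.
  rewrite ltNge; apply/negP => le2.
  have : X0 ^+ 2 <= 2 ^+ 2 by rewrite ler_pXn2r ?nnegrE // ltW.
  have : 0 < D%:Z * Y0 ^+ 2 by rewrite mulr_gt0 ?exprn_gt0.
  by lia.
have pX : 0 < X by apply: lt_le_trans leX.
have lt1 : A < X * X0.
  rewrite -(@ltr_pXn2r _ 2) ?nnegrE ?ltW ?mulr_gt0 // A2 exprMn -subr_gt0.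
  have -> : X ^+ 2 * X0 ^+ 2 - (X ^+ 2 - 4) * (X0 ^+ 2 - 4) = 4 * (X ^+ 2 + (X0 ^+ 2 - 4)) by ring.
  have : 0 < X0 ^+ 2 - 2 ^+ 2 by rewrite subr_gt0 ltr_pXn2r ?nnegrE // ltW.
  by have := sqr_ge0 X; lia.
have lt2 : X * (X0 - 2) < A.
  rewrite -(@ltr_pXn2r _ 2) ?nnegrE ?ltW ?mulr_gt0 ?subr_gt0 // A2 exprMn -subr_gt0.
  have -> : (X ^+ 2 - 4) * (X0 ^+ 2 - 4) - X ^+ 2 * (X0 - 2) ^+ 2 = 4 * ((X0 - 2) * (X ^+ 2 - (X0 + 2))) by ring.
  rewrite mulr_gt0 // mulr_gt0 ?subr_gt0 //.
  have le : 3 * X <= X ^+ 2 by rewrite expr2 ler_wpM2r // ?(ltW pX) //; lia.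
  by apply: lt_le_trans le; lia.
have hU' : X * X0 - A = 2 * U by rewrite /A.
rewrite mulrBr in lt2.
by clearbody A; apply/andP; split; lia.
Qed.

Lemma Dsqr_ge0 (Y : int) : 0 <= D%:Z * Y ^+ 2.
Proof. by rewrite mulr_ge0 ?sqr_ge0. Qed.

(** The generator is the positive solution with least X. Dividing a solution by it lowers X until
    the trivial solution X = 2 is reached. *)
Lemma pell_fundamental : (0 < D)%N ->
  (forall x y : int, x ^+ 2 = D%:Z * y ^+ 2 -> y = 0) ->
  exists X0 Y0 : int, [/\ X0 ^+ 2 - D%:Z * Y0 ^+ 2 = 4, 0 < X0, 0 < Y0
    & forall v, pell_unit v -> exists k : int, v = pell_elt X0 Y0 ^ k \/ v = - pell_elt X0 Y0 ^ k].
Proof.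
move=> D0 nsq.
pose P (n : nat) := `[< exists Y : int, 0 < Y /\ n%:Z ^+ 2 - D%:Z * Y ^+ 2 = 4 >].
have exP : exists n, P n.
  have [x [y [y0 xy]]] := pell_equation nsq.
  (* A solution of x^2 - D y^2 = 1 is doubled to obtain the right-hand side 4. *)
  exists (2 * absz x)%N; apply/asboolP; exists (2 * `|y|); split.
    by rewrite mulr_gt0 // normr_gt0.
  rewrite PoszM abszE !exprMn !real_normK ?num_real //.
  by transitivity (4 * (x ^+ 2 - D%:Z * y ^+ 2)); [ring | rewrite xy].
have [n /asboolP[Y0 [pY0 h0]] nmin] := ex_minnP exP.
have n0 : 0 < n%:Z.
  rewrite ltz_nat lt0n; apply/eqP => n0; move: h0; rewrite n0 expr0n sub0r.
  by have := Dsqr_ge0 Y0; lia.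
exists n%:Z, Y0; split=> //; set e := pell_elt _ _.
have e0 : e != 0 by apply: pell_elt_neq0.
suff main m X Y : (absz X <= m)%N -> X ^+ 2 - D%:Z * Y ^+ 2 = 4 ->
    exists k : int, pell_elt X Y = e ^ k \/ pell_elt X Y = - e ^ k.
  by move=> v [X [Y [-> h]]]; apply: (main _ X Y (leqnn _) h).
elim: m X Y => [|m IHm] X Y Xm h.
  have X0 : X = 0 by lia.
  have := Dsqr_ge0 Y.
  by move: h; rewrite X0 expr0n; lia.
(* Changing both signs negates the unit; changing the sign of Y alone, further below, inverts it. *)
wlog pX : X Y Xm h / 0 < X.
  move=> IH; have [pX|nX|X0] := ltgtP 0 X; first exact: IH.
    have [|||k hk] := IH (- X) (- Y); rewrite ?sqrrN //; [by lia | by lia |].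
    exists k; rewrite -pell_eltN in hk.
    by case: hk => hk; [right | left]; rewrite -[LHS]opprK hk ?opprK.
  have := Dsqr_ge0 Y.
  by move: h; rewrite -X0 expr0n; lia.
have [Y00|Y00] := eqVneq Y 0.
  have X2 : X = 2.
    move: h; rewrite Y00 expr0n mulr0 subr0 => h.
    by apply/eqP; rewrite -(@eqrXn2 _ 2) ?ltW //; apply/eqP.
  exists 0; left; rewrite /pell_elt X2 Y00 mulr0z mul0r addr0 expr0z.
  by apply: divff; apply: two_neq0.
wlog pY : Y h Y00 / 0 < Y.
  move=> IH; have [pY|nY|/esym/eqP] := ltgtP 0 Y; [exact: IH | | by rewrite (negbTE Y00)].
  have [|||k hk] := IH (- Y); rewrite ?sqrrN ?oppr_eq0 //; first by lia.
  exists (- k); rewrite -pell_eltV // in hk.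
  by case: hk => hk; [left | right]; rewrite -[LHS]invrK hk ?invrN invr_expz.
have leX : n%:Z <= X.
  have /nmin : P (absz X) by apply/asboolP; exists Y; rewrite gtz0_abs.
  by lia.
have h0' : n%:Z ^+ 2 - D%:Z * (- Y0) ^+ 2 = 4 by rewrite sqrrN.
have [U [V [hU hV]]] := pell_even h h0'.
have hU' : X * n%:Z - D%:Z * Y * Y0 = 2 * U by rewrite -hU mulrN.
have UX := pell_descent D0 h0 h n0 pY0 leX pY hU'.
have [||k hk] := IHm U V; [by lia | exact: pell_norm h h0' hU hV |].
have eUV : pell_elt X Y = pell_elt U V * e.
  by rewrite -(pell_eltM hU hV) -pell_eltV // mulfVK.
exists (k + 1); rewrite eUV expfzDr // expr1z.
by case: hk => ->; [left | right]; rewrite ?mulNr.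
Qed.

End PellUnits.

(** * The index of the doubles in a group known up to finite index *)

Definition doubles_of (M : zmodType) (G : set M) : set M := [set x | exists2 y, G y & x = y + y].

Lemma doubles_of_subgroup (M : zmodType) (G : set M) : is_subgroup G -> is_subgroup (doubles_of G).
Proof.
move=> sG; split; first by exists 0; rewrite ?addr0 //; apply: subgroup0.
move=> _ _ [x Gx ->] [y Gy ->]; exists (x - y); first exact: subgroupB.
by rewrite opprD addrACA.
Qed.

Section DoublingIndex.

Variables (M : zmodType) (A : set M) (t : M) (k : nat) (eps : 'I_k -> M) (n : nat).
Hypotheses (sA : is_subgroup A) (At : A t) (t0 : t != 0) (tt : t + t = 0).
Hypothesis A_2torsion : forall x, A x -> x + x = 0 -> x = 0 \/ x = t.
Hypothesis Aeps : forall i, A (eps i).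
Hypothesis n_gt0 : (0 < n)%N.

Let comb (b : bool) (z : 'I_k -> int) : M := t *+ b + \sum_i eps i *~ z i.

Hypothesis A_mul : forall x, A x -> exists b z, x *+ n = comb b z.
Hypothesis eps_free : forall z, \sum_i eps i *~ z i = 0 -> forall i, z i = 0.
Hypothesis A_torsion_finite :
  exists s : seq M, forall x, A x -> x *+ n = 0 -> x \in s.

Let span : set M := [set x | exists b z, x = comb b z].

Let tB (b b' : bool) : t *+ b - t *+ b' = t *+ (b (+) b').
Proof.
have tN : - t = t by apply/eqP; rewrite eq_sym -addr_eq0 tt.
by case: b b' => [] [] //=; rewrite ?subrr ?sub0r ?subr0 // tN.
Qed.

Let combB b z b' z' : comb b z - comb b' z' = comb (b (+) b') (fun i => z i - z' i).
Proof.
rewrite /comb opprD addrACA tB; congr (_ + _); rewrite -sumrB.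
by apply: eq_bigr => i _; rewrite mulrzBr.
Qed.

Let span_subgroup : is_subgroup span.
Proof.
split; first by exists false, (fun=> 0); rewrite /comb big1 ?addr0.
by move=> _ _ [b [z ->]] [b' [z' ->]]; rewrite combB; eexists; eexists.
Qed.

Let spanA x : span x -> A x.
Proof.
move=> [b [z ->]]; apply: subgroupD => //; first exact: subgroup_mulrn.
elim/big_ind: _ => [||i _]; [exact: subgroup0 | exact: subgroupD |].
by case: (z i) => m; [|apply: subgroupN => //]; apply: subgroup_mulrn.
Qed.

Let span_t : span t.
Proof. by exists true, (fun=> 0); rewrite /comb big1 ?addr0. Qed.

Let comb_eq0 b z : comb b z = 0 -> b = false /\ forall i, z i = 0.
Proof.
move=> e0; have z0 i : z i = 0.
  have : \sum_i eps i *~ (z i + z i) = 0.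
    have : comb b z + comb b z = 0 by rewrite e0 addr0.
    rewrite /comb addrACA -mulrnDl tt mul0rn add0r -big_split => e1.
    by rewrite -[RHS]e1; apply: eq_bigr => j _; rewrite mulrzDr.
  by move/eps_free/(_ i); lia.
split=> //; move: e0; rewrite /comb big1 ?addr0 => [|i _]; last by rewrite z0.
by case: b => //= /eqP; rewrite (negbTE t0).
Qed.

Let span_index : has_index span (doubles_of span) (2 ^ k.+1).
Proof.
pose f (u : bool * {ffun 'I_k -> bool}) := comb u.1 (fun i => (u.2 i : nat)%:Z).
exists (bool * {ffun 'I_k -> bool})%type, f; split.
- by rewrite card_prod card_ffun card_ord card_bool expnS.
- by move=> u; eexists; eexists.
- move=> [b g] [b' g'] [_ [c [z ->]]]; rewrite /f combB /= => /eqP.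
  rewrite -subr_eq0 {2 3}/comb addrACA -mulrnDl tt mul0rn add0r -big_split.
  rewrite -addrA -sumrB => /eqP e.
  have [|bb' zz'] := @comb_eq0 (b (+) b') (fun i => (g i : nat)%:Z - (g' i : nat)%:Z - (z i + z i)).
    rewrite /comb -[RHS]e; congr (_ + _); apply: eq_bigr => i _.
    by rewrite [in RHS]/= -mulrzDr -mulrzBr.
  congr (_, _); first by case: b b' bb' {e} => [] [].
  by apply/ffunP => i; have := zz' i; case: (g i) (g' i) => [] []; lia.
- move=> _ [b [z ->]].
  exists (b, [ffun i => odd (absz (z i))]); rewrite /f combB addbb.
  pose w i := (z i %/ 2)%Z.
  exists (comb false w); first by eexists; eexists.
  rewrite /comb !mulr0n !add0r -big_split; apply: eq_bigr => i _.
  rewrite /= -mulrzDr ffunE; congr (_ *~ _); rewrite /w; lia.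
Qed.

Let span_index_mul : exists m, has_index span [set x | exists2 y, span y & x = y *+ n] m.
Proof.
have [|f fP] := @choice M (bool * ('I_k -> int)) (fun x u => span x -> x = comb u.1 u.2).
  move=> x; have [[b [z ->]]|nx] := pselect (span x); first by exists (b, z).
  by exists (false, fun=> 0).
have zn (z : int) : (absz (z %% n%:Z)%Z < n)%N by lia.
pose g x : bool * {ffun 'I_k -> 'I_n} := ((f x).1, [ffun i => Ordinal (zn ((f x).2 i))]).
apply: (@has_index_finite _ _ _ _ g).
  split; first by exists 0; rewrite ?mul0rn //; apply: subgroup0.
  move=> _ _ [x Gx ->] [y Gy ->]; exists (x - y); first exact: subgroupB.
  by rewrite mulrnBl.
move=> x y /fP ex /fP ey [e1 /ffunP e2]; rewrite ex ey e1 combB addbb.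
exists (comb false (fun i => ((f x).2 i %/ n)%Z - ((f y).2 i %/ n)%Z)).
  by eexists; eexists.
rewrite /comb !mulr0n !add0r -sumrMnl; apply: eq_bigr => i _.
rewrite pmulrn -mulrzA; congr (_ *~ _).
have := congr1 val (e2 i); rewrite !ffunE /= => e.
rewrite {1}(divz_eq ((f x).2 i) n) {1}(divz_eq ((f y).2 i) n) mulrBl.
have -> : ((f x).2 i %% n)%Z = ((f y).2 i %% n)%Z by lia.
by rewrite opprD addrACA subrr addr0.
Qed.

(** The group [span] is Z/2 + Z^k, so its doubles have index 2^(k+1). It has finite index in A, and
    (A : span) = (2A : 2 span); comparing the two chains from A down to 2 span transfers the index
    to A. *)
Lemma index_doubles_of : has_index A (doubles_of A) (2 ^ k.+1).
Proof.
pose tor : set M := [set x | A x /\ x *+ n = 0].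
(* Finiteness of (A : span) passes through H: multiplication by n embeds A/H into span/n span, and
   H/span is a quotient of the n-torsion. *)
pose H : set M := [set x | exists b c, [/\ span b, tor c & x = b + c]].
have tor0 : tor 0 by split; [exact: subgroup0 | rewrite mul0rn].
have sH : is_subgroup H.
  split; first by exists 0, 0; rewrite addr0; split=> //; exact: (subgroup0 span_subgroup).
  move=> _ _ [b [c [sb [Ac nc] ->]]] [b' [c' [sb' [Ac' nc'] ->]]].
  exists (b - b'), (c - c'); split; first exact: subgroupB.
    by split; [exact: subgroupB | rewrite mulrnBl nc nc' subr0].
  by rewrite opprD addrACA.
have HA x : H x -> A x.
  by move=> [b [c [/spanA Ab [Ac _] ->]]]; apply: subgroupD.
have spanH x : span x -> H x.
  by move=> sx; exists x, 0; rewrite addr0.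
have [m1 [T [u [_ _ _ uC]]]] := span_index_mul.
have [a Aa] : exists a, has_index A H a.
  have [|f fP] := @choice M (option T) (fun x o => A x -> exists2 i, o = Some i &
      exists2 y, span y & x *+ n - u i = y *+ n).
    move=> x; have [Ax|nx] := pselect (A x); last by exists None.
    by have [i Hi] := uC _ (A_mul Ax); exists (Some i) => _; exists i.
  apply: (has_index_finite (f := f) sH) => x y Ax Ay fxy.
  have [i ei [v sv ev]] := fP x Ax; have [j ej [w sw ew]] := fP y Ay.
  have eij : i = j by apply: Some_inj; rewrite -ei -ej.
  exists (v - w), (x - y - (v - w)); split; first exact: subgroupB.
    split; first by do !apply: subgroupB => //; apply: spanA.
    rewrite mulrnBl [in X in _ - X]mulrnBl mulrnBl -ev -ew eij.
    by rewrite opprB addrA [X in X - _]addrA subrK subrr.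
  by rewrite [RHS]addrC subrK.
have [b Hb] : exists b, has_index H span b.
  have [s sP] := A_torsion_finite.
  have [|f fP] := @choice M (option (seq_sub s)) (fun x o => H x -> exists2 c, o = Some c & span (x - val c)).
    move=> x; have [[b [c [sb [Ac nc] ex]]]|nx] := pselect (H x); last by exists None.
    exists (Some (SeqSub (sP c Ac nc))) => _; eexists; first by [].
    by rewrite ex /= addrK.
  apply: (@has_index_finite _ H span (option (adhoc_seq_sub_finType s)) f span_subgroup) => x y Hx Hy fxy.
  have [c ec sc] := fP x Hx; have [d ed sd] := fP y Hy.
  have ecd : c = d by apply: Some_inj; rewrite -ec -ed.
  by apply: (subgroupBB span_subgroup sc); rewrite ecd.
have AB := has_indexM sA sH span_subgroup spanH HA Aa Hb.
have sD := doubles_of_subgroup span_subgroup.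
have Dspan x : doubles_of span x -> span x.
  by move=> [y sy ->]; apply: subgroupD.
have A2B := has_indexM sA span_subgroup sD Dspan spanA AB span_index.
have sA2 := doubles_of_subgroup sA.
have DAA x : doubles_of A x -> A x by move=> [y sy ->]; apply: subgroupD.
have DD x : doubles_of span x -> doubles_of A x by move=> [y /spanA sy ->]; exists y.
have [c [d [AAc AAd e]]] := has_index_split sA sA2 sD DD DAA A2B.
(* Doubling carries A/span onto 2A/2 span; it is injective there because its kernel {0, t} lies in
   span. *)
have : has_index (doubles_of A) (doubles_of span) (a * b).
  apply: (@has_index_corr _ _ A span _ _ (fun x x' => A x /\ x' = x + x)) AB.
  - by move=> x y _ _ [Ax ->] [Ay ->]; split; [exact: subgroupB | rewrite opprD addrACA].
  - by move=> x Ax; exists (x + x) => //; exists x.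
  - by move=> _ [x Ax ->]; exists x.
  - move=> x x' [Ax ->]; split=> [sx|[y sy e2]]; first by exists x.
    have [||xy0|xyt] := A_2torsion (x := x - y).
    + by apply: subgroupB => //; apply: spanA.
    + by rewrite addrACA -opprD e2 subrr.
    + by move/eqP: xy0; rewrite subr_eq0 => /eqP->.
    + by rewrite -(subrK y x) xyt; apply: subgroupD.
move=> /(has_index_uniq sD AAd) ed.
have ab0 := has_index_gt0 (subgroup0 sA) AB.
move: e; rewrite ed mulnC => /eqP; rewrite eqn_pmul2r // => /eqP ->.
by [].
Qed.

End DoublingIndex.

(** * Rational and integral elements *)

(** The square of the denominator of q divides D times the square of the numerator, hence divides D
    by coprimality. *)
Lemma squarefree_Zdiv (D : nat) (q : rat) : squarefree D -> (D%:Q * q ^+ 2) \is a Num.int -> q \is a Num.int.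
Proof.
move=> sqD /intrP[m mP].
suff : absz (denq q) = 1%N.
  by move=> dq; apply/intrP; exists (numq q); rewrite -[LHS]divq_num_den -absz_denq dq divr1.
apply: sqD.
have e : D%:Z * numq q ^+ 2 = m * denq q ^+ 2.
  apply: (@intr_inj rat); rewrite [LHS]rmorphM [RHS]rmorphM !rmorphXn /= -mP.
  rewrite -{2}(divq_num_den q); field; by rewrite intr_eq0 denq_neq0.
have : (absz (denq q) ^ 2 %| D * absz (numq q) ^ 2)%N.
  by rewrite -!abszX -[D]absz_nat -abszM e abszM dvdn_mull.
rewrite Gauss_dvdl //; apply: coprimeXl; apply: coprimeXr.
by rewrite coprime_sym coprime_num_den.
Qed.

Lemma squarefree1 : squarefree 1.
Proof. by move=> m; rewrite dvdn1 -{2}(exp1n 2) eqn_exp2r // => /eqP. Qed.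

Lemma squarefree_not_square (D : nat) (q : rat) : squarefree D -> (1 < D)%N -> q ^+ 2 != D%:Q.
Proof.
move=> sqD D1; apply/eqP => e.
have /intrP[m mP] : q \is a Num.int.
  by apply: (squarefree_Zdiv squarefree1); rewrite mul1r e.
have {}e : (absz m ^ 2 = D)%N.
  apply/eqP; rewrite -eqz_nat -abszX abszE ger0_norm ?sqr_ge0 //.
  by rewrite -(eqr_int rat) rmorphXn /= -mP e.
have m1 : absz m = 1%N by apply: sqD; rewrite e.
by move: D1; rewrite -e m1.
Qed.

Lemma squarefree2 : squarefree 2.
Proof.
move=> m m2; have := @dvdn_leq (m ^ 2) 2 isT m2; case: m m2 => [|[|m]] // _.
have : (2 ^ 2 <= m.+2 ^ 2)%N by rewrite leq_exp2r.
by move=> h1 h2; have := leq_trans h1 h2.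
Qed.

Lemma squarefree_double (D : nat) : odd D -> squarefree D -> squarefree (2 * D).
Proof.
move=> D_odd sqD m m2; have m_odd : odd m.
  apply/negPn/negP => ev; have : (2 %| m)%N by rewrite dvdn2.
  move=> /(dvdn_exp2r 2)/dvdn_trans/(_ m2).
  by rewrite expnS expn1 dvdn_pmul2l // dvdn2 D_odd.
apply: sqD; move: m2; rewrite Gauss_dvdr // coprimeXl //.
by rewrite coprime_sym coprime2n.
Qed.

Lemma neg_not_square (D : nat) (q : rat) : (0 < D)%N -> q ^+ 2 != - D%:Q.
Proof.
move=> D0; apply/eqP => e; have := sqr_ge0 q; rewrite e oppr_ge0.
by rewrite -[D%:~R]/(D%:R) lern0 => /eqP D00; rewrite D00 in D0.
Qed.

Section IntegralElements.

Variable L : fieldExtType rat.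

Lemma int_integral (m : int) : is_integral (m%:~R : L).
Proof. exact: integral_id. Qed.

(** The integral equation is carried to [algC], where rational algebraic integers are known to be
    integers. *)
Lemma rat_integral (q : rat) : is_integral (q%:A : L) -> q \is a Num.int.
Proof.
move=> [p p_mon pq].
have pq' : root (map_poly intr p) q.
  have : root (map_poly (in_alg L) (map_poly intr p)) (in_alg L q).
    rewrite -map_poly_comp /=; congr root : pq.
    by apply: eq_map_poly => m /=; rewrite intr_alg.
  by rewrite fmorph_root.
suff : (ratr q : algC) \is a Num.int.
  by move=> /intrP[m mP]; apply/intrP; exists m; apply: (fmorph_inj (ratr : rat -> algC)); rewrite /= mP ratr_int.
apply: Cint_rat_Aint; first exact: Crat_rat.
apply: (@root_monic_Aint (map_poly intr p)).
- have : root (map_poly ratr (map_poly intr p)) (ratr q : algC) by rewrite fmorph_root.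
  by rewrite -map_poly_comp /=; congr root; apply: eq_map_poly => m /=; rewrite ratr_int.
- exact: monic_map.
- by apply/polyOverP => i; rewrite coef_map intr_int.
Qed.

Lemma integral_fmorph (g : {rmorphism L -> L}) x : is_integral x -> is_integral (g x).
Proof.
move=> [p p_mon px]; exists p => //.
have : root (map_poly g (map_poly intr p)) (g x) by rewrite fmorph_root.
by rewrite -map_poly_comp; congr root; apply: eq_map_poly => m /=; rewrite rmorph_int.
Qed.

Lemma integral_sqrt (x : L) : is_integral (x ^+ 2) -> is_integral x.
Proof.
move=> x2; apply: (@integral_root_monic _ _ intr x ('X^2 - (x ^+ 2)%:P)).
- exact: monicXnsubC.
- by rewrite /root !hornerE subrr.
apply/integral_poly => i; rewrite coefB coefXn coefC.
apply: integral_sub; first exact: integral_nat.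
by case: ifP => _ //; apply: integral0.
Qed.

End IntegralElements.

(** * Automorphisms and quadratic extensions *)

Section Fields.

Variable L : splittingFieldType rat.

(** Source of all automorphisms used below: L is Galois over F, being normal in characteristic 0, so
    F is exactly the fixed field of the Galois group. *)
Lemma exists_moving_gal (F : {subfield L}) x : x \notin F ->
  exists2 h : gal_of {:L}, h \in ('Gal({:L} / F))%g & h x != x.
Proof.
move=> xF.
have galF : galois F {:L}.
  rewrite /galois subvf normalFieldf andbT /=; apply/separableP => y _.
  apply: pcharf0_separable => p; rewrite pchar_lalg; exact: pchar_num.
have : x \notin fixedField ('Gal({:L} / F)%g) by rewrite (galois_fixedField galF).
move=> nx; apply: contrapT => nh; case/negP: nx; apply/fixedFieldP; first exact: memvf.
by move=> h hG; apply/eqP/negPn/negP => hx; apply: nh; exists h.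
Qed.

Lemma exists_moving_automorphism (F : {subfield L}) x : x \notin F ->
  exists g : {rmorphism L -> L}, (forall y, y \in F -> g y = y) /\ g x != x.
Proof.
move=> /exists_moving_gal[h hG hx]; exists (gal_repr h); split=> // y yF.
exact: fixed_gal (subvf F) hG yF.
Qed.

Lemma Fadjoin_sqrt (F : {subfield L}) a x : a ^+ 2 \in F -> x \in <<F; a>>%VS ->
  exists p q, [/\ p \in F, q \in F & x = p + q * a].
Proof.
move=> a2 xFa.
have deg : (adjoin_degree F a <= 2)%N.
  rewrite -ltnS -size_minPoly.
  have pF : 'X^2 - (a ^+ 2)%:P \is a polyOver F by rewrite rpredB ?rpredX ?polyOverX ?polyOverC.
  have sz : size ('X^2 - (a ^+ 2)%:P) = 3%N by rewrite size_XnsubC.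
  rewrite -[X in (_ <= X)%N]sz; apply: dvdp_leq; first by rewrite -size_poly_eq0 sz.
  by apply: minPoly_dvdp => //; rewrite /root !hornerE subrr.
exists (Fadjoin_poly F a x)`_0, (Fadjoin_poly F a x)`_1.
have /polyOverP pF := Fadjoin_polyOver F a x.
split=> //; rewrite -{1}(Fadjoin_poly_eq xFa).
rewrite (horner_coef_wide (n := 2)); last exact: leq_trans (size_Fadjoin_poly _ _ _) deg.
by rewrite !big_ord_recl big_ord0 /= expr0 expr1 mulr1 addr0.
Qed.

(** If x = p + q a with p and q both nonzero, then x^2 in F would put a itself in F. *)
Lemma sqrt_in_Fadjoin (F : {subfield L}) a x : a ^+ 2 \in F -> x ^+ 2 \in F ->
  x \in <<F; a>>%VS -> x \in F \/ x * a \in F.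
Proof.
move=> a2 x2 /(Fadjoin_sqrt a2)[p [q [pF qF xE]]].
have [p0|p0] := eqVneq p 0.
  by right; rewrite xE p0 add0r -mulrA -expr2 rpredM.
have [q0|q0] := eqVneq q 0; first by left; rewrite xE q0 mul0r addr0.
left; suff aF : a \in F by rewrite xE rpredD // rpredM.
have -> : a = (x ^+ 2 - p ^+ 2 - q ^+ 2 * a ^+ 2) / (2 * p * q).
  by rewrite xE; field; rewrite p0 q0 two_neq0.
apply: rpred_div; last by rewrite !rpredM // rpred_nat.
apply: rpredB; first by apply: rpredB => //; apply: rpredX.
by apply: rpredM => //; apply: rpredX.
Qed.

Lemma sqrt_notin_Q (x : L) (m : int) : x ^+ 2 = m%:~R -> (forall q : rat, q ^+ 2 != m%:~R) ->
  x \notin 1%AS.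
Proof.
move=> xm nm; apply/negP => /vlineP[q xq]; case/eqP: (nm q).
move: xm; rewrite xq -intr_alg expr2 -scalerAl -scalerAr mul1r scalerA -expr2.
by move/eqP; rewrite -subr_eq0 -scalerBl scaler_eq0 oner_eq0 orbF subr_eq0 => /eqP.
Qed.

(** Descending through the two quadratic steps, x in Q(a, b) would make one of x, x a, x b, x b a
    rational. *)
Lemma sqrt_notin_biquadratic (a b x : L) (ma mb mx : int) :
  a ^+ 2 = ma%:~R -> b ^+ 2 = mb%:~R -> x ^+ 2 = mx%:~R ->
  (forall q : rat, [/\ q ^+ 2 != mx%:~R, q ^+ 2 != (mx * ma)%:~R, q ^+ 2 != (mx * mb)%:~R
     & q ^+ 2 != (mx * mb * ma)%:~R]) ->
  x \notin <<<<1; a>>; b>>%AS.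
Proof.
move=> aP bP xP nsq.
have intF (F : {subfield L}) (m : int) : m%:~R \in F by apply: rpred_int.
have a2 (F : {subfield L}) : a ^+ 2 \in F by rewrite aP.
have b2 (F : {subfield L}) : b ^+ 2 \in F by rewrite bP.
have x2 (F : {subfield L}) : x ^+ 2 \in F by rewrite xP.
have xb2 (F : {subfield L}) : (x * b) ^+ 2 \in F by rewrite exprMn; apply: rpredM; [apply: x2 | apply: b2].
apply/negP => /(sqrt_in_Fadjoin (b2 _) (x2 _))[].
- move=> /(sqrt_in_Fadjoin (a2 _) (x2 _))[]; apply/negP.
    by apply: (sqrt_notin_Q xP) => q; case: (nsq q).
  apply: (@sqrt_notin_Q _ (mx * ma)) => [|q]; last by case: (nsq q).
  by rewrite exprMn xP aP [RHS]rmorphM.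
- move=> /(sqrt_in_Fadjoin (a2 _) (xb2 _))[]; apply/negP.
    apply: (@sqrt_notin_Q _ (mx * mb)) => [|q]; last by case: (nsq q).
    by rewrite exprMn xP bP [RHS]rmorphM.
  apply: (@sqrt_notin_Q _ (mx * mb * ma)) => [|q]; last by case: (nsq q).
  by rewrite !exprMn xP bP aP 2![in RHS]rmorphM.
Qed.

End Fields.

(* Locked, since otherwise rmorphD and rmorphM match inside zcomb. *)
HB.lock Definition zcomb (L : fieldExtType rat) (z : L) (a0 a1 a2 a3 : rat) : L :=
  a0%:A + a1%:A * z + a2%:A * z ^+ 2 + a3%:A * z ^+ 3.

Lemma zcombE (L : fieldExtType rat) (z : L) a0 a1 a2 a3 : zcomb z a0 a1 a2 a3 =
  a0%:A + a1%:A * z + a2%:A * z ^+ 2 + a3%:A * z ^+ 3.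
Proof. by rewrite zcomb.unlock. Qed.

(** * The field Q(zeta_8, sqrt d) *)

(* sg generates the Galois group over K = Q(zeta); tau and rho fix sqrt d, and
   send (i, sqrt 2) = (zeta^2, zeta - zeta^3) to (-i, sqrt 2) and (i, - sqrt 2)
   respectively. *)
Record octic (L : fieldExtType rat) (d : nat) := Octic {
  zeta : L;
  sd : L;
  sg : {rmorphism L -> L};
  tau : {rmorphism L -> L};
  rho : {rmorphism L -> L};
  zeta4 : zeta ^+ 4 = -1;
  sd2 : sd ^+ 2 = d%:R;
  sg_zeta : sg zeta = zeta;
  sg_sd : sg sd = - sd;
  tau_zeta : tau zeta = - zeta ^+ 3;
  tau_sd : tau sd = sd;
  rho_zeta : rho zeta = - zeta;
  rho_sd : rho sd = sd;
  octic_span : forall x, exists a0 a1 a2 a3 b0 b1 b2 b3 : rat,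
    x = zcomb zeta a0 a1 a2 a3 + zcomb zeta b0 b1 b2 b3 * sd;
  octic_gt2 : (2 < d)%N;
  octic_odd : odd d;
  octic_sqfree : squarefree d;
  octic_primes : forall p : nat, prime p -> (p %| d)%N -> (p = 1 %[mod 8])%N }.

(** * Construction of the three automorphisms *)

Section Construction.

Variables (d : nat) (L : splittingFieldType rat) (zeta8 sqrtd : L) (K : {subfield L}).
Hypotheses (d_gt2 : (2 < d)%N) (d_odd : odd d) (d_sqfree : squarefree d).
Hypothesis d_primes : forall p : nat, prime p -> (p %| d)%N -> (p = 1 %[mod 8])%N.
Hypotheses (zeta8P : 8.-primitive_root zeta8) (sqrtdP : sqrtd ^+ 2 = d%:R).
Hypotheses (KE : K = <<1; zeta8>>%AS) (LE : <<K; sqrtd>>%VS = fullv).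

Let im := zeta8 ^+ 2.
Let s2 := zeta8 - zeta8 ^+ 3.

Let z4 : zeta8 ^+ 4 = -1.
Proof.
have /eqP : (zeta8 ^+ 4) ^+ 2 = 1 by rewrite -exprM (prim_expr_order zeta8P).
rewrite sqrf_eq1 => /orP[]/eqP // e1.
by have := prim_order_dvd zeta8P 4; rewrite e1 eqxx.
Qed.

Let im2 : im ^+ 2 = (-1)%:~R. Proof. by rewrite /im -exprM z4 rmorphN. Qed.

Let s22 : s2 ^+ 2 = 2%:~R.
Proof.
have -> : s2 ^+ 2 = zeta8 ^+ 2 * (1 + zeta8 ^+ 4) - 2 * zeta8 ^+ 4 by rewrite /s2; ring.
by rewrite z4 subrr mulr0 sub0r mulrN1 opprK.
Qed.

Let sd2' : sqrtd ^+ 2 = d%:Z%:~R. Proof. exact: sqrtdP. Qed.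

Let zetaE : zeta8 = (s2 + s2 * im) / 2.
Proof.
have -> : s2 + s2 * im = zeta8 - zeta8 * zeta8 ^+ 4 by rewrite /s2 /im; ring.
by rewrite z4 mulrN1 opprK; field; apply: two_neq0.
Qed.

Let sq2d := squarefree_double d_odd d_sqfree.

Let nsq (q : rat) : [/\ q ^+ 2 != d%:Q, q ^+ 2 != (2 * d)%N%:Q & q ^+ 2 != 2%N%:Q].
Proof.
split; apply: squarefree_not_square => //; [by apply: ltn_trans d_gt2 | | exact: squarefree2].
by rewrite (leq_trans (ltnW d_gt2)) // leq_pmull.
Qed.

Let nneg (q : rat) : [/\ q ^+ 2 != - 1%N%:Q, q ^+ 2 != - 2%N%:Q, q ^+ 2 != - d%:Q & q ^+ 2 != - (2 * d)%N%:Q].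
Proof. by have d0 := ltn_trans (isT : (0 < 2)%N) d_gt2; split; apply: neg_not_square; rewrite ?muln_gt0. Qed.

Let im_notin : im \notin <<<<1; s2>>; sqrtd>>%AS.
Proof.
apply: (sqrt_notin_biquadratic s22 sd2' im2) => q; have [? ? ? ?] := nneg q.
by split; rewrite ?mulN1r ?mulNr ?rmorphN //= ?(mulrC d%:Z) -?PoszM.
Qed.

Let s2_notin : s2 \notin <<<<1; im>>; sqrtd>>%AS.
Proof.
apply: (sqrt_notin_biquadratic im2 sd2' s22) => q; have [? ? ? ?] := nneg q.
have [? ? ?] := nsq q.
by split; rewrite ?mulrN1 ?rmorphN //= -?PoszM.
Qed.

Let sd_notin : sqrtd \notin K.
Proof.
apply/negP => sdK.
have : sqrtd \notin <<<<1; im>>; s2>>%AS.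
  apply: (sqrt_notin_biquadratic im2 s22 sd2') => q; have [? ? ? ?] := nneg q.
  have [? ? ?] := nsq q.
  by split; rewrite ?mulrN1 ?rmorphN //= ?(mulrC d%:Z) -?PoszM.
apply/negP; rewrite negbK; move: sdK; rewrite KE; apply/subvP.
apply/FadjoinP; split; first by rewrite sub1v.
have imF : im \in <<<<1; im>>; s2>>%AS.
  by apply: (subvP (subv_adjoin _ s2)); apply: memv_adjoin.
have s2F : s2 \in <<<<1; im>>; s2>>%AS by apply: memv_adjoin.
rewrite zetaE; apply: rpred_div; last exact: rpred_nat.
by apply: rpredD => //; apply: rpredM.
Qed.

Let span_K x : x \in K -> exists a0 a1 a2 a3, x = zcomb zeta8 a0 a1 a2 a3.
Proof.
rewrite KE => xK.
have deg : (adjoin_degree 1 zeta8 <= 4)%N.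
  rewrite -ltnS -size_minPoly.
  have pF : 'X^4 - (-1)%:P \is a polyOver (1%AS : {subfield L}).
    by rewrite rpredB ?rpredX ?polyOverX ?polyOverC // rpredN rpred1.
  have sz : size ('X^4 - (-1)%:P : {poly L}) = 5%N by rewrite size_XnsubC.
  rewrite -[X in (_ <= X)%N]sz; apply: dvdp_leq; first by rewrite -size_poly_eq0 sz.
  by apply: minPoly_dvdp => //; rewrite /root !hornerE z4 subrr.
have /polyOverP pF := Fadjoin_polyOver 1 zeta8 x.
have cF i : exists a : rat, (Fadjoin_poly 1 zeta8 x)`_i = a%:A by apply/vlineP.
have [a aP] := choice cF.
exists (a 0%N), (a 1%N), (a 2%N), (a 3%N); rewrite -(Fadjoin_poly_eq xK).
rewrite (horner_coef_wide (n := 4)); last exact: leq_trans (size_Fadjoin_poly _ _ _) deg.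
by rewrite !big_ord_recl big_ord0 /= !aP zcombE /= expr0 mulr1 expr1 addr0 !addrA.
Qed.

Let span_L x : exists a b, [/\ a \in K, b \in K & x = a + b * sqrtd].
Proof.
apply: Fadjoin_sqrt; last by rewrite LE memvf.
by rewrite sqrtdP rpred_nat.
Qed.

Let opp_of_sqr (g : {rmorphism L -> L}) (x : L) (m : int) : x ^+ 2 = m%:~R -> g x != x -> g x = - x.
Proof.
move=> xm; have /eqP : (g x) ^+ 2 = x ^+ 2 by rewrite -rmorphXn xm rmorph_int.
by rewrite eqf_sqr => /orP[/eqP->|/eqP->] //; rewrite eqxx.
Qed.

(** [sg] moves sqrt d over K, [tau] moves i over Q(sqrt 2, sqrt d), and [rho] moves sqrt 2 over Q(i,
    sqrt d). An element of Gal(L/K) is determined by its value at sqrt d, so this group is {1, [sg]}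
    and the norm is x s(x). *)
Lemma octic_exists : exists T : octic L d,
  (forall x, x \in K <-> sg T x = x) /\ (forall x, galNorm K {:L} x = x * sg T x).
Proof.
have [h hG hsd] := exists_moving_gal sd_notin.
pose s : {rmorphism L -> L} := gal_repr h.
have sK x : x \in K -> s x = x by apply: fixed_gal (subvf K) hG.
have ssd : s sqrtd = - sqrtd by apply: opp_of_sqr sd2' hsd.
have [t [tF tim]] := exists_moving_automorphism im_notin.
have {}tim : t im = - im by apply: opp_of_sqr im2 tim.
have tsd : t sqrtd = sqrtd by apply: tF; apply: memv_adjoin.
have ts2 : t s2 = s2.
  by apply: tF; apply: (subvP (subv_adjoin _ sqrtd)); apply: memv_adjoin.
have [r [rF rs2]] := exists_moving_automorphism s2_notin.
have {}rs2 : r s2 = - s2 by apply: opp_of_sqr s22 rs2.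
have rsd : r sqrtd = sqrtd by apply: rF; apply: memv_adjoin.
have rim : r im = im.
  by apply: rF; apply: (subvP (subv_adjoin _ sqrtd)); apply: memv_adjoin.
have zK : zeta8 \in K by rewrite KE; apply: memv_adjoin.
have tz : t zeta8 = - zeta8 ^+ 3.
  rewrite {1}zetaE fmorph_div rmorphD rmorphM /= tim ts2 rmorph_nat.
  have -> : s2 + s2 * - im = - 2 * zeta8 ^+ 3 + zeta8 * (1 + zeta8 ^+ 4) by rewrite /s2 /im; ring.
  by rewrite z4 subrr mulr0 addr0; field; apply: two_neq0.
have rz : r zeta8 = - zeta8.
  rewrite {1}zetaE fmorph_div rmorphD rmorphM /= rim rs2 rmorph_nat.
  by rewrite [in RHS]zetaE; field; apply: two_neq0.
have spanL x : exists a0 a1 a2 a3 b0 b1 b2 b3 : rat,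
    x = zcomb zeta8 a0 a1 a2 a3 + zcomb zeta8 b0 b1 b2 b3 * sqrtd.
  have [a [b [/span_K[a0 [a1 [a2 [a3 ->]]]] /span_K[b0 [b1 [b2 [b3 ->]]]] ->]]] := span_L x.
  by exists a0, a1, a2, a3, b0, b1, b2, b3.
exists (Octic z4 sqrtdP (sK _ zK) ssd tz tsd rz rsd spanL d_gt2 d_odd d_sqfree d_primes).
have sd0 : sqrtd != 0 by apply: contraNneq sd_notin => ->; apply: rpred0.
split=> x /=.
  split=> [|sx]; first exact: sK.
  have [a [b [aK bK xE]]] := span_L x.
  suff b0 : b = 0 by rewrite xE b0 mul0r addr0.
  move: sx; rewrite xE rmorphD rmorphM /= (sK _ aK) (sK _ bK) ssd.
  move/addrI/eqP; rewrite mulrN eq_sym -addr_eq0 -mulr2n -mulr_natl !mulf_eq0 (negbTE sd0).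
  by rewrite (negbTE (two_neq0 L)) orbF => /eqP.
rewrite /galNorm.
have GE : 'Gal({:L} / K)%g = [set (1%g : gal_of {:L}); h]%SET.
  apply/setP => g; rewrite !inE; apply/idP/idP => [gG|]; last by case/orP=> /eqP->; [apply: fingroup.group1 | apply: hG].
  have gK y : y \in K -> g y = y by apply: fixed_gal (subvf K) gG.
  have [gsd|gsd] := eqVneq (g sqrtd) sqrtd.
    apply/orP; left; apply/gal_eqP => y _; have [a [b [aK bK ->]]] := span_L y.
    by rewrite gal_id rmorphD rmorphM /= (gK _ aK) (gK _ bK) gsd.
  have {}gsd : g sqrtd = - sqrtd by apply: (@opp_of_sqr (gal_repr g)) sd2' gsd.
  apply/orP; right; apply/gal_eqP => y _; have [a [b [aK bK ->]]] := span_L y.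
  rewrite !rmorphD !rmorphM /= (gK _ aK) (gK _ bK) gsd.
  by rewrite -/(s a) (sK _ aK) -/(s b) (sK _ bK) -/(s sqrtd) ssd.
have n1h : 1%g != h.
  by apply: contraNneq hsd => <-; rewrite gal_id.
by rewrite GE big_setU1 ?inE //= big_set1 gal_id.
Qed.

End Construction.

(** * Coordinates with respect to the powers of zeta *)

Section Arithmetic.

Variables (L : fieldExtType rat) (d : nat) (T : octic L d).
Local Notation z := (zeta T).
Local Notation w := (sd T).
Local Notation s := (sg T).
Local Notation t := (tau T).
Local Notation r := (rho T).
Local Notation quartic := (zcomb z).

Lemma rmorph_alg (g : {rmorphism L -> L}) (q : rat) : g q%:A = q%:A.
Proof.
have e1 := fmorph_eq_rat (g \o in_alg L : {rmorphism rat -> L}) q.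
by have e2 := fmorph_eq_rat (in_alg L) q; rewrite /= in e1 e2; rewrite e1 e2.
Qed.

Lemma sg_quartic a0 a1 a2 a3 : s (quartic a0 a1 a2 a3) = quartic a0 a1 a2 a3.
Proof. by rewrite !zcombE !rmorphD !(rmorphXn, rmorphM) /= !rmorph_alg sg_zeta. Qed.

Lemma quartic_tau a0 a1 a2 a3 : t (quartic a0 a1 a2 a3) = quartic a0 (- a3) (- a2) (- a1).
Proof.
rewrite !zcombE !rmorphD !(rmorphXn, rmorphM) /= !rmorph_alg tau_zeta !scaleNr.
have -> : (- z ^+ 3) ^+ 2 = z ^+ 4 * z ^+ 2 by ring.
have -> : (- z ^+ 3) ^+ 3 = - ((z ^+ 4) ^+ 2 * z) by ring.
by rewrite zeta4; ring.
Qed.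

Lemma quartic_rho a0 a1 a2 a3 : r (quartic a0 a1 a2 a3) = quartic a0 (- a1) a2 (- a3).
Proof.
rewrite !zcombE !rmorphD !(rmorphXn, rmorphM) /= !rmorph_alg rho_zeta !scaleNr.
by ring.
Qed.

Lemma quarticD a0 a1 a2 a3 b0 b1 b2 b3 :
  quartic a0 a1 a2 a3 + quartic b0 b1 b2 b3 = quartic (a0 + b0) (a1 + b1) (a2 + b2) (a3 + b3).
Proof. by rewrite !zcombE !scalerDl; ring. Qed.

Lemma quarticN a0 a1 a2 a3 : - quartic a0 a1 a2 a3 = quartic (- a0) (- a1) (- a2) (- a3).
Proof. by rewrite !zcombE !scaleNr; ring. Qed.

Lemma quarticM a0 a1 a2 a3 b0 b1 b2 b3 :
  quartic a0 a1 a2 a3 * quartic b0 b1 b2 b3 =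
  quartic (a0 * b0 - a1 * b3 - a2 * b2 - a3 * b1)
          (a0 * b1 + a1 * b0 - a2 * b3 - a3 * b2)
          (a0 * b2 + a1 * b1 + a2 * b0 - a3 * b3)
          (a0 * b3 + a1 * b2 + a2 * b1 + a3 * b0).
Proof.
have algM (x y : rat) : (x * y)%:A = x%:A * y%:A :> L.
  by rewrite -scalerAl mul1r scalerA.
rewrite !zcombE !(scalerDl, scaleNr, algM).
move: (a0%:A : L) (a1%:A : L) (a2%:A : L) (a3%:A : L) => {}a0 {}a1 {}a2 {}a3.
move: (b0%:A : L) (b1%:A : L) (b2%:A : L) (b3%:A : L) => {}b0 {}b1 {}b2 {}b3.
set lhs := LHS; set rhs := RHS; suff : lhs = rhs + (z ^+ 4 + 1) *
   (a1 * b3 + a2 * b2 + a3 * b1 + (a2 * b3 + a3 * b2) * z + a3 * b3 * z ^+ 2).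
  by rewrite zeta4 addNr mul0r addr0.
by rewrite /lhs /rhs; ring.
Qed.

(** The trace down to Q is four times the constant coordinate, and division by zeta shifts the
    coordinates, so each of them vanishes in turn. *)
Lemma quartic_eq0 a0 a1 a2 a3 : quartic a0 a1 a2 a3 = 0 -> [/\ a0 = 0, a1 = 0, a2 = 0 & a3 = 0].
Proof.
have z0 : z != 0.
  by apply/eqP => z0; have /eqP := zeta4 T; rewrite z0 expr0n eq_sym oppr_eq0 oner_eq0.
have key b0 b1 b2 b3 : quartic b0 b1 b2 b3 = 0 -> b0 = 0.
  move=> e; have : quartic b0 b1 b2 b3 + r (quartic b0 b1 b2 b3) +
     t (quartic b0 b1 b2 b3 + r (quartic b0 b1 b2 b3)) = 0.
    by rewrite e !(rmorph0, addr0).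
  rewrite quartic_rho quarticD quartic_tau quarticD !zcombE.
  rewrite !(addrN, addNr, subrr, oppr0, addr0, scale0r, mul0r) /=.
  move=> /eqP; rewrite scaler_eq0 oner_eq0 orbF => /eqP; lra.
move=> e; have e0 := key _ _ _ _ e.
have mulz b0 b1 b2 b3 : quartic b0 b1 b2 b3 = 0 -> quartic b1 b2 b3 (- b0) = 0.
  (* The factor is - zeta^3, the inverse of zeta. *)
  move=> eb; have := quarticM b0 b1 b2 b3 0 0 0 (-1); rewrite eb mul0r => ->.
  by congr (zcomb _ _ _ _ _); ring.
have f1 := mulz _ _ _ _ e; have f2 := mulz _ _ _ _ f1; have f3 := mulz _ _ _ _ f2.
by rewrite e0 (key _ _ _ _ f1) (key _ _ _ _ f2) (key _ _ _ _ f3).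
Qed.

Lemma quartic_inj a0 a1 a2 a3 b0 b1 b2 b3 :
  quartic a0 a1 a2 a3 = quartic b0 b1 b2 b3 -> [/\ a0 = b0, a1 = b1, a2 = b2 & a3 = b3].
Proof.
move/eqP; rewrite -subr_eq0 quarticN quarticD => /eqP/quartic_eq0[].
by do 4 (move=> /eqP; rewrite subr_eq0 => /eqP ->).
Qed.

Lemma two_torsionfree (x : L) : x = - x -> x = 0.
Proof.
move/eqP; rewrite -addr_eq0 -mulr2n -mulr_natl mulf_eq0 (negbTE (two_neq0 L)) /=.
by move/eqP.
Qed.

Lemma sd_neq0 : w != 0.
Proof.
apply/eqP => w0; have := sd2 T; rewrite w0 expr0n => /esym/eqP.
by rewrite natrL_eq0 => /eqP d0; have := octic_gt2 T; rewrite d0.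
Qed.

Lemma fixed_quartic x : s x = x -> exists a0 a1 a2 a3, x = quartic a0 a1 a2 a3.
Proof.
have [a0 [a1 [a2 [a3 [b0 [b1 [b2 [b3 xE]]]]]]]] := octic_span T x.
move=> sx; exists a0, a1, a2, a3; move: sx; rewrite xE rmorphD rmorphM /= !sg_quartic sg_sd.
move/addrI; rewrite mulrN => /esym/two_torsionfree ->; by rewrite addr0.
Qed.

Lemma sgK x : s (s x) = x.
Proof.
have [a0 [a1 [a2 [a3 [b0 [b1 [b2 [b3 ->]]]]]]]] := octic_span T x.
by rewrite !rmorphD !rmorphM /= sg_sd !sg_quartic rmorphN /= sg_sd opprK.
Qed.

Lemma tauK x : t (t x) = x.
Proof.
have [a0 [a1 [a2 [a3 [b0 [b1 [b2 [b3 ->]]]]]]]] := octic_span T x.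
by rewrite !rmorphD !rmorphM /= !tau_sd !quartic_tau !opprK.
Qed.

Lemma rhoK x : r (r x) = x.
Proof.
have [a0 [a1 [a2 [a3 [b0 [b1 [b2 [b3 ->]]]]]]]] := octic_span T x.
by rewrite !rmorphD !rmorphM /= !rho_sd !quartic_rho !opprK.
Qed.

Lemma sg_tau x : s (t x) = t (s x).
Proof.
have [a0 [a1 [a2 [a3 [b0 [b1 [b2 [b3 ->]]]]]]]] := octic_span T x.
by rewrite !rmorphD !rmorphM /= tau_sd sg_sd !quartic_tau !sg_quartic !quartic_tau rmorphN /= tau_sd.
Qed.

Lemma sg_rho x : s (r x) = r (s x).
Proof.
have [a0 [a1 [a2 [a3 [b0 [b1 [b2 [b3 ->]]]]]]]] := octic_span T x.
by rewrite !rmorphD !rmorphM /= rho_sd sg_sd !quartic_rho !sg_quartic !quartic_rho rmorphN /= rho_sd.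
Qed.

Lemma tau_rho x : t (r x) = r (t x).
Proof.
have [a0 [a1 [a2 [a3 [b0 [b1 [b2 [b3 ->]]]]]]]] := octic_span T x.
by rewrite !rmorphD !rmorphM /= !(rho_sd, tau_sd) !(quartic_rho, quartic_tau) ?opprK.
Qed.

End Arithmetic.

(** * The ring of integers of Q(zeta_8) and its Euclidean division *)

Section RingOK.

Variables (L : fieldExtType rat) (d : nat) (T : octic L d).
Local Notation z := (zeta T).
Local Notation w := (sd T).
Local Notation s := (sg T).
Local Notation t := (tau T).
Local Notation r := (rho T).
Local Notation quartic := (zcomb z).

Definition inK (x : L) : Prop := s x = x.

Lemma inKD x y : inK x -> inK y -> inK (x + y).
Proof. by rewrite /inK rmorphD => -> ->. Qed.

Lemma inKN x : inK x -> inK (- x).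
Proof. by rewrite /inK rmorphN => ->. Qed.

Lemma inKB x y : inK x -> inK y -> inK (x - y).
Proof. by move=> xK yK; apply/inKD/inKN. Qed.

Lemma inKM x y : inK x -> inK y -> inK (x * y).
Proof. by rewrite /inK rmorphM => -> ->. Qed.

Lemma inKV x : inK x -> inK x^-1.
Proof. by rewrite /inK fmorphV => ->. Qed.

Lemma inK_int (m : int) : inK m%:~R. Proof. exact: rmorph_int. Qed.

Lemma inK0 : inK 0. Proof. exact: rmorph0. Qed.

Lemma inK1 : inK 1. Proof. exact: rmorph1. Qed.

Lemma inK_zeta : inK z. Proof. exact: sg_zeta. Qed.

Lemma inK_norm x : inK (x * s x).
Proof. by rewrite /inK rmorphM /= sgK mulrC. Qed.

Lemma inK_trace x : inK (x + s x).
Proof. by rewrite /inK rmorphD /= sgK addrC. Qed.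

(* The norm from K to Q. *)
Definition NmK (x : L) : L := x * r x * t (x * r x).

Lemma NmKM x y : NmK (x * y) = NmK x * NmK y.
Proof. by rewrite /NmK !rmorphM /=; ring. Qed.

Lemma NmK_eq0 x : NmK x = 0 -> x = 0.
Proof. by move/eqP; rewrite /NmK !(mulf_eq0, fmorph_eq0) !orbb => /eqP. Qed.

(** The norm to Q(i) of a0 + a1 zeta + a2 zeta^2 + a3 zeta^3 is (a0 + a2 i)^2 - i (a1 + a3 i)^2; the
    two squares are those of its real and imaginary parts. *)
Definition qnorm (a0 a1 a2 a3 : rat) : rat :=
  (a0 ^+ 2 - a2 ^+ 2 + 2 * a1 * a3) ^+ 2 + (2 * a0 * a2 - a1 ^+ 2 + a3 ^+ 2) ^+ 2.

Lemma zcomb_rat (a : rat) : quartic a 0 0 0 = a%:A.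
Proof. by rewrite zcombE !scale0r !mul0r !addr0. Qed.

Lemma NmK_zcomb a0 a1 a2 a3 : NmK (quartic a0 a1 a2 a3) = (qnorm a0 a1 a2 a3)%:A.
Proof.
rewrite /NmK quartic_rho quarticM quartic_tau quarticM -zcomb_rat.
by congr zcomb; rewrite /qnorm; ring.
Qed.

Lemma qnorm_ge0 a0 a1 a2 a3 : 0 <= qnorm a0 a1 a2 a3.
Proof. by rewrite addr_ge0 ?sqr_ge0. Qed.

(** This makes Z[zeta] Euclidean. With x_i = a_i^2 <= 1/4 the cross terms are at most |x0 - x2| and
    |x1 - x3|. Each of (x0 + x2)^2 + |x0 - x2| and (x1 + x3)^2 + |x1 - x3| is at most 3/8, which
    leaves 3/4 in all. *)
Lemma qnorm_lt1 (a0 a1 a2 a3 : rat) : `|a0| <= 2^-1 -> `|a1| <= 2^-1 -> `|a2| <= 2^-1 ->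
  `|a3| <= 2^-1 -> qnorm a0 a1 a2 a3 < 1.
Proof.
have sqr_le (a : rat) : `|a| <= 2^-1 -> a ^+ 2 <= 4^-1.
  move=> h; rewrite -real_normK ?num_real //.
  have -> : 4^-1 = 2^-1 ^+ 2 :> rat by [].
  by rewrite ler_pXn2r ?nnegrE // invr_ge0.
move=> /sqr_le h0 /sqr_le h1 /sqr_le h2 /sqr_le h3.
have p0 := sqr_ge0 a0; have p1 := sqr_ge0 a1; have p2 := sqr_ge0 a2; have p3 := sqr_ge0 a3.
have id : qnorm a0 a1 a2 a3 = (a0 ^+ 2 + a2 ^+ 2) ^+ 2 + (a1 ^+ 2 + a3 ^+ 2) ^+ 2
   + 4 * (a1 * a3) * (a0 ^+ 2 - a2 ^+ 2) - 4 * (a0 * a2) * (a1 ^+ 2 - a3 ^+ 2).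
  by rewrite /qnorm; ring.
have b1 : `|a1 * a3| <= 4^-1.
  rewrite ler_norml; apply/andP; split.
    by have := sqr_ge0 (a1 + a3); rewrite sqrrD; lra.
  by have := sqr_ge0 (a1 - a3); rewrite sqrrB; lra.
have b2 : `|a0 * a2| <= 4^-1.
  rewrite ler_norml; apply/andP; split.
    by have := sqr_ge0 (a0 + a2); rewrite sqrrD; lra.
  by have := sqr_ge0 (a0 - a2); rewrite sqrrB; lra.
have c1 : `|a1 * a3 * (a0 ^+ 2 - a2 ^+ 2)| <= 4^-1 * `|a0 ^+ 2 - a2 ^+ 2|.
  by rewrite normrM ler_wpM2r.
have c2 : `|a0 * a2 * (a1 ^+ 2 - a3 ^+ 2)| <= 4^-1 * `|a1 ^+ 2 - a3 ^+ 2|.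
  by rewrite normrM ler_wpM2r.
move: c1 c2; rewrite !ler_norml => /andP[_ c1] /andP[c2 _].
rewrite id.
have -> : 4 * (a1 * a3) * (a0 ^+ 2 - a2 ^+ 2) = 4 * (a1 * a3 * (a0 ^+ 2 - a2 ^+ 2)) by ring.
have -> : 4 * (a0 * a2) * (a1 ^+ 2 - a3 ^+ 2) = 4 * (a0 * a2 * (a1 ^+ 2 - a3 ^+ 2)) by ring.
move: c1 c2; move: (a1 * a3 * _) (a0 * a2 * _) => u v.
move: (a0 ^+ 2) (a1 ^+ 2) (a2 ^+ 2) (a3 ^+ 2) h0 h1 h2 h3 p0 p1 p2 p3 => x0 x1 x2 x3.
move=> h0 h1 h2 h3 p0 p1 p2 p3 c1 c2.
have q1 : (x0 + x2) ^+ 2 + `|x0 - x2| <= 3 / 8.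
  by case: (ler0P (x0 - x2)); nra.
have q2 : (x1 + x3) ^+ 2 + `|x1 - x3| <= 3 / 8.
  by case: (ler0P (x1 - x3)); nra.
lra.
Qed.

(** The ring Z[zeta]; that it contains all integers of K is proved in [OKZ]. *)
Definition ZK (x : L) : Prop :=
  exists n0 n1 n2 n3 : int, x = quartic n0%:~R n1%:~R n2%:~R n3%:~R.

Lemma ZK_inK x : ZK x -> inK x.
Proof. by move=> [n0 [n1 [n2 [n3 ->]]]]; apply: sg_quartic. Qed.

Lemma ZKD x y : ZK x -> ZK y -> ZK (x + y).
Proof.
move=> [n0 [n1 [n2 [n3 ->]]]] [m0 [m1 [m2 [m3 ->]]]].
by exists (n0 + m0), (n1 + m1), (n2 + m2), (n3 + m3); rewrite quarticD !rmorphD.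
Qed.

Lemma ZKN x : ZK x -> ZK (- x).
Proof.
move=> [n0 [n1 [n2 [n3 ->]]]].
by exists (- n0), (- n1), (- n2), (- n3); rewrite quarticN !rmorphN.
Qed.

Lemma ZKM x y : ZK x -> ZK y -> ZK (x * y).
Proof.
move=> [n0 [n1 [n2 [n3 ->]]]] [m0 [m1 [m2 [m3 ->]]]].
exists (n0 * m0 - n1 * m3 - n2 * m2 - n3 * m1), (n0 * m1 + n1 * m0 - n2 * m3 - n3 * m2),
  (n0 * m2 + n1 * m1 + n2 * m0 - n3 * m3), (n0 * m3 + n1 * m2 + n2 * m1 + n3 * m0).
by rewrite quarticM !(rmorphB, rmorphD) !rmorphM.
Qed.

Lemma ZK_int (m : int) : ZK m%:~R.
Proof. by exists m, 0, 0, 0; rewrite zcomb_rat intr_alg. Qed.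

Lemma zeta_zcomb : z = quartic 0 1 0 0.
Proof. by rewrite zcombE !scale0r !mul0r scale1r mul1r !addr0 add0r. Qed.

Lemma ZK_zeta : ZK z.
Proof. by exists 0, 1, 0, 0; apply: zeta_zcomb. Qed.

Lemma ZK_integral x : ZK x -> is_integral x.
Proof.
move=> [n0 [n1 [n2 [n3 ->]]]]; rewrite zcombE !intr_alg.
have zi : is_integral z.
  by apply: integral_sqrt; apply: integral_sqrt; rewrite -exprM zeta4 -[-1]/((-1)%:~R); apply: int_integral.
have zk k : is_integral (z ^+ k).
  by elim: k => [|k IHk]; [apply: integral1 | rewrite exprS; apply: integral_mul].
apply: integral_add; first (apply: integral_add; first apply: integral_add);
  try apply: integral_mul; try exact: int_integral; try exact: zk.
exact: zi.
Qed.

Lemma ZK_NmK x : ZK x -> exists k : nat, NmK x = k%:R.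
Proof.
move=> [n0 [n1 [n2 [n3 ->]]]].
pose m := (n0 ^+ 2 - n2 ^+ 2 + 2 * n1 * n3) ^+ 2 + (2 * n0 * n2 - n1 ^+ 2 + n3 ^+ 2) ^+ 2.
have m0 : 0 <= m by rewrite addr_ge0 ?sqr_ge0.
exists (absz m); rewrite NmK_zcomb -[RHS]/((absz m)%:Z%:~R) gez0_abs // -intr_alg; congr (_%:A).
by rewrite /qnorm /m; ring.
Qed.

Lemma rat_round (a : rat) : exists n : int, `|a - n%:~R| <= 2^-1.
Proof.
exists (Num.floor (a + 2^-1)); rewrite ler_norml.
have h1 : (Num.floor (a + 2^-1))%:~R <= a + 2^-1 by apply: Num.Theory.floor_le.
have := Num.Theory.floorD1_gt (a + 2^-1); rewrite rmorphD /= => h2.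
by apply/andP; split; lra.
Qed.

Lemma euclid_K x : inK x -> exists2 y, ZK y & exists2 q : rat, 0 <= q < 1 & NmK (x - y) = q%:A.
Proof.
move=> /fixed_quartic[a0 [a1 [a2 [a3 ->]]]].
have [n0 h0] := rat_round a0; have [n1 h1] := rat_round a1.
have [n2 h2] := rat_round a2; have [n3 h3] := rat_round a3.
exists (quartic n0%:~R n1%:~R n2%:~R n3%:~R); first by exists n0, n1, n2, n3.
rewrite quarticN quarticD NmK_zcomb; eexists; last reflexivity.
by rewrite qnorm_ge0 qnorm_lt1.
Qed.

(** Every fractional ideal of Z[zeta] is principal: the common denominator c turns norms into
    natural numbers, and an element of least nonzero norm generates, by Euclidean division. *)
Lemma pid_ZK (M : set L) (c : nat) :
  (forall x, M x -> inK x) -> (forall x y, M x -> M y -> M (x - y)) ->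
  (forall a x, ZK a -> M x -> M (a * x)) -> (0 < c)%N ->
  (forall x, M x -> ZK (c%:R * x)) -> (exists2 x, M x & x != 0) ->
  exists g, [/\ M g, g != 0 & forall x, M x -> exists2 a, ZK a & x = a * g].
Proof.
move=> MK MB MM c0 Mc [x0 Mx0 x0n0].
have cn0 : c%:R != 0 :> L by rewrite natrL_eq0 -lt0n.
pose P k := `[< exists g, [/\ M g, g != 0 & NmK (c%:R * g) = k%:R] >].
have exP : exists k, P k.
  have [k kP] := ZK_NmK (Mc _ Mx0); exists k; apply/asboolP; by exists x0.
have [k /asboolP[g [Mg g0 gk]] kmin] := ex_minnP exP.
exists g; split=> // x Mx.
have [y yZ [q /andP[q0 q1] qE]] := euclid_K (inKM (MK _ Mx) (inKV (MK _ Mg))).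
exists y => //; apply/eqP; rewrite -subr_eq0; apply/negPn/negP => n0.
have Mxy : M (x - y * g) by apply: MB => //; apply: MM.
have [m mE] := ZK_NmK (Mc _ Mxy).
have Pm : P m by apply/asboolP; exists (x - y * g).
have mqk : m%:R = q * k%:R :> rat.
  apply: (fmorph_inj (in_alg L)); rewrite /= -[m%:R]/(m%:Z%:~R) intr_alg -[LHS]mE.
  have -> : c%:R * (x - y * g) = (x / g - y) * (c%:R * g) by field.
  by rewrite NmKM qE gk -scalerAl mul1r -[k%:R]/(k%:Z%:~R) -[k%:R in RHS]/(k%:Z%:~R) -intr_alg scalerA.
have := kmin _ Pm; rewrite leqNgt => /negP[].
have k0 : (0 < k)%N.
  rewrite lt0n; apply/eqP => k0; move: gk; rewrite k0 => /NmK_eq0/eqP.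
  by rewrite mulf_eq0 (negbTE cn0) (negbTE g0).
by rewrite -(ltr_nat rat) mqk -[X in _ < X]mul1r ltr_pM2r ?ltr0n.
Qed.

Definition OK (x : L) : Prop := inK x /\ is_integral x.

Lemma OK_trace x : OK x -> exists n : int, forall a0 a1 a2 a3, x = quartic a0 a1 a2 a3 -> 4 * a0 = n%:~R.
Proof.
move=> [xK xi].
have [a0 [a1 [a2 [a3 xE]]]] := fixed_quartic xK.
have : is_integral (x + r x + t (x + r x)).
  by apply: integral_add; [|apply: integral_fmorph]; apply: integral_add => //; apply: integral_fmorph.
rewrite xE quartic_rho quarticD quartic_tau quarticD.
have -> : a0 + a0 + (a0 + a0) = 4 * a0 by ring.
rewrite !(addrN, addNr, oppr0, addr0) zcomb_rat => /rat_integral/intrP[n nE].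
by exists n => b0 b1 b2 b3 /quartic_inj[<- _ _ _].
Qed.

(** Up to sign, the coordinates of x are the constant coordinates of zeta^k x, and four times these
    are traces of integers. *)
Lemma OK_ZK4 x : OK x -> ZK (4%:R * x).
Proof.
move=> [xK xi]; have [a0 [a1 [a2 [a3 xE]]]] := fixed_quartic xK.
have zOK k : OK (z ^+ k * x).
  have zi : is_integral z by apply/ZK_integral/ZK_zeta.
  split; elim: k => [|k IHk]; rewrite ?mul1r // exprS -mulrA.
    by apply: inKM => //; apply: inK_zeta.
  exact: integral_mul.
have zM b0 b1 b2 b3 : z * quartic b0 b1 b2 b3 = quartic (- b3) b0 b1 b2.
  by rewrite {1}zeta_zcomb quarticM; congr zcomb; ring.
have [n0 /(_ _ _ _ _ xE) e0] := OK_trace (conj xK xi).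
have [n3 e3] := OK_trace (zOK 1%N); have [n2 e2] := OK_trace (zOK 2%N); have [n1 e1] := OK_trace (zOK 3%N).
exists n0, (- n1), (- n2), (- n3).
have -> : 4%:R = quartic 4%:R 0 0 0 by rewrite zcomb_rat -[4%:R in RHS]/(4%:Z%:~R) intr_alg.
rewrite xE in e1 e2 e3 *. rewrite quarticM !rmorphN /= -e0.
rewrite !exprS expr0 mulr1 -?mulrA !zM in e1 e2 e3.
rewrite -(e1 _ _ _ _ erefl) -(e2 _ _ _ _ erefl) -(e3 _ _ _ _ erefl).
by congr zcomb; ring.
Qed.

(** The integers of K form a Z[zeta]-module with denominator 4, generated by some g according to
    [pid_ZK]. As g^2 is an integer, g^2 = a g with a in Z[zeta]; so g = a, and every integer lies in
    Z[zeta]. *)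
Lemma OKZ x : OK x <-> ZK x.
Proof.
split=> [xO|xZ]; last by split; [apply: ZK_inK | apply: ZK_integral].
have [||||||g [[gK gi] g0 gP]] := @pid_ZK OK 4.
- by move=> y [].
- by move=> a b [aK ai] [bK bi]; split; [apply: inKB | apply: integral_sub].
- move=> a b aZ [bK bi]; split; first by apply: inKM => //; apply: ZK_inK.
  by apply: integral_mul => //; apply: ZK_integral.
- by [].
- exact: OK_ZK4.
- by exists 1; [split; [apply: inK1 | apply: integral1] | apply: oner_neq0].
have [a aZ gg] : exists2 a, ZK a & g * g = a * g.
  by apply: gP; split; [apply: inKM | apply: integral_mul].
have ga : g = a by apply: (mulIf g0).
by have [b bZ ->] := gP x xO; rewrite ga; apply: ZKM.
Qed.

End RingOK.

(** * Divisors of d in Z[zeta] *)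

(** A pair (p, c) with c a root of X^4 + 1 modulo p stands for the morphism from Z[zeta] to F_p
    sending zeta to c, that is, for a prime ideal above p. *)
Definition zeta_homs (d : nat) : seq (nat * nat) :=
  [seq (p, c) | p <- primes d, c <- [seq c <- iota 0 p | (p %| c ^ 4 + 1)%N]].

(** As 8 divides p - 1, X^4 + 1 divides X^8 - 1 and then X^p - X, which is a product of distinct
    linear factors. *)
Lemma size_fourth_roots (p : nat) : prime p -> (p = 1 %[mod 8])%N ->
  size [seq c <- iota 0 p | (p %| c ^ 4 + 1)%N] = 4.
Proof.
move=> p_pr p8.
have p_gt0 := prime_gt0 p_pr.
pose q : {poly 'F_p} := 'X^4 + 1.
have sq : size q = 5 by rewrite /q -[1]opprK -[- 1]/(- 1%:P) -polyCN size_XnsubC.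
have qX : q %| 'X^p - 'X.
  have [m pm] : exists m, p = (8 * m).+1.
    by exists (p %/ 8)%N; rewrite {1}(divn_eq p 8) p8 mulnC addn1.
  have e8 : 'X^8 - 1 = q * ('X^4 - 1) :> {poly 'F_p} by rewrite /q; ring.
  have -> : 'X^p - 'X = ('X^(8 * m) - 1) * 'X :> {poly 'F_p}.
    by rewrite pm exprSr; ring.
  rewrite dvdp_mulr // exprM subrX1 e8 -mulrA dvdp_mulr //.
have Xp : 'X^p - 'X = \prod_(x : 'F_p) ('X - x%:P) :> {poly 'F_p}.
  by rewrite -finField_genPoly card_Fp.
have [m qm] : exists m, q %= \prod_(x <- mask m (index_enum 'F_p)) ('X - x%:P).
  by move: qX; rewrite Xp => /dvdp_prod_XsubC[m qm]; exists m.
pose rs := mask m (index_enum 'F_p).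
have urs : uniq rs by apply: mask_uniq; apply: index_enum_uniq.
have srs : size rs = 4.
  by move/eqp_size: qm; rewrite sq size_prod_XsubC => -[].
have rsP x : (x \in rs) = (x ^+ 4 + 1 == 0).
  by rewrite -root_prod_XsubC -(eqp_root qm) /root !hornerE.
rewrite -[RHS]srs -(size_map (fun x : 'F_p => (x : nat))).
apply/eqP; rewrite eqn_leq; apply/andP.
have dvdE (c : nat) : (p %| c ^ 4 + 1)%N = ((c%:R : 'F_p) ^+ 4 + 1 == 0).
  rewrite -natrX -[1 in RHS]/(1%:R) -natrD.
  by rewrite -(dvdn_pcharf (pchar_Fp p_pr)).
have modc (x : 'F_p) : ((x : nat)%:R : 'F_p) = x by rewrite natr_Zp.
have ltp (x : 'F_p) : (x < p)%N by have := ltn_ord x; rewrite [X in (_ < X)%N -> _]Fp_cast.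
split; apply: uniq_leq_size.
- by rewrite filter_uniq // iota_uniq.
- move=> c; rewrite mem_filter mem_iota add0n => /andP[cd /andP[_ cp]].
  apply/mapP; exists (c%:R); first by rewrite rsP -dvdE.
  by rewrite val_Fp_nat // modn_small.
- by rewrite map_inj_uniq //; apply: val_inj.
- move=> _ /mapP[x xrs ->]; rewrite mem_filter mem_iota add0n ltp andbT dvdE modc.
  by rewrite -rsP xrs.
Qed.

Lemma size_zeta_homs (d : nat) : (forall p, prime p -> (p %| d)%N -> (p = 1 %[mod 8])%N) ->
  size (zeta_homs d) = (4 * size (primes d))%N.
Proof.
move=> dP; rewrite size_allpairs_dep.
have : forall p, p \in primes d -> size [seq c <- iota 0 p | (p %| c ^ 4 + 1)%N] = 4.
  by move=> p; rewrite mem_primes => /and3P[p_pr _ pd]; apply: size_fourth_roots => //; apply: dP.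
elim: (primes d) => [|p ps IHps] h //=.
rewrite h ?mem_head // IHps ?mulnS // => q qps; apply: h; by rewrite inE qps orbT.
Qed.

Lemma zeta_homs_uniq (d : nat) : uniq (zeta_homs d).
Proof.
apply: allpairs_uniq_dep; first exact: primes_uniq.
  by move=> p _; rewrite filter_uniq // iota_uniq.
by move=> [p c] [p' c'] _ _ /= [-> ->].
Qed.

Lemma zeta_homsP (d p c : nat) : (p, c) \in zeta_homs d ->
  [/\ prime p, (p %| d)%N, (c < p)%N & (p %| c ^ 4 + 1)%N].
Proof.
move=> /allpairsPdep[q [b [qd]]]; rewrite mem_filter mem_iota add0n => /andP[h /andP[_ bq]] [-> ->].
by move: qd; rewrite mem_primes => /and3P[].
Qed.

Lemma squarefree_dvdn (d n : nat) : (0 < d)%N -> squarefree d ->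
  (forall p, prime p -> (p %| d)%N -> (p %| n)%N) -> (d %| n)%N.
Proof.
move=> d0 sqd h; apply/dvdn_partP => // p; rewrite mem_primes => /and3P[p_pr _ pd].
rewrite p_part; suff : (logn p d <= 1)%N.
  by case: (logn p d) => [|[|k]] // _; rewrite ?expn0 ?dvd1n // expn1; apply: h.
rewrite leqNgt; apply/negP => l2.
have : (p ^ 2 %| d)%N by rewrite pfactor_dvdn.
by move/sqd => p1; move: p_pr; rewrite p1.
Qed.

Section Divisors.

Variables (L : fieldExtType rat) (d : nat) (T : octic L d).
Local Notation z := (zeta T).
Local Notation ZK := (ZK T).
Local Notation inK := (inK T).
Local Notation quartic := (zcomb z).

Lemma ZK0 : ZK 0. Proof. exact: (ZK_int T 0). Qed.

Lemma ZK1 : ZK 1. Proof. exact: (ZK_int T 1). Qed.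

Lemma ZK_nat (n : nat) : ZK n%:R. Proof. exact: (ZK_int T n). Qed.

Lemma ZKX x n : ZK x -> ZK (x ^+ n).
Proof. by move=> xZ; elim: n => [|n IHn]; [apply: ZK1 | rewrite exprS; apply: ZKM]. Qed.

Lemma ZKB x y : ZK x -> ZK y -> ZK (x - y).
Proof. by move=> xZ yZ; apply/ZKD/ZKN. Qed.

Lemma ZK_tau x : ZK x -> ZK (tau T x).
Proof.
move=> [n0 [n1 [n2 [n3 ->]]]]; exists n0, (- n3), (- n2), (- n1).
by rewrite quartic_tau !rmorphN.
Qed.

Lemma ZK_rho x : ZK x -> ZK (rho T x).
Proof.
move=> [n0 [n1 [n2 [n3 ->]]]]; exists n0, (- n1), n2, (- n3).
by rewrite quartic_rho !rmorphN.
Qed.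

Lemma ZK_NmK1_inv x : ZK x -> NmK T x = 1 -> ZK x^-1.
Proof.
move=> xZ xN; have x0 : x != 0.
  by apply/eqP => x0; move: xN; rewrite /NmK x0 !mul0r => /esym/eqP; rewrite oner_eq0.
have -> : x^-1 = rho T x * tau T (x * rho T x).
  by apply: (mulfI x0); rewrite divff // -xN /NmK mulrA.
by apply: ZKM; [apply: ZK_rho | apply/ZK_tau/ZKM => //; apply: ZK_rho].
Qed.

Lemma ZK_bezout a x : ZK a -> ZK x -> a != 0 -> exists g a' x' u v,
  [/\ [/\ ZK g, ZK a', ZK x', ZK u & ZK v], a = a' * g, x = x' * g & u * a' + v * x' = 1].
Proof.
move=> aZ xZ a0.
pose M : set L := [set y | exists u v, [/\ ZK u, ZK v & y = u * a + v * x]].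
have MZ y : M y -> ZK y by move=> [u [v [uZ vZ ->]]]; apply: ZKD; apply: ZKM.
have [||||||g [Mg g0 gP]] := @pid_ZK _ _ T M 1.
- by move=> y /MZ/ZK_inK.
- move=> _ _ [u [v [uZ vZ ->]]] [u' [v' [uZ' vZ' ->]]].
  by exists (u - u'), (v - v'); split; [apply: ZKB | apply: ZKB | ring].
- move=> b _ bZ [u [v [uZ vZ ->]]].
  by exists (b * u), (b * v); split; [apply: ZKM | apply: ZKM | ring].
- by [].
- by move=> y /MZ; rewrite mul1r.
- by exists a => //; exists 1, 0; split; [apply: ZK1 | apply: ZK0 | ring].
have [a' a'Z aE] : exists2 a', ZK a' & a = a' * g.
  by apply: gP; exists 1, 0; split; [apply: ZK1 | apply: ZK0 | ring].
have [x' x'Z xE] : exists2 x', ZK x' & x = x' * g.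
  by apply: gP; exists 0, 1; split; [apply: ZK0 | apply: ZK1 | ring].
have [u [v [uZ vZ gE]]] := Mg.
exists g, a', x', u, v; split=> //; first by split=> //; apply: MZ.
by apply: (mulIf g0); rewrite mul1r [RHS]gE aE xE; ring.
Qed.

Definition sqfreeK (a : L) : Prop :=
  [/\ ZK a, a != 0 & forall m, ZK m -> m != 0 -> ZK (a / m ^+ 2) -> ZK m^-1].

(** Write a = a' g and x = x' g with a' and x' coprime. Then a' divides x'^2 g, hence g; so a'^2
    divides a, and a' is a unit. *)
Lemma sqfreeK_dvd_sqr a x : sqfreeK a -> ZK x -> ZK (x ^+ 2 / a) -> ZK (x / a).
Proof.
move=> [aZ a0 asq] xZ x2.
have [g [a' [x' [u [v [[gZ a'Z x'Z uZ vZ] aE xE uv]]]]]] := ZK_bezout aZ xZ a0.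
have [a'0 g0] : a' != 0 /\ g != 0 by move: a0; rewrite aE mulf_eq0 negb_or => /andP.
have h : ZK (x' ^+ 2 * g / a').
  by have -> : x' ^+ 2 * g / a' = x ^+ 2 / a by rewrite aE xE; field; rewrite a'0 g0.
have ga : ZK (g / a').
  have -> : g / a' = g * (u ^+ 2 * a' + 2 * u * v * x') + v ^+ 2 * (x' ^+ 2 * g / a').
    have -> : g / a' = g * (u * a' + v * x') ^+ 2 / a' by rewrite uv; field.
    by field.
  apply: ZKD; last by apply: ZKM => //; apply: ZKX.
  apply: ZKM => //; apply: ZKD; first by apply: ZKM => //; apply: ZKX.
  by do 3 (apply: ZKM => //); apply: ZK_nat.
have a'V : ZK a'^-1.
  apply: asq => //; have -> : a / a' ^+ 2 = g / a' by rewrite aE; field.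
  by [].
have -> : x / a = x' / a' by rewrite aE xE; field; rewrite a'0 g0.
exact: ZKM.
Qed.

Lemma rat_common_denom (q : rat) : exists2 n : nat, (0 < n)%N & n%:R * q \is a Num.int.
Proof.
exists (absz (denq q)); first by rewrite absz_gt0 denq_neq0.
have -> : (absz (denq q))%:R = (denq q)%:~R :> rat by rewrite -{2}absz_denq.
by rewrite -{2}(divq_num_den q) mulrC divfK ?intr_eq0 ?denq_neq0 // intr_int.
Qed.

Lemma inK_denom x : inK x -> exists2 n : nat, (0 < n)%N & ZK (n%:R * x).
Proof.
move=> /fixed_quartic[a0 [a1 [a2 [a3 ->]]]].
have [n0 p0 /intrP[m0 e0]] := rat_common_denom a0; have [n1 p1 /intrP[m1 e1]] := rat_common_denom a1.
have [n2 p2 /intrP[m2 e2]] := rat_common_denom a2; have [n3 p3 /intrP[m3 e3]] := rat_common_denom a3.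
exists (n0 * n1 * n2 * n3)%N; first by rewrite !muln_gt0 p0 p1 p2.
exists ((n1 * n2 * n3)%N%:Z * m0), ((n0 * n2 * n3)%N%:Z * m1), ((n0 * n1 * n3)%N%:Z * m2), ((n0 * n1 * n2)%N%:Z * m3).
have -> : (n0 * n1 * n2 * n3)%N%:R = quartic (n0 * n1 * n2 * n3)%N%:R 0 0 0.
  by rewrite zcomb_rat -[in RHS]/((n0 * n1 * n2 * n3)%N%:Z%:~R) intr_alg.
rewrite quarticM !rmorphM /= -e0 -e1 -e2 -e3 /=.
have e (k : nat) : k%:Z%:~R = k%:R :> rat by [].
by congr zcomb; rewrite ?e; ring.
Qed.

(** Induction on the norm: if x is not squarefree, the square of a nonunit is divided out. *)
Lemma squarefree_part a : inK a -> a != 0 ->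
  exists c b, [/\ sqfreeK c, inK b, b != 0 & a = c * b ^+ 2].
Proof.
move=> aK a0; have [n n0 nZ] := inK_denom aK.
have nn0 : n%:R != 0 :> L by rewrite natrL_eq0 -lt0n.
have aZ : ZK (a * n%:R ^+ 2) by rewrite expr2 mulrA [a * _]mulrC; apply: ZKM => //; apply: ZK_nat.
suff main k x : ZK x -> x != 0 -> NmK T x = k%:R ->
    exists c b, [/\ sqfreeK c, inK b, b != 0 & x = c * b ^+ 2].
  have [k kE] := ZK_NmK aZ.
  have [|c [b [cS bK b0 e]]] := main k _ aZ _ kE; first by rewrite mulf_neq0 // expf_neq0.
  exists c, (b / n%:R); split=> //.
  - by apply: inKM => //; apply/inKV/ZK_inK/ZK_nat.
  - by rewrite mulf_neq0 ?invr_neq0.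
  - by rewrite expr_div_n mulrA -e mulfK // expf_neq0.
elim/ltn_ind: k x => k IHk x xZ x0 xN.
have [xs|] := pselect (sqfreeK x).
  by exists x, 1; split; [| apply: inK1 | apply: oner_neq0 | rewrite expr1n mulr1].
move=> /not_and3P[//|//|]/existsNP[m /not_implyP[mZ /not_implyP[m0 /not_implyP[xmZ mV]]]].
have [l lE] := ZK_NmK xmZ; have [j jE] := ZK_NmK mZ.
have xE : x = (x / m ^+ 2) * m ^+ 2 by rewrite divfK // expf_neq0.
have klj : k = (l * j ^ 2)%N.
  have : k%:R = (l * j ^ 2)%:R :> L.
    by rewrite -xN {1}xE NmKM lE natrM natrX -jE !expr2 NmKM.
  by move/eqP; rewrite -[k%:R]/(k%:Z%:~R) -[X in _ == X]/((l * j ^ 2)%N%:Z%:~R) => /eqP/intrL_inj[].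
have k0 : k != 0%N.
  by apply: contraNneq x0 => k0; apply/eqP/(@NmK_eq0 _ _ T); rewrite xN k0.
have j1 : j != 1%N by apply/eqP => j1; apply: mV; apply: ZK_NmK1_inv => //; rewrite jE j1.
have lk : (l < k)%N.
  rewrite klj in k0 *; move: k0; rewrite muln_eq0 negb_or => /andP[l0].
  rewrite expn_eq0 andbT => j0; rewrite -[X in (X < _)%N]muln1 ltn_pmul2l ?lt0n //.
  by case: j j0 j1 {jE klj} => [|[|j]] // _ _; rewrite -[1%N]/(1 ^ 2)%N ltn_exp2r.
have [|c [b [cS bK b0 e]]] := IHk l lk _ xmZ _ lE.
  by rewrite mulf_neq0 // invr_neq0 // expf_neq0.
exists c, (b * m); split=> //; [exact/inKM/ZK_inK | by rewrite mulf_neq0 |].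
by rewrite exprMn mulrA -e.
Qed.

(** Put b = m / k in lowest terms. From k^2 a = u m^2 a' it follows that m^2 divides a and k^2
    divides a', so m and k are units. This is what separates ambiguous ideals modulo ideals of K. *)
Lemma sqfreeK_ratio a a' b u : sqfreeK a -> sqfreeK a' -> inK b -> b != 0 ->
  ZK u -> ZK u^-1 -> a = u * b ^+ 2 * a' -> ZK b /\ ZK b^-1.
Proof.
move=> [aZ a0 asq] [a'Z a'0 a'sq] bK b0 uZ uV aE.
have u0 : u != 0 by apply: contraNneq a0 => u0; rewrite aE u0 !mul0r.
have [n n0 nZ] := inK_denom bK.
have nn0 : n%:R != 0 :> L by rewrite natrL_eq0 -lt0n.
have [g [m [k [x [y [[gZ mZ kZ xZ yZ] mE kE xy]]]]]] := ZK_bezout nZ (ZK_nat n) (mulf_neq0 nn0 b0).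
have g0 : g != 0 by apply: contraNneq nn0 => g0; rewrite kE g0 mulr0.
have k0 : k != 0 by apply: contraNneq nn0 => k0; rewrite kE k0 mul0r.
have bE : b = m / k.
  by apply: (mulfI nn0); rewrite mE kE; field.
have m0 : m != 0 by apply: contraNneq b0 => m0; rewrite bE m0 mul0r.
(* The cube of x m + y k = 1 lies in the ideal generated by m^2 and k^2. *)
have comax c : ZK (m ^+ 2 * c) -> ZK (k ^+ 2 * c) -> ZK c.
  move=> cm ck; rewrite -[c]mul1r -(expr1n _ 3) -xy.
  have -> : (x * m + y * k) ^+ 3 * c = (x ^+ 3 * m + 3 * x ^+ 2 * y * k) * (m ^+ 2 * c) +
     (y ^+ 3 * k + 3 * y ^+ 2 * x * m) * (k ^+ 2 * c) by ring.
  have h3 : ZK 3 by apply: ZK_nat.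
  by apply: ZKD; apply: ZKM => //; apply: ZKD; do ?[apply: ZKM | apply: ZKX | done].
have aE' : k ^+ 2 * a = u * m ^+ 2 * a' by rewrite aE bE; field.
have mV : ZK m^-1.
  apply: asq => //; apply: comax; first by rewrite mulrC divfK // expf_neq0.
  by rewrite mulrA aE'; have -> : u * m ^+ 2 * a' / m ^+ 2 = u * a' by [field]; apply: ZKM.
have kV : ZK k^-1.
  apply: a'sq => //; apply: comax; last by rewrite mulrC divfK // expf_neq0.
  have -> : m ^+ 2 * (a' / k ^+ 2) = u^-1 * a.
    by apply: (mulfI (expf_neq0 2 k0)); rewrite [RHS]mulrCA aE'; field; rewrite u0 k0.
  exact: ZKM.
by rewrite bE; split; [apply: ZKM | rewrite invf_div; apply: ZKM].
Qed.

End Divisors.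

Section Homs.

Variables (L : fieldExtType rat) (d : nat) (T : octic L d).
Local Notation z := (zeta T).
Local Notation ZK := (ZK T).
Local Notation inK := (inK T).
Local Notation quartic := (zcomb z).

(* x lies in the kernel of the ring morphism Z[zeta] -> F_p, zeta |-> c, with h = (p, c). *)
Definition kills (h : nat * nat) (x : L) : Prop := exists n0 n1 n2 n3 : int,
  x = quartic n0%:~R n1%:~R n2%:~R n3%:~R /\
  (h.1%:Z %| n0 + n1 * h.2%:Z + n2 * h.2%:Z ^+ 2 + n3 * h.2%:Z ^+ 3)%Z.

Lemma kills_ZK h x : kills h x -> ZK x.
Proof. by move=> [n0 [n1 [n2 [n3 [-> _]]]]]; exists n0, n1, n2, n3. Qed.

Lemma killsE h n0 n1 n2 n3 : kills h (quartic n0%:~R n1%:~R n2%:~R n3%:~R) ->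
  (h.1%:Z %| n0 + n1 * h.2%:Z + n2 * h.2%:Z ^+ 2 + n3 * h.2%:Z ^+ 3)%Z.
Proof.
move=> [m0 [m1 [m2 [m3 [/quartic_inj[e0 e1 e2 e3] h_dvd]]]]].
by move: h_dvd; rewrite (intr_inj e0) (intr_inj e1) (intr_inj e2) (intr_inj e3).
Qed.

Lemma killsB h x y : kills h x -> kills h y -> kills h (x - y).
Proof.
move=> [n0 [n1 [n2 [n3 [-> hx]]]]] [m0 [m1 [m2 [m3 [-> hy]]]]].
exists (n0 - m0), (n1 - m1), (n2 - m2), (n3 - m3); split.
  by rewrite quarticN quarticD !rmorphB.
by have := rpredB hx hy; congr (_ %| _)%Z; ring.
Qed.

Section OneHom.

Variable h : nat * nat.
Hypothesis hP : h \in zeta_homs d.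

Let p := h.1.
Let c := h.2%:Z.

Let p_pr : prime p.
Proof. by move: hP; rewrite /p; case: h => a b /zeta_homsP[]. Qed.

Let c4 : (p%:Z %| c ^+ 4 + 1)%Z.
Proof.
move: hP; rewrite /p /c; case: h => a b /zeta_homsP[_ _ _] /=.
by rewrite -[(b%:Z ^+ 4 + 1)%R]/((b%:Z ^+ 4 + 1%:Z)%R) -rmorphXn -PoszD dvdzE /= natrXE.
Qed.

Let eval_mul (n0 n1 n2 n3 m0 m1 m2 m3 : int) :
  (n0 + n1 * c + n2 * c ^+ 2 + n3 * c ^+ 3) * (m0 + m1 * c + m2 * c ^+ 2 + m3 * c ^+ 3) =
  (n0 * m0 - n1 * m3 - n2 * m2 - n3 * m1) + (n0 * m1 + n1 * m0 - n2 * m3 - n3 * m2) * c +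
  (n0 * m2 + n1 * m1 + n2 * m0 - n3 * m3) * c ^+ 2 +
  (n0 * m3 + n1 * m2 + n2 * m1 + n3 * m0) * c ^+ 3 +
  (c ^+ 4 + 1) * (n1 * m3 + n2 * m2 + n3 * m1 + (n2 * m3 + n3 * m2) * c + n3 * m3 * c ^+ 2).
Proof. by ring. Qed.

Lemma killsM x y : ZK x -> kills h y -> kills h (x * y).
Proof.
move=> [n0 [n1 [n2 [n3 ->]]]] [m0 [m1 [m2 [m3 [-> hy]]]]].
exists (n0 * m0 - n1 * m3 - n2 * m2 - n3 * m1), (n0 * m1 + n1 * m0 - n2 * m3 - n3 * m2),
  (n0 * m2 + n1 * m1 + n2 * m0 - n3 * m3), (n0 * m3 + n1 * m2 + n2 * m1 + n3 * m0).
split; first by rewrite quarticM !(rmorphB, rmorphD) !rmorphM.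
have := eval_mul n0 n1 n2 n3 m0 m1 m2 m3.
set A := _ * (m0 + _ + _ + _); set B := (X in _ = X + _); move=> e.
suff : (p%:Z %| A - (c ^+ 4 + 1) * (n1 * m3 + n2 * m2 + n3 * m1 + (n2 * m3 + n3 * m2) * c + n3 * m3 * c ^+ 2))%Z.
  by rewrite e addrK.
by apply: rpredB; [apply: dvdz_mull | apply: dvdz_mulr].
Qed.

Lemma kills_prime x y : ZK x -> ZK y -> kills h (x * y) -> kills h x \/ kills h y.
Proof.
move=> [n0 [n1 [n2 [n3 ->]]]] [m0 [m1 [m2 [m3 ->]]]].
rewrite quarticM -!(rmorphM, rmorphB, rmorphD) => /killsE hxy.
have := eval_mul n0 n1 n2 n3 m0 m1 m2 m3; set A := _ * _ => e.
have : (p%:Z %| A)%Z by rewrite e; apply: rpredD => //; apply: dvdz_mulr.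
rewrite /A dvdzE abszM Euclid_dvdM // -!dvdzE => /orP[hx|hy]; [left | right].
  by exists n0, n1, n2, n3.
by exists m0, m1, m2, m3.
Qed.

Lemma not_kills1 : ~ kills h 1.
Proof.
rewrite -[1]/(1%:~R) -intr_alg -(zcomb_rat T) => /(@killsE h 1 0 0 0).
by rewrite !mul0r !addr0 dvdzE /= dvdn1 => /eqP p1; move: p_pr; rewrite /p p1.
Qed.

Lemma kills_int (m : int) : kills h m%:~R <-> (p%:Z %| m)%Z.
Proof.
rewrite -intr_alg -(zcomb_rat T); split=> [/(@killsE h m 0 0 0)|pm].
  by rewrite !mul0r !addr0.
by exists m, 0, 0, 0; rewrite !mul0r !addr0.
Qed.

Lemma kills_zeta_sub (m : int) : kills h (z - m%:~R) <-> (p%:Z %| c - m)%Z.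
Proof.
have -> : z - m%:~R = quartic (- m)%:~R 1 0 0.
  rewrite {1}zeta_zcomb -intr_alg -(zcomb_rat T) quarticN quarticD.
  by rewrite !oppr0 !addr0 add0r rmorphN.
split=> [/(@killsE h (- m) 1 0 0)|pm].
  by rewrite !mul0r !addr0 mul1r addrC.
by exists (- m), 1, 0, 0; rewrite !mul0r !addr0 mul1r addrC.
Qed.

Lemma kills_d : kills h d%:R.
Proof.
rewrite -[d%:R]/(d%:Z%:~R); apply/kills_int; rewrite dvdzE /=.
by move: hP; rewrite /p; case: h => a b /zeta_homsP[].
Qed.

End OneHom.

(** Different characteristics are told apart by p, different roots of the same p by zeta - c. *)
Lemma kills_separate h h' : h \in zeta_homs d -> h' \in zeta_homs d -> h != h' ->
  exists x, kills h x /\ ~ kills h' x.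
Proof.
move=> hP hP' hh'; have [e|ne] := eqVneq h.1 h'.1.
  exists (z - h.2%:Z%:~R); split; first by apply/kills_zeta_sub; rewrite ?subrr ?dvdz0.
  move=> /kills_zeta_sub; rewrite -e => hd.
  case: h h' hP hP' hh' e hd => [p c] [p' c'] /zeta_homsP[_ _ cp _] /zeta_homsP[_ _ cp' _] /= hh' e.
  move=> hd; subst p'; case/negP: hh'; apply/eqP; congr (_, _).
  by move: hd; rewrite -eqz_mod_dvd !modz_nat eqz_nat !modn_small // => /eqP.
exists h.1%:Z%:~R; split; first by apply/kills_int.
move/kills_int; rewrite dvdzE /=.
case: h h' hP hP' ne {hh'} => [p c] [p' c'] /zeta_homsP[pp _ _ _] /zeta_homsP[pp' _ _ _] /= ne.
by rewrite dvdn_prime2 // eq_sym (negbTE ne).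
Qed.

(** Modulo p | d the coordinates of x are the coefficients of a polynomial of degree at most 3 with
    four roots, hence vanish. As d is squarefree, it divides them all. *)
Lemma kills_all_dvd x : ZK x -> (forall h, h \in zeta_homs d -> kills h x) -> ZK (x / d%:R).
Proof.
move=> [n0 [n1 [n2 [n3 ->]]]] hk.
have d0 : (0 < d)%N by apply: ltn_trans (octic_gt2 T).
have key p : prime p -> (p %| d)%N -> [/\ (p%:Z %| n0)%Z, (p%:Z %| n1)%Z, (p%:Z %| n2)%Z & (p%:Z %| n3)%Z].
  move=> p_pr pd; pose rs := [seq (c%:R : 'F_p) | c <- [seq c <- iota 0 p | (p %| c ^ 4 + 1)%N]].
  have rs4 : size rs = 4 by rewrite size_map size_fourth_roots // (octic_primes T).
  have urs : uniq rs.
    rewrite map_inj_in_uniq ?filter_uniq ?iota_uniq // => a b.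
    rewrite !mem_filter !mem_iota !add0n => /andP[_ /andP[_ ap]] /andP[_ /andP[_ bp]].
    by move/(congr1 (fun x : 'F_p => (x : nat))); rewrite !val_Fp_nat // !modn_small.
  pose q : {poly 'F_p} := Poly [:: n0%:~R; n1%:~R; n2%:~R; n3%:~R].
  have dvdF (m : int) : (p%:Z %| m)%Z = (m%:~R == 0 :> 'F_p).
    case: m => k; first by rewrite dvdzE /= (dvdn_pcharf (pchar_Fp p_pr)).
    by rewrite dvdzE NegzE abszN rmorphN oppr_eq0 /= (dvdn_pcharf (pchar_Fp p_pr)).
  have q0 : q = 0.
    apply: (@roots_geq_poly_eq0 _ _ rs) => //; last first.
      by rewrite rs4; apply: size_Poly.
    apply/allP => _ /mapP[c cF ->].
    have ph : (p, c) \in zeta_homs d.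
      apply/allpairsPdep; exists p, c; split=> //.
      by rewrite mem_primes p_pr pd d0.
    have /killsE /= := hk _ ph; rewrite dvdF !rmorphD !(rmorphM, rmorphXn) /=.
    rewrite /root /q horner_Poly /= => /eqP e; apply/eqP; rewrite -[RHS]e.
    by rewrite -[c%:Z%:~R]/(c%:R); ring.
  have cq i : (nth 0 [:: n0%:~R; n1%:~R; n2%:~R; n3%:~R : 'F_p] i) = 0.
    by rewrite -coef_Poly -/q q0 coef0.
  by rewrite !dvdF; split; apply/eqP; [exact: (cq 0%N) | exact: (cq 1%N) | exact: (cq 2%N) | exact: (cq 3%N)].
have dv (m : int) : (forall p, prime p -> (p %| d)%N -> (p%:Z %| m)%Z) -> exists k, m = k * d%:Z.
  move=> h; apply/dvdzP; rewrite dvdzE /=; apply: squarefree_dvdn => //; first exact: octic_sqfree T.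
have [|k0 e0] := dv n0; first by move=> p p_pr /(key p p_pr)[].
have [|k1 e1] := dv n1; first by move=> p p_pr /(key p p_pr)[].
have [|k2 e2] := dv n2; first by move=> p p_pr /(key p p_pr)[].
have [|k3 e3] := dv n3; first by move=> p p_pr /(key p p_pr)[].
have dn0 : d%:R != 0 :> L by rewrite natrL_eq0 -lt0n.
exists k0, k1, k2, k3; apply: (mulIf dn0); rewrite divfK //.
have -> : d%:R = quartic d%:R 0 0 0 by rewrite (zcomb_rat T) -[in RHS]/(d%:Z%:~R) intr_alg.
by rewrite quarticM e0 e1 e2 e3 !rmorphM /=; congr zcomb; rewrite -[d%:Z%:~R]/(d%:R); ring.
Qed.

Definition dvd_d (a : L) : Prop := [/\ ZK a, a != 0 & ZK (d%:R / a)].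

Let dn0 : d%:R != 0 :> L.
Proof. by rewrite natrL_eq0; have := octic_gt2 T; case: d. Qed.

(** Each morphism kills d, hence a or d / a; in either case it kills a' (d / a), which is therefore
    divisible by d. *)
Lemma dvd_d_le a a' : dvd_d a -> dvd_d a' ->
  (forall h, h \in zeta_homs d -> kills h a -> kills h a') -> ZK (a' / a).
Proof.
move=> [aZ a0 da] [a'Z a'0 da'] haa'.
have -> : a' / a = (a' * (d%:R / a)) / d%:R by field; rewrite a0 dn0.
apply: kills_all_dvd => [|h hh]; first exact: ZKM.
have : kills h (a * (d%:R / a)) by rewrite mulrC divfK //; apply: kills_d.
case/(kills_prime hh aZ da) => [/(haa' _ hh)|]; last exact: killsM.
by rewrite mulrC; apply: killsM.
Qed.

Lemma dvd_d_eq a a' : dvd_d a -> dvd_d a' ->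
  (forall h, h \in zeta_homs d -> kills h a <-> kills h a') -> ZK (a' / a) /\ ZK (a / a').
Proof.
by move=> ad ad' haa'; split; apply: dvd_d_le => // h hh ka; apply/(haa' h hh).
Qed.

(** d stays squarefree in Z[zeta]: each morphism kills m m (d / m^2) = d, hence already m (d / m^2),
    and so d divides the latter. *)
Lemma d_sqfree_factor m : ZK m -> m != 0 -> ZK (d%:R / m ^+ 2) -> ZK m^-1.
Proof.
move=> mZ m0 dm.
have -> : m^-1 = (m * (d%:R / m ^+ 2)) / d%:R by field; rewrite m0 dn0.
apply: kills_all_dvd => [|h hh]; first exact: ZKM.
have : kills h (m * (m * (d%:R / m ^+ 2))).
  have -> : m * (m * (d%:R / m ^+ 2)) = d%:R by field.
  exact: kills_d.
case/(kills_prime hh mZ (ZKM mZ dm)) => //.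
by rewrite mulrC; apply: killsM.
Qed.

Lemma dvd_d_sqfree a : dvd_d a -> sqfreeK T a.
Proof.
move=> [aZ a0 da]; split=> // m mZ m0 am; apply: d_sqfree_factor => //.
have -> : d%:R / m ^+ 2 = (d%:R / a) * (a / m ^+ 2) by field; rewrite m0 a0.
exact: ZKM.
Qed.

(** The square of a common factor of a and d / a divides d, so such a factor is a unit. *)
Lemma dvd_d_coprime a : dvd_d a -> exists u v, [/\ ZK u, ZK v & u * a + v * (d%:R / a) = 1].
Proof.
move=> [aZ a0 da].
have [g [a' [b' [u [v [[gZ a'Z b'Z uZ vZ] aE bE uv]]]]]] := ZK_bezout aZ da a0.
have g0 : g != 0 by apply: contraNneq a0 => g0; rewrite aE g0 mulr0.
have gV : ZK g^-1.
  apply: d_sqfree_factor => //.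
  have -> : d%:R / g ^+ 2 = (a / g) * (d%:R / a / g) by field; rewrite g0 a0.
  by rewrite bE {1}aE !mulfK //; apply: ZKM.
exists (u * g^-1), (v * g^-1); split; try exact: ZKM.
by rewrite bE -[RHS]uv {1}aE; field.
Qed.

(** The divisor generates the ideal of all elements killed by the morphisms in S. It divides d
    because d lies in this ideal; a morphism h outside S does not kill it, as a product of elements
    separating h from those in S shows. *)
Lemma dvd_d_exists (S : pred (nat * nat)) : exists a, dvd_d a /\
  forall h, h \in zeta_homs d -> kills h a <-> S h.
Proof.
pose M : set L := [set x | ZK x /\ forall h, h \in zeta_homs d -> S h -> kills h x].
have Md : M d%:R by split=> [|h hh _]; [apply: ZK_nat | apply: kills_d].
have [||||||g [[gZ gS] g0 gP]] := @pid_ZK _ _ T M 1.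
- by move=> y [/ZK_inK].
- move=> x y [xZ xS] [yZ yS]; split; first exact: ZKB.
  by move=> h hh Sh; apply: killsB; [apply: xS | apply: yS].
- move=> a x aZ [xZ xS]; split; first exact: ZKM.
  by move=> h hh Sh; apply: killsM => //; apply: xS.
- by [].
- by move=> y [yZ _]; rewrite mul1r.
- by exists d%:R.
exists g; split.
  split=> //; have [a aZ ->] := gP _ Md; by rewrite mulfK.
move=> h hh; split=> [hg|Sh]; last exact: gS.
apply: contrapT => nS.
suff [x [[xZ xS] nx]] : exists x, M x /\ ~ kills h x.
  have [a aZ xE] := gP x (conj xZ xS); apply: nx; rewrite xE; exact: killsM.
have main (l : seq (nat * nat)) : {subset l <= zeta_homs d} -> exists x, [/\ ZK x, ~ kills h x &
    forall h', h' \in l -> S h' -> kills h' x].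
  elim: l => [|h' l IHl] hl; first by exists 1; split; [apply: ZK1 | apply: not_kills1 |].
  have [h'' ?|x [xZ nx xS]] := IHl; first by apply: hl; rewrite inE orbC; apply/orP; left.
  have h'd : h' \in zeta_homs d by apply: hl; rewrite mem_head.
  have [Sh'|nS'] := boolP (S h'); last first.
    by exists x; split=> // h''; rewrite inE => /predU1P[->|//]; [rewrite (negbTE nS') | apply: xS].
  have hh' : h' != h by apply: contra_notN nS => /eqP <-.
  have [y [ky nky]] := kills_separate h'd hh hh'.
  have yZ := kills_ZK ky.
  exists (x * y); split; first exact: ZKM.
    by case/(kills_prime hh xZ yZ).
  move=> h''; rewrite inE => /predU1P[-> _|h''l Sh'']; first exact: killsM.
  by rewrite mulrC; apply: killsM; [apply: hl; rewrite inE h''l orbT | | apply: xS].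
have [//|x [xZ nx xS]] := main (zeta_homs d).
by exists x.
Qed.

End Homs.

(** * The multiplicative group of a field, written additively *)

Record nonzero (F : fieldType) := Nonzero { nzval :> F; nz_neq0 : nzval != 0 }.

HB.instance Definition _ (F : fieldType) := [isSub for @nzval F].
HB.instance Definition _ (F : fieldType) := [Choice of nonzero F by <:].

Section NonzeroGroup.

Variable F : fieldType.
Implicit Types x y : nonzero F.

Definition nz_one := @Nonzero F 1 (oner_neq0 F).
Definition nz_mul x y := Nonzero (mulf_neq0 (nz_neq0 x) (nz_neq0 y)).
Fact nz_inv_neq0 x : (nzval x)^-1 != 0.
Proof. by rewrite invr_eq0 nz_neq0. Qed.
Definition nz_inv x := Nonzero (nz_inv_neq0 x).

Fact nz_mulA : associative nz_mul.
Proof. by move=> x y u; apply: val_inj; apply: mulrA. Qed.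
Fact nz_mulC : commutative nz_mul.
Proof. by move=> x y; apply: val_inj; apply: mulrC. Qed.
Fact nz_mul1 : left_id nz_one nz_mul.
Proof. by move=> x; apply: val_inj; apply: mul1r. Qed.
Fact nz_mulV : left_inverse nz_one nz_inv nz_mul.
Proof. by move=> x; apply: val_inj; apply/mulVf/nz_neq0. Qed.

HB.instance Definition _ := GRing.isZmodule.Build (nonzero F) nz_mulA nz_mulC nz_mul1 nz_mulV.

Lemma nz_val0 : nzval (0 : nonzero F) = 1. Proof. by []. Qed.
Lemma nz_valD x y : nzval (x + y) = nzval x * nzval y. Proof. by []. Qed.
Lemma nz_valN x : nzval (- x) = (nzval x)^-1. Proof. by []. Qed.
Lemma nz_valB x y : nzval (x - y) = nzval x / nzval y. Proof. by []. Qed.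
Lemma nz_valMn x n : nzval (x *+ n) = nzval x ^+ n.
Proof. by elim: n => [|n IHn] //; rewrite mulrS exprS nz_valD IHn. Qed.
Lemma nz_inj x y : nzval x = nzval y -> x = y. Proof. exact: val_inj. Qed.

End NonzeroGroup.

(** * Fractional ideals of L and their conjugates *)

Section Ideals.

Variables (L : fieldExtType rat) (d : nat) (T : octic L d).
Local Notation z := (zeta T).
Local Notation w := (sd T).
Local Notation s := (sg T).
Local Notation ZK := (ZK T).
Local Notation inK := (inK T).
Local Notation O := (@is_integral L).
Local Notation Lx := (nonzero L).

Lemma OKP x : inK x -> O x -> ZK x.
Proof. by move=> xK xO; apply/OKZ. Qed.

Lemma sd_integral : O w.
Proof. by apply: integral_sqrt; rewrite sd2 -[d%:R]/(d%:Z%:~R); apply: int_integral. Qed.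

Lemma d_mod8 : (d = 1 %[mod 8])%N.
Proof.
have d0 : (0 < d)%N by apply: ltn_trans (octic_gt2 T).
have := octic_primes T; elim/ltn_ind: d d0 => n IHn n0 np.
have [n1|n1] := leqP n 1; first by have -> : n = 1%N by apply/eqP; rewrite eqn_leq n1 n0.
have pr := pdiv_prime n1; have pn := pdiv_dvd n.
have IH : (n %/ pdiv n = 1 %[mod 8])%N.
  apply: IHn; first by rewrite ltn_Pdiv // prime_gt1.
    by rewrite divn_gt0 ?prime_gt0 // dvdn_leq.
  by move=> p p_pr pd; apply: np => //; rewrite -(divnK pn) dvdn_mulr.
by rewrite -(divnK pn) -modnMm IH (np _ pr pn).
Qed.

(** Integral because d = 1 mod 4. Traces against this element avoid the denominator 2 in
    [ambiguous_square], which is how the unramifiedness of 2 enters. *)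
Definition omega : L := (1 + w) / 2.

Lemma omega_integral : O omega.
Proof.
have [k kE] : exists k : nat, d = (4 * k + 1)%N.
  exists (d %/ 4)%N; rewrite {1}(divn_eq d 4) mulnC; congr (_ + _)%N.
  by have := d_mod8; lia.
apply: (@integral_root_monic _ _ intr omega ('X^2 - 'X - (k%:R)%:P)).
- rewrite monicE.
  have -> : 'X^2 - 'X - (k%:R)%:P = 'X^2 - ('X + (k%:R)%:P) :> {poly L} by ring.
  rewrite lead_coefDl ?lead_coefXn // size_polyN size_polyXn.
  by rewrite (leq_ltn_trans (size_polyD _ _)) // size_polyX gtn_max /= size_polyC; case: eqP.
- rewrite /root !hornerE /omega; apply/eqP.
  have -> : ((1 + w) / 2) ^+ 2 - (1 + w) / 2 - k%:R = (w ^+ 2 - (4 * k + 1)%:R) / 4.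
    by rewrite natrD natrM; field; rewrite !natrL_eq0.
  by rewrite sd2 -kE subrr mul0r.
- apply/integral_poly => i; rewrite !coefB coefXn coefX coefC.
  do !apply: integral_sub; try exact: integral_nat.
  by case: eqP => _; [apply: integral_nat | apply: integral0].
Qed.

Lemma integral_sg x : O x -> O (s x). Proof. exact: integral_fmorph. Qed.

Lemma submodule_image_sg (J : set L) : is_submodule J -> is_submodule [set s x | x in J].
Proof.
move=> sJ; split.
- by exists 0; [apply: submodule0 | rewrite rmorph0].
- by move=> _ _ [x Jx <-] [y Jy <-]; exists (x + y); [apply: submoduleD | rewrite rmorphD].
- move=> a _ aO [x Jx <-]; exists (s a * x); last by rewrite rmorphM /= sgK.
  by apply: submoduleM => //; apply: integral_sg.
Qed.

Lemma fractional_image_sg (J : set L) : is_fractional J -> is_fractional [set s x | x in J].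
Proof.
move=> [sJ [c [c0 cO cJ]]]; split; first exact: submodule_image_sg.
exists (s c); split; [by rewrite fmorph_eq0 | exact: integral_sg |].
by move=> _ [x Jx <-]; rewrite -rmorphM; apply/integral_sg/cJ.
Qed.

Lemma submodule_scale (J : set L) b : is_submodule J -> is_submodule [set b * x | x in J].
Proof.
move=> sJ; split.
- by exists 0; [apply: submodule0 | rewrite mulr0].
- by move=> _ _ [x Jx <-] [y Jy <-]; exists (x + y); [apply: submoduleD | rewrite mulrDr].
- by move=> a _ aO [x Jx <-]; exists (a * x); [apply: submoduleM | rewrite mulrCA].
Qed.

Lemma integral_denom (b : L) : exists2 n : nat, (0 < n)%N & O (n%:R * b).
Proof.
have bE : b = (b + s b) / 2 + ((b - s b) / w) / 2 * w.
  by field; rewrite sd_neq0 two_neq0.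
have K2 : inK 2 by apply: (inK_int T 2).
have [|n n0 nZ] := @inK_denom _ _ T ((b + s b) / 2).
  by apply: inKM; [apply: inK_trace | apply: inKV].
have [|m m0 mZ] := @inK_denom _ _ T ((b - s b) / w / 2).
  apply: inKM; last exact: inKV.
  by rewrite /inK fmorph_div rmorphB /= sgK sg_sd invrN mulrN -mulNr opprB.
exists (n * m)%N; first by rewrite muln_gt0 n0.
move: nZ mZ bE; set A := _ / 2; set B := _ / 2 => nZ mZ bE.
have -> : (n * m)%:R * b = m%:R * (n%:R * A) + n%:R * (m%:R * B) * w.
  by rewrite {1}bE natrM; ring.
apply: integral_add; first by apply: integral_mul; [apply: integral_nat | apply: ZK_integral nZ].
apply: integral_mul; last exact: sd_integral.
by apply: integral_mul; [apply: integral_nat | apply: ZK_integral mZ].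
Qed.

Lemma fractional_scale (J : set L) b : b != 0 -> is_fractional J -> is_fractional [set b * x | x in J].
Proof.
move=> b0 [sJ [c [c0 cO cJ]]]; split; first exact: submodule_scale.
have [n n0 nb] := integral_denom b.
exists (n%:R * c); split.
- by rewrite mulf_neq0 // natrL_eq0 -lt0n.
- by apply: integral_mul => //; apply: integral_nat.
move=> _ [x Jx <-].
have -> : n%:R * c * (b * x) = (n%:R * b) * (c * x) by ring.
by apply: integral_mul => //; apply: cJ.
Qed.

(* J times its conjugate is generated by any generator g of the Z[zeta]-module
   spanned by the norms N x, x in J: for x, y in J the element x * s y / g is a
   root of X^2 - (N (x + y) - N x - N y) / g * X + N x * N y / g^2. *)
Lemma ideal_norm (J : set L) : is_fractional J -> (exists2 x, J x & x != 0) ->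
  exists g, [/\ inK g, g != 0 & ideal_mul J [set s x | x in J] = [set g * y | y in O]].
Proof.
move=> [sJ [c [c0 cO cJ]]] [x0 Jx0 x0n0].
pose M : set L := [set y | exists l : seq (L * L),
   (forall u, u \in l -> ZK u.1 /\ J u.2) /\ y = \sum_(u <- l) u.1 * (u.2 * s u.2)].
have Mnorm x : J x -> M (x * s x).
  move=> Jx; exists [:: (1, x)]; rewrite big_seq1 mul1r; split=> // u; rewrite inE => /eqP-> /=.
  by split=> //; apply: ZK1.
have MD x y : M x -> M y -> M (x + y).
  move=> [l [lP ->]] [m [mP ->]]; exists (l ++ m); rewrite big_cat; split=> // u.
  by rewrite mem_cat => /orP[]; [apply: lP | apply: mP].
have MM a x : ZK a -> M x -> M (a * x).
  move=> aZ [l [lP ->]]; exists [seq (a * u.1, u.2) | u <- l]; split.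
    by move=> _ /mapP[u /lP[uZ uJ] ->]; split=> //; apply: ZKM.
  by rewrite big_map mulr_sumr; apply: eq_bigr => u _; rewrite mulrA.
have MB x y : M x -> M y -> M (x - y).
  by move=> Mx My; apply: MD => //; rewrite -mulN1r; apply: MM => //; apply/ZKN/ZK1.
have sc0 : s c != 0 by rewrite fmorph_eq0.
(* The norm of c is a denominator for all norms from J; its own norm k to Q is a natural multiple of
   it. *)
have eK : ZK (c * s c).
  by apply: OKP; [apply: inK_norm | apply: integral_mul => //; apply: integral_sg].
have [k kE] := ZK_NmK eK.
have k0 : (0 < k)%N.
  rewrite lt0n; apply/eqP => k0; move: kE; rewrite k0 => /NmK_eq0/eqP.
  by rewrite mulf_eq0 (negbTE c0) (negbTE sc0).
have [e' e'Z ke] : exists2 e', ZK e' & k%:R = e' * (c * s c).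
  exists (rho T (c * s c) * tau T (c * s c * rho T (c * s c))); last by rewrite -kE /NmK; ring.
  by apply: ZKM; [apply: ZK_rho | apply/ZK_tau/ZKM => //; apply: ZK_rho].
have kM x : M x -> ZK (k%:R * x).
  move=> [l [lP ->]]; rewrite mulr_sumr; elim: l lP => [|u l IHl] lP.
    by rewrite big_nil; apply: ZK0.
  rewrite big_cons; apply: ZKD; last by apply: IHl => v vl; apply: lP; rewrite inE vl orbT.
  have [uZ uJ] := lP u (mem_head _ _).
  have -> : k%:R * (u.1 * (u.2 * s u.2)) = e' * u.1 * ((c * u.2) * s (c * u.2)).
    by rewrite ke rmorphM /=; ring.
  apply: ZKM; first exact: ZKM.
  apply: OKP; first exact: inK_norm.
  by apply: integral_mul; [|apply: integral_sg]; apply: cJ.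
have [||||||g [Mg g0 gP]] := @pid_ZK _ _ T M k => //.
- move=> _ [l [lP ->]]; elim: l lP => [|u l IHl] lP.
    by rewrite big_nil; apply: inK0.
  rewrite big_cons; apply: inKD; last by apply: IHl => v vl; apply: lP; rewrite inE vl orbT.
  have [uZ _] := lP u (mem_head _ _).
  by apply: inKM; [apply: ZK_inK | apply: inK_norm].
- by exists (x0 * s x0); [apply: Mnorm | rewrite mulf_neq0 // fmorph_eq0].
have gK : inK g.
  have := kM _ Mg => /ZK_inK h.
  have kn0 : k%:R != 0 :> L by rewrite natrL_eq0 -lt0n.
  rewrite -[g](mulKf kn0); apply: inKM => //; apply: inKV; exact: (inK_int T k).
have gZ x : M x -> ZK (x / g) by move=> /gP[a aZ ->]; rewrite mulfK.
exists g; split=> //; apply/seteqP; split.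
  apply: ideal_mul_incl; first exact: submodule_scale (ring_of_integers_submodule L).
  move=> x _ Jx [y Jy <-]; exists (x * s y / g); last by rewrite mulrC divfK.
  pose tr := (x + y) * s (x + y) - x * s x - y * s y.
  have trZ : ZK (tr / g) by exact: (gZ _ (MB _ _ (MB _ _ (Mnorm _ (submoduleD sJ Jx Jy)) (Mnorm _ Jx)) (Mnorm _ Jy))).
  have nZ : ZK ((x * s x / g) * (y * s y / g)) by apply: ZKM; apply/gZ/Mnorm.
  apply: (@integral_root_monic _ _ intr _ ('X^2 - (tr / g) *: 'X + ((x * s x / g) * (y * s y / g))%:P)).
  - rewrite monicE -addrA lead_coefDl ?lead_coefXn // size_polyXn.
    apply: leq_ltn_trans (size_polyD _ _) _; rewrite gtn_max size_polyC size_polyN.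
    rewrite (leq_ltn_trans (size_scale_leq _ _)) ?size_polyX //=; by case: eqP.
  - rewrite /root !hornerE; apply/eqP; rewrite /tr rmorphD /=; field; exact: g0.
  - apply/integral_poly => i; rewrite !coefE.
    apply: integral_add; last by case: eqP => _; [apply: ZK_integral nZ | apply: integral0].
    apply: integral_sub; first exact: integral_nat.
    by apply: integral_mul; [apply: ZK_integral trZ | apply: integral_nat].
move=> _ [y yO <-].
have sub := ideal_mul_submodule [set s x | x in J] sJ.
rewrite mulrC; apply: submoduleM => //.
have [l [lP ->]] := Mg; elim: l lP => [|u l IHl] lP.
  by rewrite big_nil; apply: submodule0.
rewrite big_cons; apply: submoduleD => //; last by apply: IHl => v vl; apply: lP; rewrite inE vl orbT.
have [uZ uJ] := lP u (mem_head _ _).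
apply: submoduleM => //; first exact: ZK_integral uZ.
by apply: ideal_mul_mem => //; exists u.2.
Qed.

End Ideals.

(** * The group of ideals, principal ideals and ambiguous ideals *)

Section FracIdeals.

Variables (L : fieldExtType rat) (d : nat) (T : octic L d).
Local Notation z := (zeta T).
Local Notation w := (sd T).
Local Notation s := (sg T).
Local Notation ZK := (ZK T).
Local Notation inK := (inK T).
Local Notation O := (@is_integral L).
Local Notation Lx := (nonzero L).
Local Notation ideals := (frac_ideal L).

Lemma ideal_setD (I J : ideals) : ideal_set (I + J) = ideal_mul (ideal_set I) (ideal_set J).
Proof. by []. Qed.

Lemma ideal_set0 : ideal_set (0 : ideals) = O. Proof. by []. Qed.

Lemma frac_ideal_neq0 (I : ideals) : exists2 x, ideal_set I x & x != 0.
Proof.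
apply: contrapT => nI.
have : @ring_of_integers L 1 by apply: integral1.
rewrite -(ideal_mulV I) => -[l [lP e1]].
have : (1 : L) = 0.
  rewrite e1 big1_seq // => u /andP[_ /lP[uI _]].
  suff -> : u.1 = 0 by rewrite mul0r.
  by apply/eqP/negPn/negP => u0; apply: nI; exists u.1.
by move/eqP; rewrite oner_eq0.
Qed.

Lemma scale_mul (J J' : set L) b : ideal_mul J [set b * y | y in J'] = [set b * y | y in ideal_mul J J'].
Proof.
apply/seteqP; split.
  move=> _ [l [lP ->]]; elim: l lP => [|u l IHl] lP.
    by exists 0; rewrite ?mulr0 ?big_nil //; exists [::]; split=> //; rewrite big_nil.
  have [|y [m [mP ->]] e] := IHl; first by move=> v vl; apply: lP; rewrite inE vl orbT.
  have [uJ [v vJ ev]] := lP u (mem_head _ _).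
  exists (u.1 * v + \sum_(u <- m) u.1 * u.2).
    exists ((u.1, v) :: m); split; last by rewrite big_cons.
    by move=> v'; rewrite inE => /predU1P[->|/mP].
  by rewrite big_cons -e -ev; ring.
move=> _ [_ [l [lP ->]] <-]; exists [seq (u.1, b * u.2) | u <- l]; split.
  by move=> _ /mapP[u /lP[uJ uJ'] ->]; split=> //; exists u.2.
by rewrite mulr_sumr big_map; apply: eq_bigr => u _ /=; ring.
Qed.

(** If J s(J) = (g), the inverse of J is s(J) / g; so every nonzero fractional ideal is
    invertible. *)
Lemma frac_ideal_exists (J : set L) : is_fractional J -> (exists2 x, J x & x != 0) ->
  exists I : ideals, ideal_set I = J.
Proof.
move=> fJ nJ; have [g [_ g0 gJ]] := ideal_norm T fJ nJ.
have fJ' : is_fractional [set g^-1 * y | y in [set s x | x in J]].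
  by apply: (fractional_scale T); [rewrite invr_eq0 | apply: fractional_image_sg].
have JJ' : ideal_mul J [set g^-1 * y | y in [set s x | x in J]] = @ring_of_integers L.
  rewrite scale_mul gJ; apply/seteqP; split.
    by move=> _ [_ [y yO <-] <-]; rewrite mulKf.
  by move=> y yO; exists (g * y); [exists y | rewrite mulKf].
by exists (FracIdeal fJ fJ' JJ').
Qed.

Definition prin_set (x : Lx) : set L := [set nzval x * y | y in O].

Lemma prin_set_fractional x : is_fractional (prin_set x).
Proof.
by apply: (fractional_scale T); [apply: nz_neq0 | apply: ring_of_integers_fractional].
Qed.

Lemma prin_set_mul (x y : Lx) : ideal_mul (prin_set x) (prin_set y) = prin_set (x + y).
Proof.
rewrite /prin_set scale_mul ideal_mulC scale_mul ideal_mul1; last exact: ring_of_integers_submodule.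
apply/seteqP; split.
  by move=> _ [_ [u uO <-] <-]; exists u => //; rewrite nz_valD; ring.
by move=> _ [u uO <-]; exists (nzval x * u); [exists u | rewrite nz_valD; ring].
Qed.

Lemma prin_set0 : prin_set 0 = @ring_of_integers L.
Proof.
apply/seteqP; split=> y; first by move=> [u uO <-]; rewrite mul1r.
by move=> yO; exists y => //; rewrite mul1r.
Qed.

Lemma prin_set_mulV x : ideal_mul (prin_set x) (prin_set (- x)) = @ring_of_integers L.
Proof. by rewrite prin_set_mul subrr prin_set0. Qed.

Definition prin (x : Lx) : ideals :=
  FracIdeal (prin_set_fractional x) (prin_set_fractional (- x)) (prin_set_mulV x).

Lemma prinD x y : prin (x + y) = prin x + prin y.
Proof. by apply: frac_ideal_eq; rewrite /= prin_set_mul. Qed.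

Lemma prin0 : prin 0 = 0. Proof. by apply: frac_ideal_eq; apply: prin_set0. Qed.

Lemma prinN x : prin (- x) = - prin x. Proof. exact: frac_ideal_eq. Qed.

Lemma prinB x y : prin (x - y) = prin x - prin y.
Proof. by rewrite prinD prinN. Qed.

Lemma principalP (I : ideals) : I \in principal (L := L) <-> exists x, I = prin x.
Proof.
split=> [/asboolP[a a0 eI]|[x ->]].
  by exists (Nonzero a0); apply: frac_ideal_eq.
by apply/asboolP; exists (nzval x); first exact: nz_neq0.
Qed.

Definition is_unit (x : Lx) : Prop := O (nzval x) /\ O (nzval x)^-1.

Lemma prin_eq0 x : prin x = 0 <-> is_unit x.
Proof.
split=> [e|[xO xV]].
  have xO : ideal_set (prin x) (nzval x) by exists 1; [apply: integral1 | rewrite mulr1].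
  have : ideal_set (prin x) 1 by rewrite e; apply: integral1.
  rewrite e in xO => -[y yO xy]; split=> //.
  by have -> : (nzval x)^-1 = y by rewrite -[LHS]mulr1 -xy mulKf // nz_neq0.
apply: frac_ideal_eq; apply/seteqP; split=> [_ [y yO <-]|y yO] /=.
  exact: integral_mul.
exists ((nzval x)^-1 * y); first exact: integral_mul.
by rewrite mulVKf // nz_neq0.
Qed.

(** Ideals have no 2-torsion: if I^2 = O, elements of I have integral squares, so I is contained in
    O, and O = I I is contained in I. *)
Lemma frac_ideal_double_eq0 (I : ideals) : I + I = 0 -> I = 0.
Proof.
have sub (J : ideals) : J + J = 0 -> ideal_set J `<=` O.
  move=> JJ x Jx; apply: integral_sqrt; rewrite expr2 -ideal_set0 -JJ.
  exact: ideal_mul_mem.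
move=> II; have IN : - I = I by apply/eqP; rewrite eq_sym -addr_eq0 II.
apply: frac_ideal_eq; apply/seteqP; split; first exact: sub.
move=> y yO; have [sI _] := ideal_setP I.
have : ideal_set (I + I) y by rewrite II.
move=> [l [lP ->]]; elim: l lP => [|u l IHl] lP.
  by rewrite big_nil; apply: submodule0.
rewrite big_cons; apply: submoduleD => //; last by apply: IHl => v vl; apply: lP; rewrite inE vl orbT.
have [uI uI'] := lP u (mem_head _ _).
by apply: submoduleM => //; apply: sub uI.
Qed.

Fact sgI_proof (I : ideals) :
  ideal_mul [set s x | x in ideal_set I] [set s x | x in ideal_inv I] = @ring_of_integers L.
Proof.
apply/seteqP; split.
  apply: ideal_mul_incl; first exact: ring_of_integers_submodule.
  move=> _ _ [x Ix <-] [y Iy <-]; rewrite -rmorphM; apply: integral_sg.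
  by have : @ring_of_integers L (x * y) by rewrite -(ideal_mulV I); apply: ideal_mul_mem.
move=> y yO; have : @ring_of_integers L (s y) by apply: integral_sg.
rewrite -(ideal_mulV I) => -[l [lP e]].
exists [seq (s u.1, s u.2) | u <- l]; split.
  by move=> _ /mapP[u /lP[uI uI'] ->]; split; [exists u.1 | exists u.2].
rewrite -[LHS](sgK T) e rmorph_sum big_map; apply: eq_bigr => u _.
by rewrite rmorphM.
Qed.

Definition sgI (I : ideals) : ideals :=
  FracIdeal (fractional_image_sg T (ideal_setP I)) (fractional_image_sg T (ideal_invP I)) (sgI_proof I).

Lemma sgID I J : sgI (I + J) = sgI I + sgI J.
Proof.
apply: frac_ideal_eq; apply/seteqP; split.
  move=> _ [_ [l [lP ->]] <-]; exists [seq (s u.1, s u.2) | u <- l]; split.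
    by move=> _ /mapP[u /lP[uI uI'] ->]; split; [exists u.1 | exists u.2].
  by rewrite rmorph_sum big_map; apply: eq_bigr => u _; rewrite rmorphM.
apply: ideal_mul_incl; first by apply/submodule_image_sg/ideal_mul_submodule; case: (ideal_setP I).
move=> _ _ [x Ix <-] [y Iy <-]; exists (x * y); last by rewrite rmorphM.
exact: ideal_mul_mem.
Qed.

Lemma sgIN I : sgI (- I) = - sgI I. Proof. exact: frac_ideal_eq. Qed.

Lemma sgIB I J : sgI (I - J) = sgI I - sgI J.
Proof. by rewrite sgID sgIN. Qed.

Lemma sgIK I : sgI (sgI I) = I.
Proof.
apply: frac_ideal_eq; apply/seteqP; split=> x.
  by move=> [_ [y Iy <-] <-]; rewrite sgK.
by move=> Ix; exists (s x); rewrite ?sgK //; exists x.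
Qed.

Fact sgx_neq0 (x : Lx) : s (nzval x) != 0.
Proof. by rewrite fmorph_eq0 nz_neq0. Qed.

Definition sgx (x : Lx) : Lx := Nonzero (sgx_neq0 x).

Lemma sgxB x y : sgx (x - y) = sgx x - sgx y.
Proof. by apply: nz_inj; rewrite /= fmorph_div. Qed.

Lemma sgxD x y : sgx (x + y) = sgx x + sgx y.
Proof. by apply: nz_inj; rewrite /= rmorphM. Qed.

Lemma sgxN x : sgx (- x) = - sgx x.
Proof. by apply: nz_inj; rewrite /= fmorphV. Qed.

Lemma sgxK x : sgx (sgx x) = x.
Proof. by apply: nz_inj; rewrite /= sgK. Qed.

Lemma sgI_prin x : sgI (prin x) = prin (sgx x).
Proof.
apply: frac_ideal_eq; apply/seteqP; split=> [_ [_ [y yO <-] <-]|_ [y yO <-]].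
  by exists (s y); [apply: integral_sg | rewrite rmorphM].
exists (nzval x * s y); last by rewrite rmorphM /= sgK.
by exists (s y) => //; apply: integral_sg.
Qed.

Lemma addr_sgI (I : ideals) : exists2 a : Lx, inK (nzval a) & I + sgI I = prin a.
Proof.
have [g [gK g0 gI]] := ideal_norm T (ideal_setP I) (frac_ideal_neq0 I).
by exists (Nonzero g0) => //; apply: frac_ideal_eq.
Qed.

(** J^2 = J s(J) is generated by some a b^2 in K with a squarefree, and A = J / (b) satisfies A^2 =
    (a). For x in A the square of x + s(x) is divisible by a, so x + s(x) is. Used also for omega x,
    this makes x sqrt d / a integral. Hence d x y / a^2 is integral for x, y in A; as a is a sum of
    such products x y, a divides d. *)
Lemma ambiguous_square (J : ideals) : sgI J = J ->
  exists a b : Lx, [/\ dvd_d T (nzval a), inK (nzval b) & J + J = prin (a + b + b)].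
Proof.
move=> sJ; have [e eK eJ] := addr_sgI J; rewrite sJ in eJ.
have [a [b [aS bK b0 eE]]] := squarefree_part eK (nz_neq0 e).
have [aZ a0 _] := aS.
exists (Nonzero a0), (Nonzero b0).
have {}eJ : J + J = prin (Nonzero a0 + Nonzero b0 + Nonzero b0).
  by rewrite eJ; congr prin; apply: nz_inj; rewrite /= eE; ring.
split=> //; split=> //.
pose A := J - prin (Nonzero b0).
have AA : A + A = prin (Nonzero a0).
  by rewrite addrACA eJ !prinD -opprD -[X in X - _]addrA addrK.
have sA : sgI A = A.
  rewrite sgIB sJ sgI_prin; congr (_ - _); congr prin; apply: nz_inj; exact: bK.
have As x : ideal_set A x -> ideal_set A (s x).
  by move=> Ax; rewrite -sA; exists x.
have AAO x y : ideal_set A x -> ideal_set A y -> O (x * y / a).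
  move=> Ax Ay; have : ideal_set (A + A) (x * y) by apply: ideal_mul_mem.
  by rewrite AA => -[u uO <-]; rewrite mulrC mulKf.
have [subA _] := ideal_setP A.
have trO x : ideal_set A x -> O ((x + s x) / a).
  move=> Ax; have At : ideal_set A (x + s x) by apply: submoduleD => //; apply: As.
  have tK := inK_trace T x.
  have t2 : ZK ((x + s x) ^+ 2 / a).
    apply: OKP; last by rewrite expr2; apply: AAO.
    by apply: inKM; [apply: inKM | apply/inKV/ZK_inK].
  have tZ : ZK (x + s x).
    apply: OKP => //; apply: integral_sqrt.
    rewrite -[X in O X](divfK a0).
    by apply: integral_mul; [apply: ZK_integral t2 | apply: ZK_integral aZ].
  exact: (ZK_integral (sqfreeK_dvd_sqr aS tZ t2)).
have wO x : ideal_set A x -> O (w * x / a).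
  move=> Ax; have Aox : ideal_set A (omega T * x).
    by apply: submoduleM => //; apply: omega_integral.
  (* Since omega - s(omega) = sqrt d, this expresses sqrt d x through the traces of omega x and of
     x. *)
  have -> : w * x / a = (omega T * x + s (omega T * x)) / a - s (omega T) * ((x + s x) / a).
    rewrite rmorphM /= /omega fmorph_div rmorphD /= rmorph1 sg_sd rmorph_nat; field.
    by rewrite a0 two_neq0.
  apply: integral_sub; first exact: trO.
  apply: integral_mul; last exact: trO.
  by apply: integral_sg; apply: omega_integral.
have : ideal_set (A + A) a.
  by rewrite AA; exists 1; [apply: integral1 | rewrite mulr1].
move=> [l [lP aE]]; apply: OKP.
  by apply: inKM; [apply: (inK_int T d) | apply/inKV/ZK_inK].
have -> : d%:R / a = d%:R * a / a ^+ 2 by field.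
rewrite {1}aE mulr_sumr mulr_suml; elim: l lP {aE} => [|u l IHl] lP.
  by rewrite big_nil; apply: integral0.
rewrite big_cons; apply: integral_add; last by apply: IHl => v vl; apply: lP; rewrite inE vl orbT.
have [/wO h1 /wO h2] := lP u (mem_head _ _).
have -> : d%:R * (u.1 * u.2) / a ^+ 2 = (w * u.1 / a) * (w * u.2 / a) by rewrite -(sd2 T); field.
exact: integral_mul.
Qed.

(** For J = (a, sqrt d) the square is a (a, sqrt d, d / a), and this is (a) because a and d / a are
    coprime. *)
Lemma ramified_ideal (a : Lx) : dvd_d T (nzval a) ->
  exists J : ideals, sgI J = J /\ J + J = prin a.
Proof.
move=> [aZ a0 da]; set A := nzval a in aZ a0 da.
have aK := ZK_inK aZ.
have AO := ZK_integral aZ; have wI := sd_integral T.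
pose S : set L := [set x | exists u v, [/\ O u, O v & x = A * u + w * v]].
have subS : is_submodule S.
  split.
  - by exists 0, 0; split; [apply: integral0 | apply: integral0 | rewrite !mulr0 addr0].
  - move=> _ _ [u [v [uO vO ->]]] [u' [v' [uO' vO' ->]]].
    by exists (u + u'), (v + v'); split; [apply: integral_add | apply: integral_add | ring].
  - move=> c _ cO [u [v [uO vO ->]]].
    by exists (c * u), (c * v); split; [apply: integral_mul | apply: integral_mul | ring].
have fS : is_fractional S.
  split=> //; exists 1; split; [exact: oner_neq0 | exact: integral1 |].
  by move=> _ [u [v [uO vO ->]]]; rewrite mul1r; apply: integral_add; apply: integral_mul.
have SA : S A by exists 1, 0; split; [apply: integral1 | apply: integral0 | ring].
have Sw : S w by exists 0, 1; split; [apply: integral0 | apply: integral1 | ring].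
have [|J JS] := frac_ideal_exists fS; first by exists A.
exists J; split; apply: frac_ideal_eq; rewrite /= JS.
  have sub x : S x -> S (s x).
    move=> [u [v [uO vO ->]]]; exists (s u), (- s v).
    split; [exact: integral_sg | by apply/integral_opp/integral_sg |].
    by rewrite rmorphD !rmorphM /= (aK : s A = A) sg_sd; ring.
  apply/seteqP; split=> [_ [x Sx <-]|x Sx]; first exact: sub.
  by exists (s x); [apply: sub | rewrite sgK].
apply/seteqP; split.
  apply: ideal_mul_incl.
    by case: (prin_set_fractional a).
  move=> _ _ [u [v [uO vO ->]]] [u' [v' [uO' vO' ->]]].
  exists (A * u * u' + w * (u * v' + u' * v) + d%:R / A * (v * v')).
    apply: integral_add; last by apply: integral_mul; [apply: ZK_integral da | apply: integral_mul].
    apply: integral_add; first by apply: integral_mul => //; apply: integral_mul.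
    by apply: integral_mul => //; apply: integral_add; apply: integral_mul.
  by rewrite -/A -(sd2 T); field.
have [u [v [uZ vZ uv]]] := dvd_d_coprime (And3 aZ a0 da).
move=> _ [y yO <-]; rewrite mulrC; apply: submoduleM => //.
  exact: ideal_mul_submodule.
rewrite -/A.
have -> : A = u * (A * A) + v * (w * w).
  by rewrite -(expr2 w) sd2 -[LHS]mulr1 -[in LHS]uv; field.
have subSS := ideal_mul_submodule S subS.
by apply: submoduleD => //; apply: submoduleM => //; try (exact: ZK_integral uZ || exact: ZK_integral vZ); apply: ideal_mul_mem.
Qed.

Definition ambiguous : set ideals := [set J | sgI J = J].

Definition prinK : set ideals := [set J | exists2 b : Lx, inK (nzval b) & J = prin b].

Lemma ambiguous_subgroup : is_subgroup ambiguous.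
Proof.
split; first by rewrite /ambiguous /= -prin0 sgI_prin; congr prin; apply: nz_inj; apply: rmorph1.
by move=> I J; rewrite /ambiguous /= sgIB => -> ->.
Qed.

Lemma prinK_subgroup : is_subgroup prinK.
Proof.
split; first by exists 0; [apply: inK1 | rewrite prin0].
move=> _ _ [a aK ->] [b bK ->]; exists (a - b); last by rewrite prinB.
by rewrite nz_valB; apply: inKM => //; apply: inKV.
Qed.

(** Each set S of primes above d has a divisor of d killed exactly by S, and the ramified ideal over
    this divisor represents S. By [ambiguous_square] these ideals reach every class: the squares
    agree up to ideals of K, and ideals have no 2-torsion. *)
Lemma index_ambiguous_prinK : has_index ambiguous prinK (2 ^ (4 * size (primes d))).
Proof.
rewrite -(size_zeta_homs (octic_primes T)).
pose n := size (zeta_homs d).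
pose hom (i : 'I_n) := nth (0%N, 0%N) (zeta_homs d) i.
have homP i : hom i \in zeta_homs d by apply: mem_nth.
have homI : injective hom.
  by move=> i j /eqP; rewrite nth_uniq ?zeta_homs_uniq // => /eqP/val_inj.
have homS h : h \in zeta_homs d -> exists i, h = hom i.
  move=> hh; have lt : (index h (zeta_homs d) < n)%N by rewrite index_mem.
  by exists (Ordinal lt); rewrite /hom /= nth_index.
have [f fP] : exists f : {set 'I_n} -> ideals * Lx, forall S, [/\ sgI (f S).1 = (f S).1, dvd_d T (nzval (f S).2),
   (f S).1 + (f S).1 = prin (f S).2 & forall i, kills T (hom i) (nzval (f S).2) <-> i \in S].
  have ex (S : {set 'I_n}) : exists u : ideals * Lx, [/\ sgI u.1 = u.1, dvd_d T (nzval u.2),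
     u.1 + u.1 = prin u.2 & forall i, kills T (hom i) (nzval u.2) <-> i \in S].
    have [a [ad aS]] := @dvd_d_exists _ _ T (fun h => [exists i in S, hom i == h]).
    have [_ a0 _] := ad.
    have [J [sJ JJ]] := @ramified_ideal (Nonzero a0) ad.
    exists (J, Nonzero a0); split=> //= i; rewrite aS //.
    split=> [/existsP[j /andP[jS /eqP/homI <-]]//|iS].
    by apply/existsP; exists i; rewrite iS eqxx.
  by have [f fP] := choice ex; exists f.
exists {set 'I_n}, (fun S => (f S).1); split.
- by rewrite -cardsT -powersetT card_powerset cardsT card_ord.
- by move=> S; case: (fP S).
- move=> S S' [b bK e].
  have [_ ad fJ aS] := fP S; have [_ ad' fJ' aS'] := fP S'.
  set a := (f S).2 in ad fJ aS; set a' := (f S').2 in ad' fJ' aS'.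
  have : prin (a - a' - (b + b)) = 0.
    by rewrite prinB (prinD b b) -e addrACA -opprD prinB -fJ -fJ' subrr.
  move=> /prin_eq0[uO uV]; set u := nzval _ in uO uV.
  have [aZ a0 _] := ad; have [aZ' a0' _] := ad'.
  have uK : inK u.
    rewrite /u !nz_valB nz_valD; apply: inKM; first by apply: inKM; [apply: ZK_inK | apply/inKV/ZK_inK].
    by apply/inKV/inKM.
  have uZ := OKP uK uO; have uVZ := OKP (inKV uK) uV.
  have aE : nzval a = u * nzval b ^+ 2 * nzval a'.
    by rewrite /u !nz_valB nz_valD; field; rewrite a0' nz_neq0.
  have [bZ bVZ] := sqfreeK_ratio (dvd_d_sqfree ad) (dvd_d_sqfree ad') bK (nz_neq0 b) uZ uVZ aE.
  apply/setP => i; apply/idP/idP => [/aS|/aS'] k; [apply/aS' | apply/aS].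
    have -> : nzval a' = (u^-1 * (nzval b)^-1 ^+ 2) * nzval a.
      rewrite aE; field; rewrite nz_neq0 /=.
      by apply: contraNneq a0 => u0; rewrite aE u0 !mul0r.
    by apply: killsM => //; apply: ZKM => //; apply: ZKX.
  by rewrite aE; apply: killsM => //; apply: ZKM => //; apply: ZKX.
- move=> J /ambiguous_square[c [b [cd bK JJ]]].
  pose S : {set 'I_n} := [set i | `[< kills T (hom i) (nzval c) >]]%SET.
  have [_ ad fJ aS] := fP S.
  have [|caZ acZ] := @dvd_d_eq _ _ T _ _ ad cd.
    move=> h /homS[i ->]; rewrite aS inE; split; by move/asboolP.
  exists S, b => //; apply/eqP; rewrite -subr_eq0; apply/eqP/frac_ideal_double_eq0.
  rewrite addrACA -opprD addrACA -opprD fJ JJ -prinD -!prinB; apply/prin_eq0.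
  rewrite /is_unit !nz_valB !nz_valD; have b0 := nz_neq0 b; have c0 := nz_neq0 c; have a0 := nz_neq0 (f S).2.
  split.
    have -> : nzval c * nzval b * nzval b / nzval (f S).2 / (nzval b * nzval b) = nzval c / nzval (f S).2 by field; rewrite a0 b0.
    exact: ZK_integral caZ.
  have -> : (nzval c * nzval b * nzval b / nzval (f S).2 / (nzval b * nzval b))^-1 = nzval (f S).2 / nzval c.
    by field; rewrite a0 b0 c0.
  exact: ZK_integral acZ.
Qed.

End FracIdeals.

(** * Finiteness of the class group *)

(** Dirichlet's theorem in dimension k: N^k + 1 multiples are distributed over N^k cubes of side
    1/N. *)
Lemma simultaneous_approx (N k : nat) (c : nat -> rat) : (0 < N)%N ->
  exists m : nat, [/\ (0 < m)%N, (m <= N ^ k)%N & exists n : nat -> int,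
    forall j, (j < k)%N -> `|m%:R * c j - (n j)%:~R| * N%:R < 1].
Proof.
move=> N0; pose fl (i j : nat) : int := Num.floor (i%:R * c j).
pose fr i j : rat := i%:R * c j - (fl i j)%:~R.
have frP i j : 0 <= fr i j < 1.
  have h1 : (fl i j)%:~R <= i%:R * c j by apply: Num.Theory.floor_le.
  have := Num.Theory.floorD1_gt (i%:R * c j); rewrite rmorphD /= -/(fl i j) /fr => h2.
  by apply/andP; split; lra.
pose bx i j : int := Num.floor (fr i j * N%:R).
have N0R : 0 < N%:R :> rat by rewrite ltr0n.
have bxP i j : (bx i j)%:~R <= fr i j * N%:R < (bx i j + 1)%:~R.
  by rewrite Num.Theory.floor_le /= Num.Theory.floorD1_gt.
have bx_ge0 i j : 0 <= bx i j.
  by rewrite Num.Theory.floor_ge0 mulr_ge0 ?ler0n //; case/andP: (frP i j).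
have bxN i j : (absz (bx i j) < N)%N.
  rewrite -ltz_nat gez0_abs // -(ltr_int rat).
  apply: le_lt_trans (proj1 (andP (bxP i j))) _.
  by rewrite -[X in _ < X]mul1r ltr_pM2r //; case/andP: (frP i j).
pose F (i : nat) : {ffun 'I_k -> 'I_N} := [ffun j : 'I_k => Ordinal (bxN i j)].
have ltc : (#|{: {ffun 'I_k -> 'I_N}}| < (N ^ k).+1)%N by rewrite card_ffun !card_ord.
have [i [j [lij /enum_rank_inj /ffunP bij]]] :=
  not_injective_pigeonhole (fun i : 'I_((N ^ k).+1) => enum_rank (F i)) ltc.
exists (j - i)%N; split; first by rewrite subn_gt0.
  by rewrite (leq_trans (leq_subr _ _)) // -ltnS.
exists (fun l => fl j l - fl i l) => l lk.
have {}bij : bx i l = bx j l.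
  have := congr1 val (bij (Ordinal lk)); rewrite !ffunE /= => e.
  by rewrite -(gez0_abs (bx_ge0 i l)) e gez0_abs.
have -> : (j - i)%:R * c l - (fl j l - fl i l)%:~R = fr j l - fr i l.
  by rewrite /fr natrB ?(ltnW lij) // rmorphB /=; ring.
rewrite -(gtr0_norm N0R) -normrM ltr_norml mulrBl.
have := bxP i l; have := bxP j l; rewrite bij rmorphD /= => /andP[h1 h2] /andP[h3 h4].
by apply/andP; split; lra.
Qed.

Section ClassNumber.

Variables (L : fieldExtType rat) (d : nat) (T : octic L d).
Local Notation z := (zeta T).
Local Notation w := (sd T).
Local Notation s := (sg T).
Local Notation ZK := (ZK T).
Local Notation inK := (inK T).
Local Notation O := (@is_integral L).
Local Notation Lx := (nonzero L).
Local Notation ideals := (frac_ideal L).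

Definition NmL (x : L) : L := NmK T (x * s x).

Lemma NmLM x y : NmL (x * y) = NmL x * NmL y.
Proof. by rewrite /NmL rmorphM /= -NmKM; congr NmK; ring. Qed.

Lemma NmL_eq0 x : NmL x = 0 -> x = 0.
Proof. by move/NmK_eq0/eqP; rewrite mulf_eq0 fmorph_eq0 orbb => /eqP. Qed.

Lemma NmL_integral x : O x -> exists k : nat, NmL x = k%:R.
Proof.
move=> xO; apply: ZK_NmK; apply: OKP; first exact: inK_norm.
by apply: integral_mul => //; apply: integral_sg.
Qed.

Definition comb8 (g : nat -> rat) : L :=
  zcomb z (g 0%N) (g 1%N) (g 2%N) (g 3%N) + zcomb z (g 4%N) (g 5%N) (g 6%N) (g 7%N) * w.

Lemma comb8_span x : exists g, x = comb8 g.
Proof.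
have [a0 [a1 [a2 [a3 [b0 [b1 [b2 [b3 ->]]]]]]]] := octic_span T x.
by exists (fun i => nth 0 [:: a0; a1; a2; a3; b0; b1; b2; b3] i).
Qed.

Lemma comb8B g h : comb8 g - comb8 h = comb8 (fun i => g i - h i).
Proof. by rewrite /comb8 opprD addrACA -mulrBl !quarticN !quarticD. Qed.

Lemma zcombZ (q : rat) a0 a1 a2 a3 :
  q%:A * zcomb z a0 a1 a2 a3 = zcomb z (q * a0) (q * a1) (q * a2) (q * a3).
Proof. by rewrite -(zcomb_rat T) quarticM; congr zcomb; ring. Qed.

Lemma comb8Z (q : rat) g : q%:A * comb8 g = comb8 (fun i => q * g i).
Proof. by rewrite /comb8 mulrDr mulrA !zcombZ. Qed.

Lemma comb8_integral (n : nat -> int) : O (comb8 (fun i => (n i)%:~R)).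
Proof.
apply: integral_add; first by apply: (@ZK_integral _ _ T); do 4 eexists.
apply: integral_mul; last exact: sd_integral T.
by apply: (@ZK_integral _ _ T); do 4 eexists.
Qed.

(** Write the element as A + B sqrt d. With N = 4 (d + 1), each coordinate of its relative norm A^2
    - d B^2 is at most 4 (d + 1) / N^2 = 1 / N <= 1/2, where [qnorm_lt1] applies. *)
Lemma NmL_comb8_lt1 (g : nat -> rat) :
  (forall j, (j < 8)%N -> `|g j| * (4 * d.+1)%:R < 1) ->
  exists2 q : rat, 0 <= q < 1 & NmL (comb8 g) = q%:A.
Proof.
move=> gP; pose N : rat := (4 * d.+1)%:R.
have N0 : 0 < N by rewrite ltr0n.
have gN j : (j < 8)%N -> `|g j| <= N^-1.
  by move=> /gP h; rewrite -[N^-1]mul1r ler_pdivlMr // ltW.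
have NV : 0 <= N^-1 by rewrite invr_ge0 ltW.
have pr i j : (i < 8)%N -> (j < 8)%N -> `|g i * g j| <= N^-1 ^+ 2.
  by move=> /gN hi /gN hj; rewrite normrM expr2 ler_pM.
have dN : d%:R * 8 * N^-1 ^+ 2 + 8 * N^-1 ^+ 2 <= 2^-1.
  have -> : d%:R * 8 * N^-1 ^+ 2 + 8 * N^-1 ^+ 2 = 2 * N^-1.
    have d1 : (d.+1)%:R != 0 :> rat by rewrite pnatr_eq0.
    rewrite /N natrM; move: d1; rewrite -natr1 => d1; field; exact: d1.
  have h4 : 4 <= N by rewrite /N ler_nat mulnS leq_addr.
  have : N^-1 <= 4^-1 by rewrite lef_pV2.
  by move: (N^-1) => u; lra.
have -> : NmL (comb8 g) = NmK T (
   zcomb z (g 0%N) (g 1%N) (g 2%N) (g 3%N) * zcomb z (g 0%N) (g 1%N) (g 2%N) (g 3%N) -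
   (d%:R : rat)%:A * (zcomb z (g 4%N) (g 5%N) (g 6%N) (g 7%N) * zcomb z (g 4%N) (g 5%N) (g 6%N) (g 7%N))).
  rewrite /NmL; congr NmK; rewrite /comb8 rmorphD rmorphM /= !sg_quartic sg_sd.
  by rewrite -[d%:R]/(d%:Z%:~R) intr_alg -[d%:Z%:~R]/(d%:R) -(sd2 T); ring.
rewrite !quarticM zcombZ quarticN quarticD NmK_zcomb.
eexists; last reflexivity.
rewrite qnorm_ge0 /=.
move: dN; set e := N^-1 ^+ 2 => dN.
have d0 : 0 <= d%:R :> rat by apply: ler0n.
have key (x y : rat) : `|x| <= 4 * e -> `|y| <= 4 * e -> `|x - d%:R * y| <= 2^-1.
  move=> hx hy; apply: le_trans (ler_normB _ _) _; rewrite normrM (ger0_norm d0).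
  by have := ler_wpM2l d0 hy; lra.
have tri (a b c h : rat) : `|a| <= e -> `|b| <= e -> `|c| <= e -> `|h| <= e ->
    [/\ `|a - b - c - h| <= 4 * e, `|a + b - c - h| <= 4 * e, `|a + b + c - h| <= 4 * e
      & `|a + b + c + h| <= 4 * e].
  by rewrite !ler_norml => /andP[? ?] /andP[? ?] /andP[? ?] /andP[? ?]; split; apply/andP; split; lra.
(* The arguments of [q] list the index pairs of the four products in each coordinate of A^2 and of
   B^2, as in [quarticM]. *)
have q i1 j1 i2 j2 i3 j3 i4 j4 := @tri (g i1 * g j1) (g i2 * g j2) (g i3 * g j3) (g i4 * g j4).
by apply: qnorm_lt1; apply: key; [case: (q 0 0 1 3 2 2 3 1)%N | case: (q 4 4 5 7 6 6 7 5)%N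
 | case: (q 0 1 1 0 2 3 3 2)%N | case: (q 4 5 5 4 6 7 7 6)%N
 | case: (q 0 2 1 1 2 0 3 3)%N | case: (q 4 6 5 5 6 4 7 7)%N
 | case: (q 0 3 1 2 2 1 3 0)%N | case: (q 4 7 5 6 6 5 7 4)%N ]; rewrite ?pr.
Qed.

(** Hurwitz's substitute for Euclidean division: simultaneous approximation of the eight coordinates
    needs a multiplier m <= N^8, which divides M = (N^8)!. *)
Lemma hurwitz : exists2 M : nat, (0 < M)%N & forall x : L,
  exists m y, [/\ (0 < m)%N, (m %| M)%N, O y &
  exists2 q : rat, 0 <= q < 1 & NmL (m%:R * x - y) = q%:A].
Proof.
pose N := (4 * d.+1)%N.
exists ((N ^ 8)`!)%N; first exact: fact_gt0.
move=> x; have [g ->] := comb8_span x.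
have [|m [m0 mN [n nP]]] := @simultaneous_approx N 8 g; first by [].
exists m, (comb8 (fun i => (n i)%:~R)); split=> //.
- by apply: dvdn_fact; rewrite m0.
- exact: comb8_integral.
have -> : m%:R * comb8 g = comb8 (fun i => m%:R * g i).
  by rewrite -comb8Z -[m%:R]/(m%:Z%:~R) -intr_alg.
by rewrite comb8B; apply: NmL_comb8_lt1.
Qed.

Section BoundedIdeals.

Variable M : nat.
Hypothesis M_gt0 : (0 < M)%N.
Hypothesis hurwitzM : forall x : L, exists m y, [/\ (0 < m)%N, (m %| M)%N, O y &
  exists2 q : rat, 0 <= q < 1 & NmL (m%:R * x - y) = q%:A].

Let B := ((2 * d) * M)%N.
Let d_gt0 : (0 < d)%N. Proof. by apply: ltn_trans (octic_gt2 T). Qed.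
Let B_gt0 : (0 < B)%N. Proof. by rewrite muln_gt0 M_gt0 muln_gt0 d_gt0. Qed.

(** Take b in I of least norm and J = (M / b) I. For a in I, Hurwitz's property of a / b yields m a
    - v b in I of smaller norm than b. It is therefore 0, so m a / b = v is integral, and then M a /
    b as well. *)
Lemma bounded_representative (I : ideals) : exists J : ideals,
  [/\ exists x, I - J = prin T x, ideal_set J `<=` O & ideal_set J M%:R].
Proof.
have [[sI sub] [c [c0 cO cI]]] := (ideal_setP I, proj2 (ideal_setP I)).
pose P k := `[< exists b, [/\ ideal_set I b, b != 0 & NmL (c * b) = k%:R] >].
have exP : exists k, P k.
  have [b Ib b0] := frac_ideal_neq0 I; have [k kE] := NmL_integral (cI _ Ib).
  by exists k; apply/asboolP; exists b.
have [k /asboolP[b [Ib b0 kE]] kmin] := ex_minnP exP.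
have Mn0 : M%:R != 0 :> L by rewrite natrL_eq0 -lt0n.
pose x := Nonzero (mulf_neq0 Mn0 (invr_neq0 b0)).
exists (I + prin T x); split.
- by exists (- x); rewrite prinN opprD addrA subrr add0r.
- rewrite ideal_setD; apply: ideal_mul_incl; first exact: ring_of_integers_submodule.
  move=> a _ Ia [y yO <-].
  have [m [v [m0 mM vO [q /andP[q0 q1] qE]]]] := hurwitzM (a / b).
  have mn0 : m%:R != 0 :> L by rewrite natrL_eq0 -lt0n.
  suff e : m%:R * (a / b) = v.
    have [l lE] := dvdnP mM.
    have -> : a * (nzval x * y) = l%:R * v * y by rewrite -e /= lE natrM; field.
    by apply: integral_mul => //; apply: integral_mul => //; apply: integral_nat.
  apply/eqP; rewrite -subr_eq0; apply/negPn/negP => n0.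
  have Iab : ideal_set I (m%:R * a - v * b).
    apply: submoduleD => //; first by apply: submoduleM => //; apply: integral_nat.
    by rewrite -mulNr; apply: submoduleM => //; apply: integral_opp.
  have e : m%:R * a - v * b = (m%:R * (a / b) - v) * b by field.
  have [j jE] := NmL_integral (cI _ Iab).
  have Pj : P j by apply/asboolP; exists (m%:R * a - v * b); split=> //; rewrite e mulf_neq0.
  have jqk : j%:R = q * k%:R :> rat.
    apply: (fmorph_inj (in_alg L)); rewrite /= -[j%:R]/(j%:Z%:~R) intr_alg -[LHS]jE e mulrCA NmLM qE kE.
    by rewrite -scalerAl mul1r -[k%:R]/(k%:Z%:~R) -[k%:R in RHS]/(k%:Z%:~R) -intr_alg scalerA.
  have := kmin _ Pj; rewrite leqNgt => /negP[].
  have k0 : (0 < k)%N.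
    rewrite lt0n; apply/eqP => k0; move: kE; rewrite k0 => /NmL_eq0/eqP.
    by rewrite mulf_eq0 (negbTE c0) (negbTE b0).
  by rewrite -(ltr_nat rat) jqk -[X in _ < X]mul1r ltr_pM2r ?ltr0n.
- have -> : M%:R = b * (M%:R * b^-1 * 1) by field.
  by apply: ideal_mul_mem => //; exists 1 => //; apply: integral1.
Qed.

(** 2 d x = d (x + s(x)) + sqrt d (sqrt d x + s(sqrt d x)), and both relative traces lie in
    Z[zeta]. *)
Lemma integral_comb8 x : O x -> exists n : nat -> int, (2 * d)%:R * x = comb8 (fun i => (n i)%:~R).
Proof.
move=> xO.
have [n0 [n1 [n2 [n3 aE]]]] : ZK (x + s x).
  by apply: OKP; [apply: inK_trace | apply: integral_add => //; apply: integral_sg].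
have [m0 [m1 [m2 [m3 bE]]]] : ZK (w * x + s (w * x)).
  by apply: OKP; [apply: inK_trace | apply: integral_add; [|apply: integral_sg]; apply: integral_mul => //; apply: sd_integral T].
exists (fun i => nth 0 [:: d%:Z * n0; d%:Z * n1; d%:Z * n2; d%:Z * n3; m0; m1; m2; m3] i).
rewrite /comb8 /= -bE !rmorphM /= -zcombZ -aE.
by rewrite intr_alg sg_sd -[d%:Z%:~R]/(d%:R) natrM -(sd2 T); ring.
Qed.

(** An ideal between M O and O is determined by its elements modulo M. These are recorded by the
    coordinates of 2 d x modulo B = 2 d M, which leaves finitely many possibilities. *)
Lemma class_group_finite_of_bound : exists n, has_index [set: ideals] [set I | exists x, I = prin T x] n.
Proof.
have [rep repP] := choice bounded_representative.
pose cz (g : {ffun 'I_8 -> 'I_B}) : nat -> rat := fun i => (g (inord i) : nat)%:R.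
pose f (I : ideals) : {set {ffun 'I_8 -> 'I_B}} :=
  [set g | `[< ideal_set (rep I) (comb8 (cz g) / (2 * d)%:R) >]]%SET.
have Dn0 : (2 * d)%:R != 0 :> L by rewrite natrL_eq0 -lt0n muln_gt0 d_gt0.
have sub I J : f I = f J -> ideal_set (rep I) `<=` ideal_set (rep J).
  move=> fIJ x Ix; have [_ IO IM] := repP I; have [_ _ JM] := repP J.
  have [subI _] := ideal_setP (rep I); have [subJ _] := ideal_setP (rep J).
  have [n nE] := integral_comb8 (IO _ Ix).
  have modB i : (absz (n i %% B%:Z)%Z < B)%N by have := B_gt0; lia.
  pose g : {ffun 'I_8 -> 'I_B} := [ffun i : 'I_8 => Ordinal (modB i)].
  pose q i := (n i %/ B%:Z)%Z.
  have xE : x - comb8 (cz g) / (2 * d)%:R = comb8 (fun i => (q i)%:~R) * M%:R.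
    apply: (mulfI Dn0); rewrite mulrBr nE mulrCA divff // mulr1 comb8B.
    rewrite mulrCA -natrM -[(2 * d * _)%:R]/(B%:Z%:~R) -intr_alg mulrC comb8Z.
    have h i : (i < 8)%N -> (n i)%:~R - cz g i = B%:~R * (q i)%:~R.
      move=> i8; rewrite /cz ffunE inordK //= -[_%:R]/((absz (n i %% B%:Z)%Z)%:Z%:~R) gez0_abs.
        by rewrite {1}(divz_eq (n i) B%:Z) rmorphD rmorphM /= addrK mulrC.
      by rewrite modz_ge0 // -lt0n B_gt0.
    by rewrite /comb8 !h.
  have intM J' : ideal_set (rep J') (comb8 (fun i => (q i)%:~R) * M%:R).
    have [_ _ ?] := repP J'; have [? _] := ideal_setP (rep J').
    by apply: submoduleM => //; apply: comb8_integral.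
  have : g \in f I.
    rewrite inE; apply/asboolP.
    have -> : comb8 (cz g) / (2 * d)%:R = x + (-1) * (comb8 (fun i => (q i)%:~R) * M%:R).
      by rewrite -xE; ring.
    apply: submoduleD => //; apply: submoduleM => //.
    by rewrite -[-1]/((-1)%:~R); apply: int_integral.
  rewrite fIJ inE => /asboolP gJ.
  have -> : x = comb8 (cz g) / (2 * d)%:R + comb8 (fun i => (q i)%:~R) * M%:R by rewrite -xE; ring.
  exact: submoduleD.
apply: (has_index_finite (f := f)).
  split; first by exists 0; rewrite prin0.
  by move=> _ _ [x ->] [y ->]; exists (x - y); rewrite prinB.
move=> I J _ _ fIJ.
have eIJ : rep I = rep J by apply: frac_ideal_eq; apply/seteqP; split; apply: sub.
have [[x xE] _ _] := repP I; have [[y yE] _ _] := repP J.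
by exists (x - y); rewrite prinB -xE -yE eIJ opprB addrA subrK.
Qed.

End BoundedIdeals.

Lemma class_group_finite : exists n, has_index [set: ideals] [set I | exists x, I = prin T x] n.
Proof. by have [M M0 hM] := hurwitz; apply: class_group_finite_of_bound M0 hM. Qed.

End ClassNumber.

(** * Units *)

Lemma finite_roots (F : fieldType) (p : {poly F}) : p != 0 ->
  exists l : seq F, forall x, root p x -> x \in l.
Proof.
have [n] := ubnP (size p); elim: n p => // n IHn p sp p0.
have [[a pa]|np] := pselect (exists a, root p a); last first.
  by exists [::] => x px; case: np; exists x.
have [q pE] := factor_theorem p a pa.
have q0 : q != 0 by apply: contraNneq p0 => q0; rewrite pE q0 mul0r.
have sq : (size q < n)%N.
  by move: sp; rewrite pE size_mul ?polyXsubC_eq0 // size_XsubC addn2.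
have [l lP] := IHn q sq q0; exists (a :: l) => x.
by rewrite pE rootM root_XsubC inE orbC => /orP[->|/lP->]; rewrite ?orbT.
Qed.

Lemma squarefree_int_nonsquare (D : nat) : squarefree D -> (1 < D)%N ->
  forall x y : int, x ^+ 2 = D%:Z * y ^+ 2 -> y = 0.
Proof.
move=> sD D1 x y e; apply/eqP/negPn/negP => y0.
have := squarefree_not_square (x%:~R / y%:~R) sD D1; case/eqP.
have y0' : y%:~R != 0 :> rat by rewrite intr_eq0.
rewrite expr_div_n -[x%:~R ^+ 2]rmorphXn e [in LHS]rmorphM rmorphXn /= mulfK //.
by rewrite expf_neq0.
Qed.

Section PellUnitIntegral.

Variables (L : fieldExtType rat) (D : nat) (delta : L).
Hypothesis deltaP : delta ^+ 2 = D%:R.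

Lemma pell_unit_integral v : pell_unit D delta v -> is_integral v /\ is_integral v^-1.
Proof.
suff sub u : pell_unit D delta u -> is_integral u.
  by move=> uP; split; apply: sub => //; apply: (pell_unitV deltaP).
move=> [X [Y [uE h]]].
apply: (@integral_root_monic _ _ intr u ('X^2 - X%:~R *: 'X + 1)).
- rewrite monicE -addrA lead_coefDl ?lead_coefXn // size_polyXn.
  apply: leq_ltn_trans (size_polyD _ _) _; rewrite gtn_max size_polyN size_poly1.
  by rewrite (leq_ltn_trans (size_scale_leq _ _)) ?size_polyX.
- have := pell_elt_conj deltaP h; rewrite -uE => e.
  rewrite /root !hornerE -[X in _ + X == _]e; apply/eqP.
  have -> : pell_elt delta X (- Y) = X%:~R - u by rewrite uE /pell_elt rmorphN /=; field; rewrite natrL_eq0.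
  by ring.
- apply/integral_poly => i; rewrite !coefE.
  apply: integral_add; last exact: integral_nat.
  apply: integral_sub; first exact: integral_nat.
  by apply: integral_mul; [apply: int_integral | apply: integral_nat].
Qed.

(** Positive powers keep positive coordinates, so they are irrational; negative exponents follow by
    inversion. *)
Lemma pell_elt_free (X Y : int) (k : int) : squarefree D -> (1 < D)%N ->
  X ^+ 2 - D%:Z * Y ^+ 2 = 4 -> 0 < X -> 0 < Y -> pell_elt delta X Y ^ k = 1 -> k = 0.
Proof.
move=> sD D1 h X0 Y0.
have main n : pell_elt delta X Y ^+ n.+1 != 1.
  have [U [V [e hUV U0 V0]]] := pell_pos_exp deltaP n h X0 Y0 (ltnW D1).
  rewrite e; apply/eqP => e1.
  have e2 : V%:~R * delta = (2 - U)%:~R.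
    have e2 : U%:~R + V%:~R * delta = 2%:~R.
      by rewrite -[LHS](divfK (two_neq0 L)) -[X in X * _]/(pell_elt delta U V) e1 mul1r.
    by rewrite rmorphB /= -e2; ring.
  suff V00 : V = 0 by rewrite V00 in V0.
  apply: (@squarefree_int_nonsquare D sD D1 (2 - U)).
  apply: (@intrL_inj L); rewrite /= [LHS]rmorphXn [RHS]rmorphM rmorphXn /= -e2 exprMn deltaP.
  by rewrite mulrC.
case: k => [[|n]|n] //.
  by rewrite -exprnP => /eqP; rewrite (negbTE (main n)).
rewrite NegzE -exprz_inv -exprnP exprVn => /(congr1 GRing.inv); rewrite invrK invr1 => /eqP.
by rewrite (negbTE (main n)).
Qed.

End PellUnitIntegral.

Section Units.

Variables (L : fieldExtType rat) (d : nat) (T : octic L d).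
Local Notation z := (zeta T).
Local Notation w := (sd T).
Local Notation s := (sg T).
Local Notation t := (tau T).
Local Notation r := (rho T).
Local Notation inK := (inK T).
Local Notation O := (@is_integral L).
Local Notation Lx := (nonzero L).

Let im := z ^+ 2.
Let s2 := z - z ^+ 3.

Lemma fixed_rat x : s x = x -> t x = x -> r x = x -> exists q : rat, x = q%:A.
Proof.
move=> /fixed_quartic[a0 [a1 [a2 [a3 ->]]]].
rewrite quartic_tau quartic_rho => /quartic_inj[_ _ e2 _] /quartic_inj[_ e1 _ e3].
exists a0; rewrite -(zcomb_rat T); congr zcomb; lra.
Qed.

(* f acts on v and delta as on a norm one element of Q(delta). *)
Definition compatible (f : {rmorphism L -> L}) (v delta : L) : Prop :=
  (f v = v /\ f delta = delta) \/ (f v = v^-1 /\ f delta = - delta).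

(** v + 1/v and (v - 1/v) / delta are fixed by all three automorphisms, hence rational; they are X
    and Y. The first is integral, and D Y^2 = X^2 - 4 with D squarefree makes the second an
    integer. *)
Lemma quadratic_unit (D : int) (delta v : L) : squarefree (absz D) -> D != 0 ->
  delta ^+ 2 = D%:~R -> v != 0 -> O v -> O v^-1 ->
  compatible s v delta -> compatible t v delta -> compatible r v delta ->
  exists X Y : int, v = (X%:~R + Y%:~R * delta) / 2 /\ X ^+ 2 - D * Y ^+ 2 = 4.
Proof.
move=> sD D0 dD v0 vO vV sv tv rv.
have dn0 : delta != 0.
  apply/eqP => d0; move: dD; rewrite d0 expr0n /= => /esym/eqP.
  by rewrite intrL_eq0 (negbTE D0).
have trf f : compatible f v delta -> f (v + v^-1) = v + v^-1.
  by move=> [[e _]|[e _]]; rewrite rmorphD fmorphV e ?invrK // addrC.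
have dff f : compatible f v delta -> f ((v - v^-1) / delta) = (v - v^-1) / delta.
  move=> [[e e']|[e e']]; rewrite fmorph_div rmorphB fmorphV e e' // invrK invrN mulrN -mulNr opprB //.
have [a aE] := fixed_rat (trf s sv) (trf t tv) (trf r rv).
have [b bE] := fixed_rat (dff s sv) (dff t tv) (dff r rv).
have /rat_integral/intrP[X XE] : O a%:A by rewrite -aE; apply: integral_add.
have e : (a ^+ 2 - D%:~R * b ^+ 2)%:A = 4%:~R :> L.
  rewrite -(in_algE L) rmorphB [X in _ - X]rmorphM !rmorphXn /=.
  by rewrite -aE -bE intr_alg -dD; field; rewrite dn0 v0.
have {}e : a ^+ 2 - D%:~R * b ^+ 2 = 4.
  by apply: (fmorph_inj (in_alg L)); rewrite /= e -(intr_alg L 4).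
have /intrP[Y YE] : b \is a Num.int.
  apply: (squarefree_Zdiv sD).
  have -> : (absz D)%:Q = Num.sg D%:~R * D%:~R.
    by rewrite abszE -[RHS]normrEsg intr_norm.
  have -> : Num.sg (D%:~R : rat) * D%:~R * b ^+ 2 = Num.sg D%:~R * (a ^+ 2 - 4) by rewrite -e; ring.
  rewrite rpredM ?rpredB ?rpredX ?XE ?intr_int //.
  by case: sgrP => _; rewrite ?rpred0 ?rpred1 ?rpredN1.
exists X, Y; split.
  rewrite -!intr_alg -XE -YE -aE -bE; field; by rewrite dn0 v0 two_neq0.
by apply: (@intr_inj rat); rewrite rmorphB [X in _ - X]rmorphM !rmorphXn /= -XE -YE.
Qed.

(** X^2 + D Y^2 = 4 leaves |X| <= 2. For X = 0 one has v^2 = -1, for |X| = 2 one has v^2 = 1, and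
    |X| = 1 would need D Y^2 = 3: the case D = 3 of the third and sixth roots of unity. *)
Lemma imaginary_unit (D : nat) (delta v : L) : squarefree D -> (0 < D)%N -> D != 3%N ->
  delta ^+ 2 = - D%:R -> v != 0 -> O v -> O v^-1 ->
  compatible s v delta -> compatible t v delta -> compatible r v delta -> v ^+ 4 = 1.
Proof.
move=> sD D0 D3 dD v0 vO vV sv tv rv.
have [|||X [Y [vE h]]] := @quadratic_unit (- D%:Z) delta v _ _ _ v0 vO vV sv tv rv.
- by rewrite abszN.
- by rewrite oppr_eq0; apply/eqP => -[D00]; rewrite D00 in D0.
- by rewrite dD rmorphN.
have {}h : X ^+ 2 + D%:Z * Y ^+ 2 = 4 by move: h; rewrite mulNr opprK.
have DY : 0 <= D%:Z * Y ^+ 2 by rewrite mulr_ge0 ?sqr_ge0.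
have X2 : (absz X <= 2)%N.
  rewrite -(@leq_exp2r _ _ 2) // -lez_nat -abszX gez0_abs ?sqr_ge0 //; lia.
have YD : D%:Z * Y ^+ 2 = 4 - X ^+ 2 by lia.
have four (u : L) : u ^+ 2 = 1 \/ u ^+ 2 = -1 -> u ^+ 4 = 1.
  by move=> [] e; rewrite (exprM u 2 2) e ?expr1n // sqrrN expr1n.
have [X0|X1|X2'] : [\/ absz X = 0%N, absz X = 1%N | absz X = 2%N] by case: (absz X) X2 => [|[|[|k]]] // _; [constructor 1|constructor 2|constructor 3].
- have X00 : X = 0 by lia.
  move: YD; rewrite X00 expr0n subr0 => YD.
  apply: four; right; rewrite vE X00 add0r exprMn exprMn dD.
  have -> : Y%:~R ^+ 2 * - D%:R = - (D%:Z * Y ^+ 2)%:~R :> L.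
    by rewrite rmorphM rmorphXn /=; ring.
  by rewrite YD; field; rewrite !natrL_eq0.
- have YD3 : D%:Z * Y ^+ 2 = 3.
    by rewrite YD -(gez0_abs (sqr_ge0 X)) abszX X1.
  have : (D * absz Y ^ 2)%N = 3%N.
    by apply/eqP; rewrite -eqz_nat PoszM -abszX gez0_abs ?sqr_ge0 // YD3.
  move=> e3; have D3' : (D %| 3)%N by rewrite -e3 dvdn_mulr.
  have : D \in divisors 3 by rewrite -dvdn_divisors.
  rewrite [divisors 3]/= !inE => /orP[/eqP D1|]; last by rewrite (negbTE D3).
  move: e3; rewrite D1 mul1n; case: (absz Y) => [|[|k]] //.
  move=> e3; have : (2 ^ 2 <= k.+2 ^ 2)%N by rewrite leq_exp2r.
  by rewrite e3.
- have X4 : X ^+ 2 = 4 by rewrite -(gez0_abs (sqr_ge0 X)) abszX X2'.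
  have Y0 : Y = 0.
    move: YD; rewrite X4 subrr => /eqP; rewrite mulf_eq0 expf_eq0 /=.
    by case/orP=> [/eqP[D00]|/eqP//]; rewrite D00 in D0.
  apply: four; left; rewrite vE Y0 mul0r addr0 exprMn -rmorphXn X4.
  by field; rewrite natrL_eq0.
Qed.

Let im2 : im ^+ 2 = - 1%N%:R. Proof. by rewrite /im -exprM zeta4. Qed.

Let s22 : s2 ^+ 2 = 2%N%:R.
Proof.
have -> : s2 ^+ 2 = z ^+ 2 * (1 + z ^+ 4) - 2 * z ^+ 4 by rewrite /s2; ring.
by rewrite zeta4 subrr mulr0 sub0r mulrN1 opprK.
Qed.

Let sim : s im = im. Proof. by rewrite rmorphXn /= sg_zeta. Qed.
Let ss2 : s s2 = s2. Proof. by rewrite rmorphB rmorphXn /= sg_zeta. Qed.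
Let rim : r im = im. Proof. by rewrite rmorphXn /= rho_zeta sqrrN. Qed.
Let rs2 : r s2 = - s2. Proof. by rewrite rmorphB rmorphXn /= rho_zeta /s2; ring. Qed.
Let tim : t im = - im.
Proof.
rewrite rmorphXn /= tau_zeta sqrrN /im.
have -> : (z ^+ 3) ^+ 2 = z ^+ 4 * z ^+ 2 by ring.
by rewrite zeta4 mulN1r.
Qed.
Let ts2 : t s2 = s2.
Proof.
rewrite rmorphB rmorphXn /= tau_zeta /s2.
have -> : - z ^+ 3 - (- z ^+ 3) ^+ 3 = - z ^+ 3 + (z ^+ 4) ^+ 2 * z by ring.
by rewrite zeta4 sqrrN expr1n mul1r addrC.
Qed.

Let d_sqf := octic_sqfree T.
Let d_gt3 : (3 < d)%N.
Proof. by have := d_mod8 T; have := octic_gt2 T; lia. Qed.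

Let sqf1 := squarefree1.
Let sqf2 := squarefree2.
Let sqf2d := squarefree_double (octic_odd T) d_sqf.

Definition units_K : set Lx := [set x | is_unit x /\ inK (nzval x)].

Definition units_minus : set Lx := [set x | is_unit x /\ x + sgx T x = 0].

Lemma is_unitB (x y : Lx) : is_unit x -> is_unit y -> is_unit (x - y).
Proof.
by move=> [xO xV] [yO yV]; split; rewrite nz_valB; [apply: integral_mul | rewrite invf_div; apply: integral_mul].
Qed.

Lemma is_unit0 : is_unit (0 : Lx).
Proof. by split; rewrite nz_val0 ?invr1; apply: integral1. Qed.

Lemma units_K_subgroup : is_subgroup units_K.
Proof.
split; first by split; [apply: is_unit0 | apply: inK1].
move=> x y [xu xK] [yu yK]; split; first exact: is_unitB.
by rewrite nz_valB; apply: inKM => //; apply: inKV.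
Qed.

Lemma sgx0 : sgx T 0 = 0.
Proof. by apply: nz_inj; apply: rmorph1. Qed.

Lemma units_minus_subgroup : is_subgroup units_minus.
Proof.
split; first by split; [apply: is_unit0 | rewrite sgx0 addr0].
move=> x y [xu xK] [yu yK]; split; first exact: is_unitB.
by rewrite sgxB addrACA xK -opprD yK subr0.
Qed.

(* The four factors of v^4 lie in the four quadratic fields Q(delta) with
   prescribed behaviour under s. *)
Let q1 (v : L) := v * t v * r (v * t v).
Let q2 (v : L) := v * t v / r (v * t v).
Let q3 (v : L) := v / t v * r (v / t v).
Let q4 (v : L) := v / t v / r (v / t v).

Let q_prod v : v != 0 -> v ^+ 4 = q1 v * q2 v * q3 v * q4 v.
Proof.
move=> v0; rewrite /q1 /q2 /q3 /q4 !(fmorphV, rmorphM) /=; field.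
by rewrite !fmorph_eq0 v0.
Qed.

Let q_neq0 v : v != 0 -> [/\ q1 v != 0, q2 v != 0, q3 v != 0 & q4 v != 0].
Proof.
by move=> v0; rewrite /q1 /q2 /q3 /q4 !(mulf_neq0, invr_eq0, fmorph_eq0).
Qed.

Let q_t v : v != 0 -> [/\ t (q1 v) = q1 v, t (q2 v) = q2 v, t (q3 v) = (q3 v)^-1 & t (q4 v) = (q4 v)^-1].
Proof.
move=> v0; rewrite /q1 /q2 /q3 /q4 !(fmorphV, rmorphM) /= !tau_rho !tauK.
have n1 : t v != 0 by rewrite fmorph_eq0. have n2 : r v != 0 by rewrite fmorph_eq0.
have n3 : r (t v) != 0 by rewrite !fmorph_eq0.
by split; field; rewrite ?v0 ?n1 ?n2 ?n3.
Qed.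

Let q_r v : v != 0 -> [/\ r (q1 v) = q1 v, r (q2 v) = (q2 v)^-1, r (q3 v) = q3 v & r (q4 v) = (q4 v)^-1].
Proof.
move=> v0; rewrite /q1 /q2 /q3 /q4 !(fmorphV, rmorphM) /= !rhoK.
have n1 : t v != 0 by rewrite fmorph_eq0. have n2 : r v != 0 by rewrite fmorph_eq0.
have n3 : r (t v) != 0 by rewrite !fmorph_eq0.
by split; field; rewrite ?v0 ?n1 ?n2 ?n3.
Qed.

Let q_s v : s v = v -> [/\ s (q1 v) = q1 v, s (q2 v) = q2 v, s (q3 v) = q3 v & s (q4 v) = q4 v].
Proof.
by move=> e; rewrite /q1 /q2 /q3 /q4 !(fmorphV, rmorphM) /= !(sg_rho, sg_tau) e.
Qed.

Let q_sV v : v != 0 -> s v = v^-1 ->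
  [/\ s (q1 v) = (q1 v)^-1, s (q2 v) = (q2 v)^-1, s (q3 v) = (q3 v)^-1 & s (q4 v) = (q4 v)^-1].
Proof.
move=> v0 e; rewrite /q1 /q2 /q3 /q4 !(fmorphV, rmorphM) /= !(sg_rho, sg_tau) e !fmorphV.
have n1 : t v != 0 by rewrite fmorph_eq0. have n2 : r v != 0 by rewrite fmorph_eq0.
have n3 : r (t v) != 0 by rewrite !fmorph_eq0.
by split; field; rewrite v0 n1 n2 n3 ?oner_neq0.
Qed.

Let q_int (x : Lx) : is_unit x -> let v := nzval x in
  [/\ O (q1 v) /\ O (q1 v)^-1, O (q2 v) /\ O (q2 v)^-1, O (q3 v) /\ O (q3 v)^-1 & O (q4 v) /\ O (q4 v)^-1].
Proof.
move=> [vO vV] v.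
pose U y := O y /\ O y^-1.
have UM a b : U a -> U b -> U (a * b).
  by move=> [? ?] [? ?]; split; rewrite ?invfM; apply: integral_mul.
have UV a : U a -> U a^-1 by move=> [? ?]; split; rewrite ?invrK.
have Uf (f : {rmorphism L -> L}) a : U a -> U (f a).
  by move=> [? ?]; split; rewrite -?fmorphV; apply: integral_fmorph.
have Uv : U v by [].
have Ut := Uf t _ Uv.
have Uw : U (v * t v) by apply: UM.
have Uw' : U (v / t v) by apply/UM/UV.
split; [exact: UM Uw (Uf r _ Uw) | exact: UM Uw (UV _ (Uf r _ Uw))
 | exact: UM Uw' (Uf r _ Uw') | exact: UM Uw' (UV _ (Uf r _ Uw'))].
Qed.

Lemma fixed_unit v : v != 0 -> O v -> O v^-1 -> s v = v -> t v = v -> r v = v -> v ^+ 4 = 1.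
Proof.
move=> v0 vO vV sv tv rv; have [q qE] := fixed_rat sv tv rv.
have /intrP[m mE] : q \is a Num.int by apply: (rat_integral (L := L)); rewrite -qE.
have /intrP[n nE] : q^-1 \is a Num.int.
  by apply: (rat_integral (L := L)); rewrite -(in_algE L) fmorphV /= -qE.
have q0 : q != 0 by apply: contraNneq v0 => q0; rewrite qE q0 scale0r.
have mn : m * n = 1.
  by apply: (@intr_inj rat); rewrite rmorphM /= -mE -nE divff.
have m1 : absz m = 1%N by have /eqP := congr1 absz mn; rewrite abszM muln_eq1 => /andP[/eqP].
have m4 : m ^+ 4 = 1 by rewrite (exprM m 2 2) -(gez0_abs (sqr_ge0 m)) abszX m1.
rewrite qE -(in_algE L) -rmorphXn mE -rmorphXn m4; exact: (rmorph1 (in_alg L)).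
Qed.

Lemma nz_valMz (x : Lx) (k : int) : nzval (x *~ k) = nzval x ^ k.
Proof.
case: k => n; first by rewrite -pmulrn nz_valMn exprnP.
by rewrite NegzE -nmulrn nz_valN nz_valMn -exprz_inv -exprnP exprVn.
Qed.

Lemma torsion_finite n (A : set Lx) : exists l : seq Lx, forall x, A x -> x *+ n.+1 = 0 -> x \in l.
Proof.
have [|l lP] := @finite_roots L ('X^(n.+1) - 1%:P); first by rewrite -size_poly_eq0 size_XnsubC.
exists (pmap insub l) => x _ xn; rewrite mem_pmap_sub; apply: lP.
by rewrite /root !hornerE -nz_valMn xn subrr.
Qed.

Fact minus_one_neq0 : -1 != 0 :> L. Proof. by rewrite oppr_eq0 oner_eq0. Qed.

Definition nz_minus1 : Lx := Nonzero minus_one_neq0.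

Lemma nz_minus1_neq0 : nz_minus1 != 0.
Proof.
apply/eqP => /(congr1 (@nzval L)) /= /eqP; rewrite eq_sym -addr_eq0 -mulr2n.
by rewrite (negbTE (two_neq0 L)).
Qed.

Lemma nz_minus1_double : nz_minus1 + nz_minus1 = 0.
Proof. by apply: nz_inj; rewrite nz_valD /= mulrNN mulr1. Qed.

Lemma nz_2torsion (x : Lx) : x + x = 0 -> x = 0 \/ x = nz_minus1.
Proof.
move/(congr1 (@nzval L)) => /eqP; rewrite nz_valD nz_val0 -expr2 sqrf_eq1.
by case/orP=> /eqP e; [left | right]; apply: nz_inj.
Qed.

Lemma minus1_unit : is_unit nz_minus1.
Proof. by split; rewrite /= ?invrN1; apply: integral_opp; apply: integral1. Qed.

(** A Pell unit is a power of the fundamental one up to sign; the fourth power absorbs the sign. *)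
Lemma real_quadratic (D : nat) (delta : L) : squarefree D -> (1 < D)%N -> delta ^+ 2 = D%:R ->
  exists e : Lx, [/\ pell_unit D delta (nzval e), forall k : int, e *~ k = 0 -> k = 0 &
    forall v, pell_unit D delta v -> exists k : int, v ^+ 4 = nzval e ^ (k * 4)].
Proof.
move=> sD D1 dD.
have [X [Y [h X0 Y0 hv]]] := pell_fundamental dD (ltnW D1) (squarefree_int_nonsquare sD D1).
exists (Nonzero (pell_elt_neq0 dD h)); split=> /=.
- by exists X, Y.
- by move=> k /(congr1 (@nzval L)); rewrite nz_valMz /=; apply: (pell_elt_free dD).
- have f4 (x : L) : (- x) ^+ 4 = x ^+ 4 by ring.
  by move=> v /hv[k [->|->]]; exists k; rewrite ?f4 exprnP exprz_exp.
Qed.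

Lemma pell_unit_fixed (f : {rmorphism L -> L}) D delta v : pell_unit D delta v ->
  f delta = delta -> f v = v.
Proof.
by move=> [X [Y [-> _]]] fd; rewrite fmorph_div rmorphD rmorphM /= !rmorph_int fd rmorph_nat.
Qed.

Lemma pell_unit_inverted (f : {rmorphism L -> L}) D delta v : delta ^+ 2 = D%:R ->
  pell_unit D delta v -> f delta = - delta -> f v = v^-1.
Proof.
move=> dD [X [Y [-> h]]] fd; rewrite (pell_eltV dD h) /pell_elt.
by rewrite fmorph_div rmorphD rmorphM /= !rmorph_int fd rmorph_nat rmorphN /= mulNr mulrN.
Qed.

Let expM4 (a b c h : L) : (a * b * c * h) ^+ 4 = a ^+ 4 * b ^+ 4 * c ^+ 4 * h ^+ 4.
Proof. by rewrite !exprMn. Qed.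

(** For v in K the four factors of v^4 lie in Q, Q(sqrt 2), Q(i) and Q(sqrt(-2)). All but the second
    have fourth power 1, so v^16 is a power of one Pell unit: rank 1, and index 2^2. *)
Lemma index_units_K : has_index units_K (doubles_of units_K) 4.
Proof.
have [e [eP e_free eM]] := real_quadratic sqf2 isT s22.
have [eO eV] := pell_unit_integral s22 eP.
apply: (@index_doubles_of Lx units_K nz_minus1 1 (fun=> e) 16 units_K_subgroup _ nz_minus1_neq0
  nz_minus1_double _ _ isT _ _ (torsion_finite 15 units_K)).
- by split; [apply: minus1_unit | rewrite /= /inK rmorphN rmorph1].
- by move=> x _; apply: nz_2torsion.
- by move=> _; split; [split | apply: (pell_unit_fixed eP ss2)].
- move=> x [xU xK]; have x0 := nz_neq0 x; set v := nzval x in x0 xK.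
  have [[o1 o1'] [o2 o2'] [o3 o3'] [o4 o4']] := q_int xU.
  have [s1 s2' s3 s4] := q_s xK; have [t1 t2 t3 t4] := q_t x0; have [r1 r2 r3 r4] := q_r x0.
  have [n1 n2 n3 n4] := q_neq0 x0.
  have f1 : q1 v ^+ 4 = 1 by apply: fixed_unit.
  have f3 : q3 v ^+ 4 = 1.
    by apply: (@imaginary_unit 1 im) => //; [left | right | left].
  have f4 : q4 v ^+ 4 = 1.
    apply: (@imaginary_unit 2 (im * s2)) => //.
    + by rewrite exprMn im2 s22 mulN1r.
    + by left; rewrite rmorphM /= sim ss2.
    + by right; rewrite rmorphM /= tim ts2 mulNr.
    + by right; rewrite rmorphM /= rim rs2 mulrN.
  have p2 : pell_unit 2 s2 (q2 v).
    by apply: quadratic_unit => //; [left | left | right].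
  have [k kE] := eM _ p2.
  exists false, (fun=> k * 4); rewrite big_ord1 mulr0n add0r; apply: nz_inj.
  rewrite nz_valMn nz_valMz -kE -/v (exprM v 4 4) (q_prod x0) expM4 f1 f3 f4.
  by rewrite mul1r !mulr1.
- by move=> y; rewrite big_ord1 => /e_free y0 i; rewrite (ord1 i).
Qed.

Lemma units_minusE x : is_unit x -> units_minus x <-> s (nzval x) = (nzval x)^-1.
Proof.
move=> xU; split=> [[_ /eqP]|e].
  by rewrite addr_eq0 => /eqP xs; rewrite {2}xs nz_valN invrK.
by split=> //; apply: nz_inj; rewrite nz_valD /= e divff // nz_neq0.
Qed.

(** Since s inverts v, the four factors of v^4 now belong to the square roots of d, 2d, -d and -2d.
    The two real fields give rank 2, and index 2^3. The exception D = 3 of [imaginary_unit] is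
    excluded by d > 3 and by parity. *)
Lemma index_units_minus : has_index units_minus (doubles_of units_minus) 8.
Proof.
pose w2 := w * s2.
have w22 : w2 ^+ 2 = (2 * d)%:R by rewrite exprMn (sd2 T) s22 -natrM mulnC.
have sw2 : s w2 = - w2 by rewrite rmorphM /= sg_sd ss2 mulNr.
have tw2 : t w2 = w2 by rewrite rmorphM /= tau_sd ts2.
have rw2 : r w2 = - w2 by rewrite rmorphM /= rho_sd rs2 mulrN.
have d1 : (1 < d)%N by apply: ltn_trans (octic_gt2 T).
have dd1 : (1 < 2 * d)%N by rewrite mul2n -addnn ltn_addr.
have [e [eP e_free eM]] := real_quadratic d_sqf d1 (sd2 T).
have [e' [eP' e_free' eM']] := real_quadratic sqf2d dd1 w22.
have [eO eV] := pell_unit_integral (sd2 T) eP; have [eO' eV'] := pell_unit_integral w22 eP'.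
pose eps (i : 'I_2) := if i == ord0 then e else e'.
apply: (@index_doubles_of Lx units_minus nz_minus1 2 eps 16 units_minus_subgroup _ nz_minus1_neq0
  nz_minus1_double _ _ isT _ _ (torsion_finite 15 units_minus)).
- apply/units_minusE; first exact: minus1_unit.
  by rewrite /= rmorphN rmorph1 invrN1.
- by move=> x _; apply: nz_2torsion.
- move=> i; rewrite /eps; case: eqP => _; apply/units_minusE => //.
    exact: (pell_unit_inverted (sd2 T) eP (sg_sd T)).
  exact: (pell_unit_inverted w22 eP' sw2).
- move=> x [xU xm]; have x0 := nz_neq0 x; set v := nzval x in x0.
  have sv : s v = v^-1 by apply/units_minusE.
  have [[o1 o1'] [o2 o2'] [o3 o3'] [o4 o4']] := q_int xU.
  have [s1 s2' s3 s4] := q_sV x0 sv; have [t1 t2 t3 t4] := q_t x0; have [r1 r2 r3 r4] := q_r x0.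
  have [n1 n2 n3 n4] := q_neq0 x0.
  have d0 := ltnW d1.
  have p1 : pell_unit d w (q1 v).
    apply: quadratic_unit => //; first by rewrite eqz_nat -lt0n.
    + exact: sd2 T.
    + by right; rewrite sg_sd.
    + by left; rewrite tau_sd.
    + by left; rewrite rho_sd.
  have p2 : pell_unit (2 * d) w2 (q2 v).
    apply: quadratic_unit => //; first by rewrite eqz_nat -lt0n ltnW.
    + by right.
    + by left.
    + by right.
  have f3 : q3 v ^+ 4 = 1.
    apply: (@imaginary_unit d (im * w)) => //.
    + by apply/eqP => d3; have := d_gt3; rewrite d3.
    + by rewrite exprMn im2 (sd2 T) mulN1r.
    + by right; rewrite rmorphM /= sim sg_sd mulrN.
    + by right; rewrite rmorphM /= tim tau_sd mulNr.
    + by left; rewrite rmorphM /= rim rho_sd.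
  have f4 : q4 v ^+ 4 = 1.
    apply: (@imaginary_unit (2 * d) (im * w2)) => //; first exact: ltnW.
    + by apply/eqP => /(congr1 odd); rewrite oddM.
    + by rewrite exprMn im2 w22 mulN1r.
    + by right; rewrite rmorphM /= sim sw2 mulrN.
    + by right; rewrite rmorphM /= tim tw2 mulNr.
    + by right; rewrite rmorphM /= rim rw2 mulrN.
  have [k kE] := eM _ p1; have [k' kE'] := eM' _ p2.
  exists false, (fun i => if i == ord0 then k * 4 else k' * 4).
  rewrite big_ord_recl big_ord1 /eps /= mulr0n add0r; apply: nz_inj.
  rewrite nz_valMn nz_valD !nz_valMz -kE -kE' -/v (exprM v 4 4) (q_prod x0) expM4 f3 f4.
  by rewrite !mulr1.
- move=> y; rewrite big_ord_recl big_ord1 /eps /= => e0.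
  (* [rho] fixes e and inverts e', so multiplying a relation by its image under [rho] eliminates
     e'. *)
  have re : r (nzval e) = nzval e := pell_unit_fixed eP (rho_sd T).
  have re' : r (nzval e') = (nzval e')^-1 := pell_unit_inverted w22 eP' rw2.
  have y0 : y ord0 = 0.
    have : e *~ (y ord0 + y ord0) = 0.
      apply: nz_inj; have := congr1 (@nzval L) e0; rewrite nz_valD !nz_valMz nz_val0 => h.
      have := congr1 r h; rewrite rmorphM rmorph1 /= !rmorphXz ?unitfE ?nz_neq0 // re re' => h'.
      have ne := nz_neq0 e'.
      have h2 : nzval e' ^ (y (lift ord0 ord0)) * (nzval e')^-1 ^ (y (lift ord0 ord0)) = 1.
        by rewrite -expfzMl divff // exp1rz.
      by rewrite expfzDr ?nz_neq0 // -[LHS]mulr1 -{1}h2 mulrACA h h' mulr1.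
    by move/e_free; lia.
  move: e0; rewrite y0 mulr0z add0r => /e_free' y1 i.
  by case: (unliftP ord0 i) => [j ->|->//]; rewrite (ord1 j).
Qed.

End Units.

(** * Ambiguous classes *)

Lemma subr_interchange (V : zmodType) (x y u v : V) : x - y - (u - v) = x - u - (y - v).
Proof. by rewrite opprD addrACA -opprD. Qed.

Section AmbiguousClasses.

Variables (L : fieldExtType rat) (d : nat) (T : octic L d).
Local Notation s := (sg T).
Local Notation inK := (inK T).
Local Notation Lx := (nonzero L).
Local Notation ideals := (frac_ideal L).
Local Notation sgx := (sgx T).
Local Notation sgI := (sgI T).
Local Notation prin := (prin T).

(** In multiplicative terms: [NE] is N(E), [DE] is E^(s-1), [EKN] consists of the units of K that
    are norms of elements of L, and [EKEm] is E_K E^-. *)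
Let EK : set Lx := units_K T.
Let Em : set Lx := units_minus T.
Let E : set Lx := [set x | is_unit x].
Let NE : set Lx := [set u | exists2 x, is_unit x & u = x + sgx x].
Let DE : set Lx := [set u | exists2 x, is_unit x & u = sgx x - x].
Let EKN : set Lx := [set u | EK u /\ exists x, u = x + sgx x].
Let EKEm : set Lx := [set x | exists a b, [/\ EK a, Em b & x = a + b]].

Lemma is_unit_sgx x : is_unit x -> is_unit (sgx x).
Proof. by move=> [xO xV]; split; rewrite /= -?fmorphV; apply: integral_sg. Qed.

Lemma is_unitD (x y : Lx) : is_unit x -> is_unit y -> is_unit (x + y).
Proof.
move=> xU yU; rewrite -[y]opprK; apply: is_unitB => //; rewrite -[- y]add0r.
by apply: is_unitB => //; apply: is_unit0.
Qed.

Lemma is_unitN (x : Lx) : is_unit x -> is_unit (- x).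
Proof. by move=> xU; rewrite -[- x]add0r; apply: is_unitB => //; apply: is_unit0. Qed.

Lemma inK_sgx x : inK (nzval x) <-> sgx x = x.
Proof. by split=> [e|/(congr1 (@nzval L))//]; apply: nz_inj. Qed.

Let sE : is_subgroup E.
Proof. by split; [apply: is_unit0 | move=> x y; apply: is_unitB]. Qed.

Let sEK : is_subgroup EK := units_K_subgroup T.
Let sEm : is_subgroup Em := units_minus_subgroup T.

Let sNE : is_subgroup NE.
Proof.
split; first by exists 0; [apply: is_unit0 | rewrite sgx0 addr0].
move=> _ _ [x xU ->] [y yU ->]; exists (x - y); first exact: is_unitB.
by rewrite sgxB opprD addrACA.
Qed.

Let sDE : is_subgroup DE.
Proof.
split; first by exists 0; [apply: is_unit0 | rewrite sgx0 subr0].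
move=> _ _ [x xU ->] [y yU ->]; exists (x - y); first exact: is_unitB.
by rewrite sgxB subr_interchange.
Qed.

Let sEKN : is_subgroup EKN.
Proof.
split; first by split; [apply: subgroup0 | exists 0; rewrite sgx0 addr0].
move=> u v [uK [x xE]] [vK [y yE]]; split; first exact: subgroupB.
by exists (x - y); rewrite xE yE sgxB opprD addrACA.
Qed.

Let NE_EK x : NE x -> EK x.
Proof.
move=> [y yU ->]; split; first by apply: is_unitD => //; apply: is_unit_sgx.
by apply/inK_sgx; rewrite sgxD sgxK addrC.
Qed.

Let DE_Em x : DE x -> Em x.
Proof.
move=> [y yU ->]; split; first by apply: is_unitB => //; apply: is_unit_sgx.
by rewrite sgxB sgxK addrA subrK subrr.
Qed.

Let dEK_NE x : doubles_of EK x -> NE x.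
Proof. by move=> [y [yU /inK_sgx yK] ->]; exists y => //; rewrite yK. Qed.

Let Em_sgx x : Em x -> sgx x = - x.
Proof. by move=> [_ /eqP]; rewrite addrC addr_eq0 => /eqP. Qed.

Let dEm_DE x : doubles_of Em x -> DE x.
Proof.
move=> [y yE ->]; have [yU _] := yE; exists (- y); first exact: is_unitN.
by rewrite sgxN (Em_sgx yE) !opprK.
Qed.

(* The Herbrand quotient of the units is 1/2: (1 + s) and (1 - s) both identify
   E/(E_K E^-) with a quotient of squares. *)
Lemma unit_indices : exists q, has_index EK NE q /\ has_index Em DE (2 * q).
Proof.
have [q [m [iq im qm]]] := has_index_split sEK sNE (doubles_of_subgroup sEK) dEK_NE NE_EK (index_units_K T).
have [h [m' [ih im' hm]]] := has_index_split sEm sDE (doubles_of_subgroup sEm) dEm_DE DE_Em (index_units_minus T).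
(* If N(x) = a^2 with a a unit of K, then x / a has norm 1; so E_K E^- is the preimage of the
   squares of E_K. *)
have iE : has_index E EKEm m.
  apply: (has_index_corr (R := fun u x => is_unit x /\ u = x + sgx x)) im.
  - move=> u v x y [xU ->] [yU ->]; split; first exact: is_unitB.
    by rewrite sgxB opprD addrACA.
  - by move=> u [x xU ->]; exists x.
  - by move=> x xU; exists (x + sgx x) => //; exists x.
  - move=> u x [xU ->]; split=> [[a aK e]|[a [b [[aU /inK_sgx aK] bE ->]]]].
      have [aU /inK_sgx sa] := aK; exists a, (x - a); split=> //; last by rewrite addrC subrK.
      split; first exact: is_unitB.
      by rewrite sgxB sa addrACA e -opprD subrr.
    exists a; first by split=> //; apply/inK_sgx.
    by rewrite sgxD aK (Em_sgx bE) addrACA subrr addr0.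
(* If s(x) / x = b^2 with b in E^-, then x b is fixed by s; so the preimage of the squares of E^- is
   E_K E^- again. *)
have iD : has_index DE (doubles_of Em) m.
  apply: (has_index_corr (R := fun x u => is_unit x /\ u = sgx x - x)) iE.
  - move=> x y u v [xU ->] [yU ->]; split; first exact: is_unitB.
    by rewrite sgxB subr_interchange.
  - by move=> x xU; exists (sgx x - x) => //; exists x.
  - by move=> u [x xU ->]; exists x.
  - move=> x u [xU ->]; split=> [[a [b [[aU /inK_sgx aK] bE ->]]]|[b bE e]].
      exists (- b); first exact: subgroupN.
      by rewrite sgxD aK (Em_sgx bE) opprD addrACA subrr add0r.
    have [bU _] := bE; have sb := Em_sgx bE.
    exists (x + b), (- b); split; last by rewrite addrK.
      split; first exact: is_unitD.
      by apply/inK_sgx; rewrite sgxD sb -[sgx x](subrK x) e -addrA -[b + b + _]addrA addrCA addrC addrA addrK addrC.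
    exact: subgroupN.
have mm := has_index_uniq (doubles_of_subgroup sEm) im' iD; rewrite mm in hm.
exists q; split=> //.
(* The two factorisations are 4 = q m and 8 = h m. *)
have <- : h = (2 * q)%N.
  have m0 := has_index_gt0 (subgroup0 sE) iE.
  by apply/eqP; rewrite -(eqn_pmul2r m0) -hm -mulnA -qm.
by [].
Qed.

(** Modulo the principal ideals [P], [JJ] is C[2], [DP] is C^2, and [ambP] is the group of classes
    that contain an ambiguous ideal; [PG] consists of the principal ambiguous ideals. *)
Let P : set ideals := [set I | exists x, I = prin x].
Let JJ : set ideals := [set J | P (J + J)].
Let II : set ideals := [set: ideals].
Let DP : set ideals := [set J | exists A, P (J - (A + A))].
Let amb : set ideals := ambiguous T.
Let ambP : set ideals := [set J | exists A x, amb A /\ J = A + prin x].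
Let PG : set ideals := [set J | amb J /\ P J].

Let sP : is_subgroup P.
Proof.
split; first by exists 0; rewrite prin0.
by move=> _ _ [x ->] [y ->]; exists (x - y); rewrite prinB.
Qed.

Let sII : is_subgroup II. Proof. by []. Qed.

Let sJJ : is_subgroup JJ.
Proof.
split; first by rewrite /JJ /= addr0; apply: subgroup0.
by move=> I J PI PJ; rewrite /JJ /= addrACA -opprD; apply: subgroupB.
Qed.

Let sDP : is_subgroup DP.
Proof.
split; first by exists 0; rewrite addr0 subr0; apply: subgroup0.
move=> I J [A PA] [B PB]; exists (A - B).
have -> : I - J - (A - B + (A - B)) = I - (A + A) - (J - (B + B)).
  by rewrite [A - B + _]addrACA -opprD subr_interchange.
exact: subgroupB.
Qed.

Let samb : is_subgroup amb := ambiguous_subgroup T.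

Let sambP : is_subgroup ambP.
Proof.
split; first by exists 0, 0; split; [apply: subgroup0 | rewrite prin0 addr0].
move=> _ _ [A [x [sA ->]]] [B [y [sB ->]]]; exists (A - B), (x - y).
by split; [apply: subgroupB | rewrite prinB opprD addrACA].
Qed.

Let sPG : is_subgroup PG.
Proof.
split; first by split; apply: subgroup0.
by move=> I J [aI PI] [aJ PJ]; split; apply: subgroupB.
Qed.

Let P_JJ x : P x -> JJ x. Proof. by move=> Px; apply: subgroupD. Qed.

Let P_DP x : P x -> DP x. Proof. by move=> Px; exists 0; rewrite addr0 subr0. Qed.

Let P_ambP x : P x -> ambP x.
Proof. by move=> [y ->]; exists 0, y; split; [apply: subgroup0 | rewrite add0r]. Qed.

(** J s(J) is principal, so J^2 and J / s(J) differ by a principal ideal. *)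
Let JJ_sgI J : JJ J <-> exists x, J = sgI J + prin x.
Proof.
have [a aK e] := addr_sgI T J; split=> [[x xE]|[x xE]].
  by exists (x - a); rewrite prinB -xE -e opprD addrACA subrr add0r [RHS]addrC subrK.
by exists (x + a); rewrite prinD -e addrCA [prin x + _]addrC -xE.
Qed.

Let ambP_JJ x : ambP x -> JJ x.
Proof.
move=> [A [y [sA ->]]]; apply/JJ_sgI; exists (y - sgx y).
by rewrite sgID sA sgI_prin prinB -addrA; congr (_ + _); rewrite addrC subrK.
Qed.

(** If u s(u) = 1, then (1 + u) / s(1 + u) = u; for u = -1 the element sqrt d serves instead. *)
Lemma hilbert90 (u : Lx) : u + sgx u = 0 -> exists x, u = x - sgx x.
Proof.
move=> uN; have su : s (nzval u) = (nzval u)^-1.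
  have /(congr1 (@nzval L)) : sgx u = - u by apply/eqP; rewrite -addr_eq0 addrC uN.
  by [].
have u0 := nz_neq0 u.
have [u1|u1] := eqVneq (1 + nzval u) 0.
  exists (Nonzero (sd_neq0 T)); apply: nz_inj; rewrite nz_valB /= sg_sd.
  by rewrite invrN mulrN divff ?sd_neq0 //; apply/eqP; rewrite -addr_eq0 addrC u1.
exists (Nonzero u1); apply: nz_inj; rewrite nz_valB /= rmorphD rmorph1 /= su.
by field; rewrite u0 /= addrC u1.
Qed.

(** Take J = (1, x). Then x s(J) = (x, x s(x)) = (x, 1) = J, because x s(x) is a unit. *)
Lemma norm_one_ideal (x : Lx) : is_unit (x + sgx x) -> exists J : ideals, J = sgI J + prin x.
Proof.
move=> [uO uV]; set u := nzval _ in uO uV.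
have uE : u = nzval x * s (nzval x) by [].
pose S : set L := [set y | exists a b, [/\ is_integral a, is_integral b & y = a + b * nzval x]].
have subS : is_submodule S.
  split.
  - by exists 0, 0; split; [apply: integral0 | apply: integral0 | ring].
  - move=> _ _ [a [b [aO bO ->]]] [a' [b' [aO' bO' ->]]].
    by exists (a + a'), (b + b'); split; [apply: integral_add | apply: integral_add | ring].
  - move=> c _ cO [a [b [aO bO ->]]].
    by exists (c * a), (c * b); split; [apply: integral_mul | apply: integral_mul | ring].
have [n n0 nx] := integral_denom T (nzval x).
have fS : is_fractional S.
  split=> //; exists n%:R; split; [by rewrite natrL_eq0 -lt0n | exact: integral_nat |].
  move=> _ [a [b [aO bO ->]]]; rewrite mulrDr mulrCA.
  by apply: integral_add; apply: integral_mul => //; apply: integral_nat.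
have S1 : S 1 by exists 1, 0; split; [apply: integral1 | apply: integral0 | ring].
have [|J JS] := frac_ideal_exists T fS; first by exists 1; [| apply: oner_neq0].
exists J; apply: frac_ideal_eq; rewrite ideal_setD ideal_mulC /= (_ : ideal_set J = S) //.
have -> : ideal_mul (prin_set x) [set s y | y in S] = [set nzval x * y | y in [set s y | y in S]].
  rewrite ideal_mulC /prin_set scale_mul ideal_mulC ideal_mul1 //.
  exact: submodule_image_sg.
have x0 := nz_neq0 x; have sx0 : s (nzval x) != 0 by rewrite fmorph_eq0.
apply/seteqP; split.
  move=> _ [a [b [aO bO ->]]]; exists (s (s b + s a * u^-1 * nzval x)).
    exists (s b + s a * u^-1 * nzval x) => //; exists (s b), (s a * u^-1).
    by split=> //; [exact: integral_sg | apply: integral_mul => //; apply: integral_sg].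
  rewrite rmorphD !rmorphM fmorphV /= !sgK uE rmorphM /= sgK; field.
  by rewrite x0 sx0.
move=> _ [_ [_ [a [b [aO bO ->]]] <-] <-].
exists (s b * u), (s a); split; [by apply: integral_mul => //; apply: integral_sg | exact: integral_sg |].
by rewrite rmorphD rmorphM /= uE; ring.
Qed.

Variable e : nat.
Hypothesis index_norm : has_index EK EKN (2 ^ e).

(** [II]/[DP] is C/C^2. Its order is that of C[2] = [JJ]/[P] because C is finite, and C[2] is then
    cut at the classes [ambP] of ambiguous ideals. *)
Lemma index_doubles_class :
  exists2 n, has_index II DP (2 ^ n) & (n + e + 1)%N = (4 * size (primes d))%N.
Proof.
have [N iN] := class_group_finite T.
have [a [c [iIJ iJP Nac]]] := has_index_split sII sJJ sP P_JJ (fun _ _ => I) iN.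
have [a' [b' [iID iDP Nab]]] := has_index_split sII sDP sP P_DP (fun _ _ => I) iN.
(* Squaring maps C onto C^2 with kernel C[2]. *)
have iDP' : has_index DP P a.
  apply: (has_index_corr (R := fun J J' => P (J' - (J + J)))) iIJ.
  - move=> x y x' y' Px Py.
    have -> : x' - y' - (x - y + (x - y)) = x' - (x + x) - (y' - (y + y)).
      by rewrite [x - y + _]addrACA -opprD subr_interchange.
    exact: subgroupB.
  - by move=> x _; exists (x + x); [exists x; rewrite subrr; apply: subgroup0 | rewrite subrr; apply: subgroup0].
  - by move=> x' [A PA]; exists A.
  - move=> x x' Px; split=> h; first by rewrite -[x'](subrK (x + x)); apply: subgroupD.
    by rewrite /JJ /= -[x + x](subKr x'); apply: subgroupB.
have ab : a = b' := has_index_uniq sP iDP' iDP.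
have a0 : (0 < a)%N := has_index_gt0 (subgroup0 sII) iIJ.
have ca : a' = c.
  by apply/eqP; rewrite -(eqn_pmul2l a0) {1}ab mulnC -Nab Nac.
have [m [k [iJa iaP cmk]]] := has_index_split sJJ sambP sP P_ambP ambP_JJ iJP.
(* The generator x of J / s(J) is fixed only up to a unit, hence a relation in place of a map. If
   N(x) = N(v) for a unit v, then x / v = y / s(y), and J / (y) is ambiguous. *)
have iEN : has_index EKN NE m.
  apply: (has_index_corr (R := fun J u => exists x, J = sgI J + prin x /\ u = x + sgx x)) iJa.
  - move=> I J u v [x [xE ->]] [y [yE ->]]; exists (x - y); split.
      by rewrite {1}xE {1}yE sgIB prinB opprD addrACA.
    by rewrite sgxB opprD addrACA.
  - move=> J /JJ_sgI[x xE]; exists (x + sgx x); last by exists x.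
    split; last by exists x.
    split; last by apply/inK_sgx; rewrite sgxD sgxK addrC.
    apply/(prin_eq0 T); rewrite prinD -sgI_prin.
    have -> : prin x = J - sgI J by rewrite {1}xE addrC addKr.
    by rewrite sgIB sgIK addrA subrK subrr.
  - move=> u [[uU _] [x uE]]; rewrite uE in uU.
    by have [J JE] := norm_one_ideal uU; exists J; [apply/JJ_sgI; exists x | exists x].
  - move=> J u [x [xE ->]]; split.
      move=> [A [y [sA JE]]].
      have uV : is_unit (x - (y - sgx y)).
        apply/(prin_eq0 T); rewrite !prinB.
        have -> : prin x = J - sgI J by rewrite {1}xE addrC addKr.
        rewrite JE sgID (sA : sgI A = A) sgI_prin opprD addrACA subrr add0r.
        by rewrite subrr.
      exists (x - (y - sgx y)) => //.
      by rewrite !sgxB sgxK addrACA -opprD [y - _ + _]addrA subrK subrr subr0.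
    move=> [v vU vN].
    have [y yE] : exists y, x - v = y - sgx y.
      by apply: hilbert90; rewrite sgxB addrACA vN -opprD subrr.
    have pv : prin v = 0 by apply/prin_eq0.
    exists (J - prin y), y; split; last by rewrite subrK.
    rewrite /amb /ambiguous /= sgIB sgI_prin.
    have xE' : prin x = prin y - prin (sgx y) by rewrite -prinB -yE prinB pv subr0.
    by rewrite [in RHS]xE xE' addrA addrAC addrK.
(* The ambiguous ideal in a class of [ambP] is unique up to principal ambiguous ideals. *)
have iaG : has_index amb PG k.
  apply: (has_index_corr (R := fun J J' => amb J' /\ P (J - J'))) iaP.
  - move=> x y x' y' [ax Px] [ay Py]; split; first exact: subgroupB.
    rewrite subr_interchange.
    exact: subgroupB.
  - move=> _ [A [x [sA ->]]]; exists A => //; split=> //.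
    by rewrite addrC addrA addNr add0r; exists x.
  - move=> A sA; exists A; last by split=> //; rewrite subrr; apply: subgroup0.
    by exists A, 0; rewrite prin0 addr0.
  - move=> x x' [sx Px]; split=> [h|[_ h]].
      by split=> //; rewrite -(subKr x x'); apply: subgroupB.
    by rewrite -(subrK x' x); apply: subgroupD.
have KPG x : prinK T x -> PG x.
  move=> [b bK ->]; split; last by exists b.
  by rewrite /amb /ambiguous /= sgI_prin; congr prin; apply/inK_sgx.
have [k2 [l [iaG' iGK kl]]] :=
  has_index_split samb sPG (prinK_subgroup T) KPG (fun x h => proj1 h) (index_ambiguous_prinK T).
have kk : k2 = k := has_index_uniq sPG iaG' iaG.
(* A principal ambiguous ideal (x) gives the unit s(x) / x in E^-. This unit is s(v) / v for a unit
   v exactly when x / v, another generator, lies in K. *)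
have iED : has_index Em DE l.
  apply: (has_index_corr (R := fun J u => exists x, [/\ J = prin x, amb J & u = sgx x - x])) iGK.
  - move=> I J u v [x [-> aI ->]] [y [-> aJ ->]]; exists (x - y); split.
    + by rewrite prinB.
    + exact: subgroupB.
    + by rewrite sgxB subr_interchange.
  - move=> J [aJ [x xE]]; exists (sgx x - x); last by exists x.
    split; last by rewrite sgxB sgxK addrA subrK subrr.
    apply/(prin_eq0 T); rewrite prinB -sgI_prin -xE (aJ : sgI J = J) subrr //.
  - move=> u [uU uN]; have [x xE] := hilbert90 uN.
    exists (prin (- x)); last first.
      exists (- x); split=> //; last by rewrite sgxN opprK addrC.
      rewrite /amb /ambiguous /= sgI_prin sgxN; apply/eqP; rewrite -subr_eq0 -prinB opprK addrC -xE.
      by apply/eqP/prin_eq0.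
    split; last by exists (- x).
    rewrite /amb /ambiguous /= sgI_prin sgxN; apply/eqP; rewrite -subr_eq0 -prinB opprK addrC -xE.
    by apply/eqP/prin_eq0.
  - move=> J u [x [JE aJ ->]]; split.
      move=> [b /inK_sgx bK JE']; exists (x - b).
        by apply/(prin_eq0 T); rewrite prinB -JE -JE' subrr.
      by rewrite sgxB bK opprD opprK addrACA addNr addr0.
    move=> [v vU vE]; exists (x - v).
      by apply/inK_sgx; rewrite sgxB; apply/eqP; rewrite -subr_eq0 subr_interchange vE subrr.
    by rewrite prinB (proj2 (prin_eq0 T v) vU) subr0.
have [q [iq ih]] := unit_indices.
have lq : l = (2 * q)%N := has_index_uniq sDE iED ih.
have NE_EKN x : NE x -> EKN x.
  by move=> xN; split; [apply: NE_EK | case: xN => y _ ->; exists y].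
have qe : q = (2 ^ e * m)%N.
  apply: (has_index_uniq sNE iq).
  exact: (has_indexM sEK sEKN sNE NE_EKN (fun x h => proj1 h) index_norm iEN).
(* Here c = m k, l = 2 q and q = 2^e m, while k l is the number of ambiguous ideals modulo K; the
   factor m cancels. *)
have ce : (c * 2 ^ e.+1)%N = (2 ^ (4 * size (primes d)))%N.
  by rewrite kl kk lq qe cmk expnS; nia.
have /dvdn_pfactor[] // : (c %| 2 ^ (4 * size (primes d)))%N by rewrite -ce dvdn_mulr.
move=> n _ cn; exists n; first by rewrite -cn -ca.
by move: ce; rewrite cn -expnD => /(expnI (isT : (1 < 2)%N)); rewrite addnS addn1.
Qed.

End AmbiguousClasses.

(** * Return to the index and the class group of the statement *)

Lemma has_index_of_index_eq (L : fieldType) (G H : set L) (G' H' : set (nonzero L)) n :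
  is_subgroup H' -> (forall x : nonzero L, G' x <-> G (nzval x)) ->
  (forall x : nonzero L, H' x <-> H (nzval x)) -> (forall x, G x -> x != 0) ->
  (forall x, H x -> x != 0) -> index_eq G H n -> has_index G' H' n.
Proof.
move=> sH' GG' HH' G0 H0 /card_set_bijP[f [f_fun f_inj f_surj]].
pose coset (x : L) : set L := [set x * h | h in H].
have cosetE (x y : nonzero L) : coset (nzval x) = coset (nzval y) <-> H' (x - y).
  split=> [e|Hxy].
    (* A coset contains its representative because 1 lies in H; equality of cosets then yields the
       congruence. *)
    have : coset (nzval x) (nzval x).
      exists 1; last by rewrite mulr1.
      by rewrite -[1]/(nzval (0 : nonzero L)); apply/HH'; apply: subgroup0.
    rewrite e => -[h hH hx]; apply/HH'; rewrite nz_valB -hx mulrAC divff ?nz_neq0 // mul1r //.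
  have sub (u v : nonzero L) : H' (u - v) -> coset (nzval u) `<=` coset (nzval v).
    move=> Huv _ [h hH <-]; exists (nzval u / nzval v * h).
      have Hh : H' (Nonzero (H0 _ hH)) by apply/HH'.
      by have /HH' := subgroupD sH' Huv Hh.
    by rewrite mulrA mulrCA divff ?nz_neq0 // mulr1.
  by apply/seteqP; split; apply: sub => //; apply: subgroupBC.
have [t tP] : exists t : 'I_n -> nonzero L, forall i, G' (t i) /\ f (coset (nzval (t i))) = i.
  have ex (i : 'I_n) : exists x : nonzero L, G' x /\ f (coset (nzval x)) = i.
    have [C [x Gx <-] fC] := f_surj i (ltn_ord i).
    by exists (Nonzero (G0 _ Gx)); split=> //; apply/GG'.
  by have [t tP] := choice ex; exists t.
have cG x : G' x -> [set [set x * h | h in H] | x in G] (coset (nzval x)).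
  by move=> /GG' Gx; exists (nzval x).
exists 'I_n, t; split.
- exact: card_ord.
- by move=> i; case: (tP i).
- move=> i j /cosetE e; have [_ fi] := tP i; have [_ fj] := tP j.
  by apply: val_inj; rewrite /= -fi -fj e.
- move=> x Gx; have lt : (f (coset (nzval x)) < n)%N by apply: f_fun; apply: cG.
  exists (Ordinal lt); apply/cosetE; have [Gt ft] := tP (Ordinal lt).
  by apply: f_inj; rewrite ?inE; [apply: cG | apply: cG | rewrite ft].
Qed.

Theorem theorem4p10 (d : nat) (L : splittingFieldType rat) (zeta8 sqrtd : L)
    (K : {subfield L}) (e : nat)
    (d_gt2 : (2 < d)%N) (d_odd : odd d) (d_sqfree : squarefree d)
    (d_primes : forall p : nat, prime p -> (p %| d)%N -> (p = 1 %[mod 8])%N)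
    (zeta8P : 8.-primitive_root zeta8) (sqrtdP : sqrtd ^+ 2 = d%:R)
    (KE : K = <<1; zeta8>>%AS) (LE : <<K; sqrtd>>%VS = fullv)
    (eE : index_eq (unit_group K) (unit_group K `&` norm_group K) (2 ^ e)) :
  let r := size (primes d) in
  exists2 r2 : nat, two_rank_eq (class_group L) r2
                  & r2%:Z = 4 * r%:Z - 1 - e%:Z.
Proof.
move=> r; have [T [KP normP]] := octic_exists d_gt2 d_odd d_sqfree d_primes zeta8P sqrtdP KE LE.
pose EK := units_K T; pose EKN : set (nonzero L) := [set u | EK u /\ exists x, u = x + sgx T x].
have EKP (x : nonzero L) : EK x <-> unit_group K (nzval x).
  split=> [[[xO xV] xK]|[xK x0 xO xV]].
    by split=> //; [apply/KP | apply: nz_neq0].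
  by split; [split | apply/KP].
have iN : has_index EK EKN (2 ^ e).
  apply: (has_index_of_index_eq _ EKP _ _ _ eE).
  - split; first by split; [apply: (subgroup0 (units_K_subgroup T)) | exists 0; rewrite sgx0 addr0].
    move=> u v [uK [x xE]] [vK [y yE]]; split; first exact: (subgroupB (units_K_subgroup T)).
    by exists (x - y); rewrite xE yE sgxB opprD addrACA.
  - move=> u; split=> [[uK [x xE]]|[uK [x x0 xE]]].
      split; first exact/EKP.
      by exists (nzval x); [apply: nz_neq0 | rewrite normP xE].
    split; first exact/EKP.
    by exists (Nonzero x0); apply: nz_inj; rewrite /= -xE normP.
  - by move=> x [].
  - by move=> x [[]].
have [n iD ne] := index_doubles_class iN.
exists n; last by rewrite /r; lia.
apply: two_rank_of_index.
pose p (I : frac_ideal L) : class_group L := \pi_(class_group L)%qT I.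
have pB I J : p (I - J) = p I - p J by rewrite /p raddfB.
have pD I J : p (I + J) = p I + p J by rewrite /p raddfD.
have p0 I : p I = 0 <-> exists x, I = prin T x.
  have -> : 0 = p 0 by rewrite /p raddf0.
  rewrite -principalP; split=> [/eqP|Ip].
    by rewrite /p -Quotient.idealrBE subr0.
  by apply/eqP; rewrite /p -Quotient.idealrBE subr0.
have pS c : exists I, p I = c by exists (repr c); apply: reprK.
(* The index of [DP] in the group of ideals is carried to the class group along the projection [p],
   whose kernel consists of the principal ideals. *)
apply: (has_index_corr (R := fun I c => c = p I)) iD.
- by move=> I J c c' -> ->; rewrite pB.
- by move=> I _; exists (p I).
- by move=> c _; have [I <-] := pS c; exists I.
- move=> I c ->; split=> [[A /p0 hA]|[y yE]].
    by exists (p A); move: hA => /eqP; rewrite pB pD subr_eq0 => /eqP.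
  have [A AE] := pS y; exists A; apply/p0.
  by rewrite pB pD AE yE subrr.
Qed.
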